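(* Let $\hat{y} \in C_{\diamond}^1([a,b],\mathbb{R})$ be an extremizer for the delta-nabla isoperimetric problem of extremizing $$\mathcal{L}(y) = \left(\int_a^b L_{\Delta}[y](t)\, \Delta t\right)\left(\int_a^b L_{\nabla}\{y\}(t)\, \nabla t\right)$$ over $y \in C_{\diamond}^{1}([a,b], \mathbb{R})$ subject to $y(a)=\alpha$, $y(b)=\beta$ and $$\mathcal{K}(y) = \left(\int_a^b K_{\Delta}[y](t)\, \Delta t\right)\left(\int_a^b K_{\nabla}\{y\}(t)\, \nabla t\right)=k .$$ Then there exist two real constants $\lambda_0$ and $\lambda$, not both zero, such that $\hat{y}$ satisfies both of the following delta-nabla integral equations (each for some real constant on the right-hand side, independent of $t$): $$\begin{aligned} &\lambda_0\left\{\mathcal{L}_\nabla(\hat{y}) \left(\partial_3 L_\Delta[\hat{y}](\rho(t)) -\int_{a}^{\rho(t)} \partial_2 L_\Delta[\hat{y}](\tau)\, \Delta\tau\right) + \mathcal{L}_\Delta(\hat{y}) \left(\partial_3 L_\nabla\{\hat{y}\}(t) -\int_{a}^{t} \partial_2 L_\nabla\{\hat{y}\}(\tau)\, \nabla\tau\right)\right\} \\ &\quad -\lambda\left\{\mathcal{K}_\nabla(\hat{y}) \left(\partial_3 K_\Delta[\hat{y}](\rho(t)) -\int_{a}^{\rho(t)} \partial_2 K_\Delta[\hat{y}](\tau)\, \Delta\tau\right) + \mathcal{K}_\Delta(\hat{y}) \left(\partial_3 K_\nabla\{\hat{y}\}(t) -\int_{a}^{t} \partial_2 K_\nabla\{\hat{y}\}(\tau)\,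 \nabla\tau\right)\right\} = \text{const} \quad \forall t \in [a,b]_\kappa ; \end{aligned}$$ $$\begin{aligned} &\lambda_0\left\{\mathcal{L}_\nabla(\hat{y}) \left(\partial_3 L_\Delta[\hat{y}](t) -\int_{a}^{t} \partial_2 L_\Delta[\hat{y}](\tau)\, \Delta\tau\right) + \mathcal{L}_\Delta(\hat{y}) \left(\partial_3 L_\nabla\{\hat{y}\}(\sigma(t)) -\int_{a}^{\sigma(t)} \partial_2 L_\nabla\{\hat{y}\}(\tau)\, \nabla\tau\right)\right\} \\ &\quad -\lambda \left\{\mathcal{K}_\nabla(\hat{y}) \left(\partial_3 K_\Delta[\hat{y}](t) -\int_{a}^{t} \partial_2 K_\Delta[\hat{y}](\tau)\, \Delta\tau\right) + \mathcal{K}_\Delta(\hat{y}) \left(\partial_3 K_\nabla\{\hat{y}\}(\sigma(t)) -\int_{a}^{\sigma(t)} \partial_2 K_\nabla\{\hat{y}\}(\tau)\, \nabla\tau\right)\right\}= \text{const} \quad \forall t \in [a,b]^\kappa . \end{aligned}$$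
   Context: Time-scale setting. $\mathbb{T}$ is a time scale (nonempty closed subset of $\mathbb{R}$) with forward jump operator $\sigma$, backward jump operator $\rho$, delta derivative $y^\Delta$, nabla derivative $y^\nabla$, and the usual delta and nabla integrals $\int \cdot\,\Delta t$, $\int\cdot\,\nabla t$. Points $a,b\in\mathbb{T}$ satisfy $a<b$ and $(\mathbb{T}\setminus\{a,b\})\cap[a,b]\neq\emptyset$. Intervals $[a,b]$ are time-scale intervals, i.e. intersected with $\mathbb{T}$. $[a,b]^\kappa$ is $[a,b]$ with $b$ removed if $b$ is left-scattered ($\rho(b)<b$), and $[a,b]^\kappa=[a,b]$ otherwise; $[a,b]_\kappa$ is $[a,b]$ with $a$ removed if $a$ is right-scattered ($\sigma(a)>a$), and $[a,b]_\kappa=[a,b]$ otherwise; $[a,b]^\kappa_\kappa=[a,b]^\kappa\cap[a,b]_\kappa$. Write $y^\sigma=y\circ\sigma$, $y^\rho=y\circ\rho$. Data. $L_\Delta,L_\nabla,K_\Delta,K_\nabla:\mathbb{T}\times\mathbb{R}^2\to\mathbb{R}$ are given smooth functions; $\partial_i$ denotes the partial derivative with respect to the $i$-th argument. $\alpha,\beta,k$ are given real numbers. Notation. $[y](t):=(t,y^\sigma(t),y^\Delta(t))$ and $\{y\}(t):=(t,y^\rho(t),y^\nabla(t))$; thus $L_\Delta[y](t)=L_\Delta(t,y^\sigma(t),y^\Delta(t))$, $\partial_i L_\nabla\{y\}(t)=\partial_i L_\nabla(t,y^\rho(t),y^\nabla(t))$, etc. Also $$\mathcal{L}_\Delta(y)=\int_a^b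 L_\Delta[y](t)\,\Delta t,\quad \mathcal{L}_\nabla(y)=\int_a^b L_\nabla\{y\}(t)\,\nabla t,\quad \mathcal{K}_\Delta(y)=\int_a^b K_\Delta[y](t)\,\Delta t,\quad \mathcal{K}_\nabla(y)=\int_a^b K_\nabla\{y\}(t)\,\nabla t,$$ so $\mathcal{L}=\mathcal{L}_\Delta\mathcal{L}_\nabla$ and $\mathcal{K}=\mathcal{K}_\Delta\mathcal{K}_\nabla$. $C_{\diamond}^1([a,b],\mathbb{R})$ is the class of functions $y:[a,b]\to\mathbb{R}$ with $y^\Delta$ continuous on $[a,b]^\kappa$ and $y^\nabla$ continuous on $[a,b]_\kappa$. Put $\|y\|_\infty:=\sup_{t\in[a,b]^\kappa_\kappa}|y(t)|$ and $\|y\|_{1,\infty}:=\|y^\sigma\|_\infty+\|y^\rho\|_\infty+\|y^\Delta\|_\infty+\|y^\nabla\|_\infty$. Weak local extremizer. A function $\hat y\in C_{\diamond}^1([a,b],\mathbb{R})$ (itself satisfying the boundary conditions and the constraint) is a weak local minimizer (respectively maximizer) of the isoperimetric problem if there is $\delta>0$ such that $\mathcal{L}(\hat y)\le\mathcal{L}(y)$ (respectively $\mathcal{L}(\hat y)\ge\mathcal{L}(y)$) for all $y\in C_{\diamond}^1([a,b],\mathbb{R})$ with $y(a)=\alpha$, $y(b)=\beta$, $\mathcal{K}(y)=k$ and $\|y-\hat y\|_{1,\infty}<\delta$. An extremizer is a weak local minimizer or a weak local maximizer.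
   Formalization: The first equation at left-dense right-scattered t is asserted only if ∂₃L_Δ[ŷ] and ∂₃K_Δ[ŷ] are continuous at t, and the second at right-dense left-scattered t only if ∂₃L_∇{ŷ} and ∂₃K_∇{ŷ} are; unguarded, the claim fails, e.g. on [0,1]∪{2}. *)

(* Defs.v *)
From Stdlib Require Import Reals ClassicalEpsilon.
From Coquelicot Require Import Coquelicot.
Open Scope R_scope.

(** * Time scales

    A time scale is a set [T : R -> Prop].  A function on [T] is represented by
    a total function [R -> R]; only its values on [T] matter below. *)

Definition time_scale (T : R -> Prop) : Prop := (exists t, T t) /\ closed T.

(** Conventions: [sigma_ts T t = t] if [t] is the maximum of [T], and
    [rho_ts T t = t] if [t] is the minimum of [T]. *)
Definition sigma_ts (T : R -> Prop) (t : R) : R :=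
  if excluded_middle_informative (exists s, T s /\ t < s)
  then real (Glb_Rbar (fun s => T s /\ t < s)) else t.

Definition rho_ts (T : R -> Prop) (t : R) : R :=
  if excluded_middle_informative (exists s, T s /\ s < t)
  then real (Lub_Rbar (fun s => T s /\ s < t)) else t.

(** [T^kappa]: the maximum is removed if it is left-scattered. *)
Definition upper_kappa (T : R -> Prop) (t : R) : Prop :=
  T t /\ ~ ((forall s, T s -> s <= t) /\ rho_ts T t < t).

(** [T_kappa]: the minimum is removed if it is right-scattered. *)
Definition lower_kappa (T : R -> Prop) (t : R) : Prop :=
  T t /\ ~ ((forall s, T s -> t <= s) /\ t < sigma_ts T t).

Definition both_kappa (T : R -> Prop) (t : R) : Prop :=
  upper_kappa T t /\ lower_kappa T t.

Definition left_dense_right_scattered (T : R -> Prop) (t : R) : Prop :=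
  rho_ts T t = t /\ t < sigma_ts T t.

Definition right_dense_left_scattered (T : R -> Prop) (t : R) : Prop :=
  sigma_ts T t = t /\ rho_ts T t < t.

Definition is_delta_derive (T : R -> Prop) (y : R -> R) (t l : R) : Prop :=
  forall eps : posreal, locally t (fun s => T s ->
    Rabs (y (sigma_ts T t) - y s - l * (sigma_ts T t - s))
      <= eps * Rabs (sigma_ts T t - s)).

Definition is_nabla_derive (T : R -> Prop) (y : R -> R) (t l : R) : Prop :=
  forall eps : posreal, locally t (fun s => T s ->
    Rabs (y (rho_ts T t) - y s - l * (rho_ts T t - s))
      <= eps * Rabs (rho_ts T t - s)).

(** The derivatives and integrals are total functions, with an unspecified
    value where the defining property has no witness. *)
Definition delta_derive (T : R -> Prop) (y : R -> R) (t : R) : R :=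
  epsilon (inhabits 0) (is_delta_derive T y t).

Definition nabla_derive (T : R -> Prop) (y : R -> R) (t : R) : R :=
  epsilon (inhabits 0) (is_nabla_derive T y t).

(** The integrals are the Cauchy integrals, i.e. increments of
    antiderivatives. *)
Definition is_delta_int (T : R -> Prop) (f : R -> R) (r s v : R) : Prop :=
  exists F : R -> R,
    (forall t, upper_kappa T t -> is_delta_derive T F t (f t)) /\
    v = F s - F r.

Definition is_nabla_int (T : R -> Prop) (f : R -> R) (r s v : R) : Prop :=
  exists F : R -> R,
    (forall t, lower_kappa T t -> is_nabla_derive T F t (f t)) /\
    v = F s - F r.

Definition delta_int (T : R -> Prop) (f : R -> R) (r s : R) : R :=
  epsilon (inhabits 0) (is_delta_int T f r s).

Definition nabla_int (T : R -> Prop) (f : R -> R) (r s : R) : R :=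
  epsilon (inhabits 0) (is_nabla_int T f r s).

(** The interval [[a,b]] of [T].  It is itself a time scale; all operators
    below are taken with respect to it, so that [sigma_ts] and [rho_ts] map [[a,b]]
    to itself and apply to functions defined on [[a,b]] only.  For [a], [b] in
    [T] this changes the jump operators of [T] only in [sigma(b) = b] and
    [rho(a) = a]. *)
Definition ts_interval (T : R -> Prop) (a b : R) (t : R) : Prop :=
  T t /\ a <= t <= b.

(** * The class [C^1_diamond] and its norm *)

Definition C1_diamond (I : R -> Prop) (y : R -> R) : Prop :=
  (forall t, upper_kappa I t -> exists l, is_delta_derive I y t l) /\
  (forall t, lower_kappa I t -> exists l, is_nabla_derive I y t l) /\
  continuous_on (upper_kappa I) (delta_derive I y) /\
  continuous_on (lower_kappa I) (nabla_derive I y).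

Definition norm_inf (I : R -> Prop) (y : R -> R) : Rbar :=
  Lub_Rbar (fun r => exists t, both_kappa I t /\ r = Rabs (y t)).

Definition norm_1_inf (I : R -> Prop) (y : R -> R) : Rbar :=
  Rbar_plus
    (Rbar_plus (norm_inf I (fun t => y (sigma_ts I t)))
               (norm_inf I (fun t => y (rho_ts I t))))
    (Rbar_plus (norm_inf I (delta_derive I y))
               (norm_inf I (nabla_derive I y))).

(** * Lagrangians *)

Definition partial2 (L : R -> R -> R -> R) (t x v : R) : R :=
  Derive (fun x' => L t x' v) x.

Definition partial3 (L : R -> R -> R -> R) (t x v : R) : R :=
  Derive (fun v' => L t x v') v.

Definition jointly_continuous (T : R -> Prop) (L : R -> R -> R -> R) : Prop :=
  continuous_on (fun p : R * (R * R) => T (fst p))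
    (fun p : R * (R * R) => L (fst p) (fst (snd p)) (snd (snd p))).

(** Smoothness of a function on [T * R^2]: it is continuous, and its partial
    derivatives in the second and third arguments exist and are continuous. *)
Definition smooth_lagrangian (T : R -> Prop) (L : R -> R -> R -> R) : Prop :=
  (forall t x v, T t -> ex_derive (fun x' => L t x' v) x) /\
  (forall t x v, T t -> ex_derive (fun v' => L t x v') v) /\
  jointly_continuous T L /\
  jointly_continuous T (partial2 L) /\
  jointly_continuous T (partial3 L).

(** [along_delta I L y] is [L[y]] and [along_nabla I L y] is [L{y}]. *)
Definition along_delta (I : R -> Prop) (L : R -> R -> R -> R) (y : R -> R)
  (t : R) : R := L t (y (sigma_ts I t)) (delta_derive I y t).

Definition along_nabla (I : R -> Prop) (L : R -> R -> R -> R) (y : R -> R)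
  (t : R) : R := L t (y (rho_ts I t)) (nabla_derive I y t).

Definition delta_functional (I : R -> Prop) (a b : R) (L : R -> R -> R -> R)
  (y : R -> R) : R := delta_int I (along_delta I L y) a b.

Definition nabla_functional (I : R -> Prop) (a b : R) (L : R -> R -> R -> R)
  (y : R -> R) : R := nabla_int I (along_nabla I L y) a b.

Definition product_functional (I : R -> Prop) (a b : R)
  (LD LN : R -> R -> R -> R) (y : R -> R) : R :=
  delta_functional I a b LD y * nabla_functional I a b LN y.

(** * The isoperimetric problem *)

Definition admissible (I : R -> Prop) (a b alpha beta k : R)
  (KD KN : R -> R -> R -> R) (y : R -> R) : Prop :=
  C1_diamond I y /\ y a = alpha /\ y b = beta /\
  product_functional I a b KD KN y = k.

Definition weak_local_minimizer (I : R -> Prop) (a b alpha beta k : R)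
  (LD LN KD KN : R -> R -> R -> R) (yh : R -> R) : Prop :=
  admissible I a b alpha beta k KD KN yh /\
  exists delta : posreal, forall y : R -> R,
    admissible I a b alpha beta k KD KN y ->
    Rbar_lt (norm_1_inf I (fun t => y t - yh t)) delta ->
    product_functional I a b LD LN yh <= product_functional I a b LD LN y.

Definition weak_local_maximizer (I : R -> Prop) (a b alpha beta k : R)
  (LD LN KD KN : R -> R -> R -> R) (yh : R -> R) : Prop :=
  admissible I a b alpha beta k KD KN yh /\
  exists delta : posreal, forall y : R -> R,
    admissible I a b alpha beta k KD KN y ->
    Rbar_lt (norm_1_inf I (fun t => y t - yh t)) delta ->
    product_functional I a b LD LN yh >= product_functional I a b LD LN y.

Definition extremizer (I : R -> Prop) (a b alpha beta k : R)
  (LD LN KD KN : R -> R -> R -> R) (yh : R -> R) : Prop :=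
  weak_local_minimizer I a b alpha beta k LD LN KD KN yh \/
  weak_local_maximizer I a b alpha beta k LD LN KD KN yh.

Definition delta_EL (I : R -> Prop) (a : R) (L : R -> R -> R -> R)
  (y : R -> R) (t : R) : R :=
  along_delta I (partial3 L) y t
  - delta_int I (along_delta I (partial2 L) y) a t.

Definition nabla_EL (I : R -> Prop) (a : R) (L : R -> R -> R -> R)
  (y : R -> R) (t : R) : R :=
  along_nabla I (partial3 L) y t
  - nabla_int I (along_nabla I (partial2 L) y) a t.

Definition continuous_within (D : R -> Prop) (f : R -> R) (t : R) : Prop :=
  filterlim f (within D (locally t)) (locally (f t)).

(** At a left-dense right-scattered point [t], [sigma], hence [y o sigma],
    is in general discontinuous, and [d_3 L[y]] with it; similarly for
    [d_3 L{y}] at a right-dense left-scattered point.  Elsewhere the two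
    predicates below hold trivially.  They cannot be dropped: on
    [[0,1] U {2}], with [LD = x v + (v - 1)^2], [LN = 1/2 + x v + (v - 1)^2],
    [KD = t v], [KN = 1/2], the function [y t = t] is an extremizer, but
    no nonzero pair of multipliers makes the first integral equation hold both
    on [[0,1)] and at [t = 1]. *)
Definition delta_momentum_regular (I : R -> Prop) (L : R -> R -> R -> R)
  (y : R -> R) (t : R) : Prop :=
  left_dense_right_scattered I t ->
  continuous_within (upper_kappa I) (along_delta I (partial3 L) y) t.

Definition nabla_momentum_regular (I : R -> Prop) (L : R -> R -> R -> R)
  (y : R -> R) (t : R) : Prop :=
  right_dense_left_scattered I t ->
  continuous_within (lower_kappa I) (along_nabla I (partial3 L) y) t.

(* Main.v *)
(** The interval [I = [a,b]] is a compact time scale, and [t |-> - t] exchanges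
    its delta and nabla calculus.  If no variation vanishing at [a] and [b]
    changes [K] to first order, take [(lambda0, lambda) = (0, 1)].  Otherwise
    correct an arbitrary variation by a second one, along which [K] has nonzero
    derivative, to stay on the constraint: a combination of the first variations
    of [L] and [K] vanishes.  Integration by parts turns it into
    [int p z^Delta + int q z^nabla = 0] for all admissible [z], where [p] and [q]
    collect the Euler-Lagrange expressions.  Choosing [z^Delta], up to a constant,
    as a cutoff that drops from 1 to 0 near [t] shows that
    [A t = int_a^t p Delta + int_a^t q nabla] is affine, and the two equations
    state that its nabla derivative [p (rho t) + q t] and its delta derivative
    [p t + q (sigma t)] are constant. *)
Require Import Defs.
From Stdlib Require Import Reals Lra Classical ClassicalEpsilon.
From Stdlib Require Import FunctionalExtensionality PropExtensionality.
From Coquelicot Require Import Coquelicot.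
Open Scope R_scope.

(** * The jump operators *)

(** The obstacle is the supply of variations. Both derivatives of a variation must be continuous, so
    its slope cannot simply drop at a point: across a gap whose right end is right-dense, continuity
    of the nabla derivative forces the same slope at both ends. A drop at one point is possible only
    where that point is isolated; elsewhere the slope has to descend within a short window without
    changing across the gaps in it, and in a Cantor-like set that means a Cantor function. Such
    windows shrink to [t] only in the limit, so the variations determine the sum of integrals [A],
    not [p] and [q] pointwise.

    Returning from [A] to [p] and [q] is delicate too. In general [p] is continuous only at
    right-dense points and [q] only at left-dense ones, while the nabla derivative of the delta
    integral of [p] requires continuity at left-dense points, and dually for [q]. The momentum
    hypotheses supply it where density is one-sided.

    Integrals are increments of antiderivatives picked by [epsilon], so existence and uniqueness of
    antiderivatives must be available for such discontinuous integrands. *)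

Record compact_ts (I : R -> Prop) (a b : R) : Prop := {
  cts_closed : closed I;
  cts_l : I a;
  cts_r : I b;
  cts_lt : a < b;
  cts_bound : forall t, I t -> a <= t <= b }.

Lemma continuous_within_eps (D : R -> Prop) (f : R -> R) (t : R) :
  continuous_within D f t <->
  forall eps, 0 < eps -> exists d, 0 < d /\
    forall s, D s -> Rabs (s - t) < d -> Rabs (f s - f t) < eps.
Proof.
  split.
  - intros H eps He.
    destruct (H (fun y => Rabs (y - f t) < eps)) as [d Hd].
    + exists (mkposreal eps He). intros y Hy. exact Hy.
    + exists d. split; [apply cond_pos|]. intros s Ds Hs. now apply Hd.
  - intros H P [e He].
    destruct (H e (cond_pos e)) as [d [Hd Hs]].
    exists (mkposreal d Hd). intros s Bs Ds. apply He. apply Hs; assumption.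
Qed.

Lemma is_delta_derive_eps (I : R -> Prop) (y : R -> R) (t l : R) :
  is_delta_derive I y t l <->
  forall eps, 0 < eps -> exists d, 0 < d /\
    forall s, I s -> Rabs (s - t) < d ->
      Rabs (y (sigma_ts I t) - y s - l * (sigma_ts I t - s))
        <= eps * Rabs (sigma_ts I t - s).
Proof.
  split.
  - intros H eps He. destruct (H (mkposreal eps He)) as [d Hd].
    exists d. split; [apply cond_pos|]. intros s Is Hs. now apply Hd.
  - intros H eps. destruct (H eps (cond_pos eps)) as [d [Hd Hs]].
    exists (mkposreal d Hd). intros s Bs Is. apply Hs; assumption.
Qed.

Lemma closed_adherent (I : R -> Prop) (x : R) :
  closed I -> (forall d, 0 < d -> exists s, I s /\ Rabs (s - x) < d) -> I x.
Proof.
  intros HI H. apply HI. intros [d Hd].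
  destruct (H d (cond_pos d)) as [s [Is Hs]]. exact (Hd s Hs Is).
Qed.

(** Closedness puts the infimum in [I]: if no point of [I] came within [d] of [g], then [g + d]
    would be a lower bound as well. If nothing lies to the right of [t], the default value [t]
    satisfies every clause. *)
Lemma sigma_spec (I : R -> Prop) (a b t : R) :
  compact_ts I a b -> I t ->
  I (sigma_ts I t) /\ t <= sigma_ts I t <= b /\
  (forall s, I s -> t < s -> sigma_ts I t <= s).
Proof.
  intros HI It. unfold sigma_ts.
  pose proof (cts_bound _ _ _ HI t It).
  destruct (excluded_middle_informative _) as [[s0 [Is0 Hs0]]|N].
  - pose proof (Glb_Rbar_correct (fun s => I s /\ t < s)) as [Hlb Hglb].
    destruct (Glb_Rbar (fun s => I s /\ t < s)) as [g| |]; simpl.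
    + assert (Hl : forall s, I s -> t < s -> g <= s).
      { intros s Is Hs. apply (Hlb s). now split. }
      assert (Htg : t <= g).
      { apply (Hglb (Finite t)). intros s [_ Hs]. simpl. lra. }
      assert (Ig : I g).
      { apply closed_adherent; [exact (cts_closed _ _ _ HI)|].
        intros d Hd. apply NNPP. intros N.
        enough (g + d <= g) by lra.
        apply (Hglb (Finite (g + d))). intros s [Is Hs]. simpl.
        apply Rnot_lt_le. intros Hlt. apply N. exists s. split; [exact Is|].
        specialize (Hl s Is Hs). rewrite Rabs_pos_eq; lra. }
      repeat split; auto. apply (cts_bound _ _ _ HI g Ig).
    + destruct (Hlb s0 (conj Is0 Hs0)).
    + destruct (Hglb (Finite t)). intros s [_ Hs]. simpl. lra.
  - repeat split; try tauto; try lra.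
    intros s Is Hs. destruct N. now exists s.
Qed.

(** [t < b] rules out the default value of [sigma_ts], so [t] really is an infimum; a hole of length
    [eps] would push that infimum up to [t + eps]. *)
Lemma right_dense_approx (I : R -> Prop) (a b t eps : R) :
  compact_ts I a b -> I t -> t < b -> sigma_ts I t = t -> 0 < eps ->
  exists s, I s /\ t < s < t + eps.
Proof.
  intros HI It Htb Hs He. unfold sigma_ts in Hs.
  destruct (excluded_middle_informative _) as [_|N].
  - pose proof (Glb_Rbar_correct (fun s => I s /\ t < s)) as [Hlb Hglb].
    apply NNPP. intros N.
    assert (Hle : Rbar_le (t + eps) (Glb_Rbar (fun s => I s /\ t < s))).
    { apply Hglb. intros s [Is Hts]. simpl. apply Rnot_lt_le. intros Hlt.
      apply N. exists s. split; [exact Is|lra]. }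
    specialize (Hlb b (conj (cts_r _ _ _ HI) Htb)).
    destruct (Glb_Rbar (fun s => I s /\ t < s)) as [g| |]; simpl in *; try tauto.
    lra.
  - destruct N. exists b. split; [exact (cts_r _ _ _ HI)|exact Htb].
Qed.

(** * Reflection and the backward jump *)

Definition reflect (I : R -> Prop) (t : R) : Prop := I (- t).

Lemma reflect_involutive (I : R -> Prop) : reflect (reflect I) = I.
Proof.
  apply functional_extensionality. intros t. unfold reflect.
  now rewrite Ropp_involutive.
Qed.

(** The facts about [[a,b]] are packed into a record stable under reflection, so that nabla
    statements can be obtained as instances of delta ones. *)
Lemma compact_ts_reflect (I : R -> Prop) (a b : R) :
  compact_ts I a b -> compact_ts (reflect I) (- b) (- a).
Proof.
  intros [Hc Ha Hb Hab HI]. split; unfold reflect.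
  - intros x Hx. apply Hc. intros [d Hd]. apply Hx. exists d. intros s Hs.
    apply Hd. revert Hs. unfold ball; simpl; unfold AbsRing_ball, abs, minus, plus, opp; simpl.
    intros Hs. rewrite <- Rabs_Ropp.
    now replace (- (- s + - - x)) with (s + - x) by ring.
  - now rewrite Ropp_involutive.
  - now rewrite Ropp_involutive.
  - lra.
  - intros t It. specialize (HI _ It). lra.
Qed.

Lemma rho_reflect (I : R -> Prop) (t : R) :
  rho_ts I t = - sigma_ts (reflect I) (- t).
Proof.
  unfold rho_ts, sigma_ts, reflect.
  destruct (excluded_middle_informative _) as [[s [Is Hs]]|N];
  destruct (excluded_middle_informative _) as [E'|N'].
  - pose proof (Lub_Rbar_correct (fun s => I s /\ s < t)) as H.
    apply is_glb_Rbar_opp in H.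
    rewrite (is_glb_Rbar_unique (fun s0 => I (- s0) /\ - t < s0)
      (Rbar_opp (Lub_Rbar (fun s => I s /\ s < t)))).
    + destruct (Lub_Rbar _); simpl; ring.
    + destruct H as [H1 H2]. split.
      * intros x [Ix Hx]. apply H1. split; [exact Ix|lra].
      * intros l Hl. apply H2. intros x [Ix Hx]. apply Hl. split; [exact Ix|lra].
  - destruct N'. exists (- s). rewrite Ropp_involutive. split; [exact Is|lra].
  - destruct N, E' as [s [Is Hs]]. exists (- s). split; [exact Is|lra].
  - ring.
Qed.

Lemma sigma_reflect (I : R -> Prop) (t : R) :
  sigma_ts (reflect I) t = - rho_ts I (- t).
Proof. rewrite rho_reflect, !Ropp_involutive. reflexivity. Qed.

Lemma rho_spec (I : R -> Prop) (a b t : R) :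
  compact_ts I a b -> I t ->
  I (rho_ts I t) /\ a <= rho_ts I t <= t /\
  (forall s, I s -> s < t -> s <= rho_ts I t).
Proof.
  intros HI It. rewrite rho_reflect.
  destruct (sigma_spec (reflect I) (- b) (- a) (- t)) as [H1 [H2 H3]].
  - now apply compact_ts_reflect.
  - unfold reflect. now rewrite Ropp_involutive.
  - repeat split; [exact H1|lra|lra|]. intros s Is Hs.
    specialize (H3 (- s)). unfold reflect in H3 at 1.
    rewrite Ropp_involutive in H3. specialize (H3 Is). lra.
Qed.

Lemma left_dense_approx (I : R -> Prop) (a b t eps : R) :
  compact_ts I a b -> I t -> a < t -> rho_ts I t = t -> 0 < eps ->
  exists s, I s /\ t - eps < s < t.
Proof.
  intros HI It Htb Hs He. rewrite rho_reflect in Hs.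
  destruct (right_dense_approx (reflect I) (- b) (- a) (- t) eps) as [s [Is H]].
  - now apply compact_ts_reflect.
  - unfold reflect. now rewrite Ropp_involutive.
  - lra.
  - lra.
  - exact He.
  - exists (- s). split; [exact Is|lra].
Qed.

Lemma upper_kappa_reflect (I : R -> Prop) (t : R) :
  upper_kappa (reflect I) t <-> lower_kappa I (- t).
Proof.
  unfold upper_kappa, lower_kappa, reflect at 1 2.
  rewrite rho_reflect, reflect_involutive.
  split; intros [It H]; split; auto; intros [H1 H2]; apply H; split; try lra.
  - intros s Is. apply Ropp_le_cancel. apply H1. exact Is.
  - intros s Is. specialize (H1 (- s)). rewrite Ropp_involutive in H1.
    specialize (H1 Is). lra.
Qed.

Lemma upper_kappa_in (I : R -> Prop) (t : R) : upper_kappa I t -> I t.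
Proof. now intros [H _]. Qed.

Lemma lower_kappa_in (I : R -> Prop) (t : R) : lower_kappa I t -> I t.
Proof. now intros [H _]. Qed.

Lemma upper_kappa_lt (I : R -> Prop) (a b t : R) :
  compact_ts I a b -> I t -> t < b -> upper_kappa I t.
Proof.
  intros HI It Htb. split; [exact It|]. intros [H _].
  specialize (H b (cts_r _ _ _ HI)). lra.
Qed.

Lemma upper_kappa_left_dense (I : R -> Prop) (t : R) :
  I t -> rho_ts I t = t -> upper_kappa I t.
Proof. intros It H. split; [exact It|]. lra. Qed.

Lemma lower_kappa_lt (I : R -> Prop) (a b t : R) :
  compact_ts I a b -> I t -> a < t -> lower_kappa I t.
Proof.
  intros HI It Htb. split; [exact It|]. intros [H _].
  specialize (H a (cts_l _ _ _ HI)). lra.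
Qed.

Lemma lower_kappa_right_dense (I : R -> Prop) (t : R) :
  I t -> sigma_ts I t = t -> lower_kappa I t.
Proof. intros It H. split; [exact It|]. lra. Qed.

Lemma upper_kappa_dec (I : R -> Prop) (a b t : R) :
  compact_ts I a b -> I t -> upper_kappa I t \/ (t = b /\ rho_ts I t < t).
Proof.
  intros HI It. pose proof (cts_bound _ _ _ HI t It) as Hb.
  destruct (Req_dec t b) as [->|Hne].
  - destruct (rho_spec I a b b HI It) as [_ [[_ Hr] _]].
    destruct (Req_dec (rho_ts I b) b).
    + left. now apply upper_kappa_left_dense.
    + right. split; [reflexivity|lra].
  - left. apply (upper_kappa_lt I a b); auto. lra.
Qed.

(** If [sigma_ts I (rho_ts I t)] were below [t], it would be at most [rho_ts I t], making that point
    right-dense; points of [I] would then lie strictly between it and [t]. *)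
Lemma sigma_rho (I : R -> Prop) (a b t : R) :
  compact_ts I a b -> I t -> rho_ts I t < t -> sigma_ts I (rho_ts I t) = t.
Proof.
  intros HI It Ht. destruct (rho_spec I a b t HI It) as [Ir [_ Hr]].
  destruct (sigma_spec I a b (rho_ts I t) HI Ir) as [Is [[Hs _] Hs']].
  specialize (Hs' t It Ht).
  destruct (Rle_lt_or_eq_dec _ _ Hs') as [Hlt|]; [|assumption].
  specialize (Hr _ Is Hlt).
  destruct (right_dense_approx I a b (rho_ts I t) (t - rho_ts I t) HI Ir) as [s [Iss Hss]].
  - pose proof (cts_bound _ _ _ HI t It). lra.
  - lra.
  - lra.
  - destruct (rho_spec I a b t HI It) as [_ [_ Hr']].
    specialize (Hr' s Iss). lra.
Qed.

(** * Delta derivatives and antiderivatives *)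

Definition anti_delta (I : R -> Prop) (f F : R -> R) : Prop :=
  forall t, upper_kappa I t -> is_delta_derive I F t (f t).

(** At [t = b] the equality [sigma_ts I b = b] is only a convention; there membership in
    [upper_kappa] supplies left-density instead. This is what makes delta derivatives unique. *)
Lemma upper_kappa_dense_approx (I : R -> Prop) (a b t d : R) :
  compact_ts I a b -> upper_kappa I t -> sigma_ts I t = t -> 0 < d ->
  exists s, I s /\ s <> t /\ Rabs (s - t) < d.
Proof.
  intros HI Kt Hs Hd. pose proof (upper_kappa_in _ _ Kt) as It.
  pose proof (cts_bound _ _ _ HI t It) as Hb.
  destruct (Rle_lt_or_eq_dec t b) as [Hlt|Heq]; [lra| |].
  - destruct (right_dense_approx I a b t d HI It Hlt Hs Hd) as [s [Is Hss]].
    exists s. repeat split; [exact Is|lra|]. rewrite Rabs_pos_eq; lra.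
  - destruct (rho_spec I a b t HI It) as [_ [[_ Hr] _]].
    assert (Hr' : rho_ts I t = t).
    { destruct (Rle_lt_or_eq_dec _ _ Hr) as [Hlt|]; [|assumption].
      destruct Kt as [_ N]. destruct N. split; [|exact Hlt].
      intros s Is. rewrite Heq. apply (cts_bound _ _ _ HI s Is). }
    pose proof (cts_lt _ _ _ HI) as Hab.
    destruct (left_dense_approx I a b t d HI It) as [s [Is Hss]]; auto; [lra|].
    exists s. repeat split; [exact Is|lra|].
    rewrite Rabs_left; lra.
Qed.

(** The defining inequality may be tested at [s = t], which lies in every neighbourhood; letting
    [eps] shrink turns it into an equality. *)
Lemma delta_derive_jump (I : R -> Prop) (F : R -> R) (t l : R) :
  I t -> is_delta_derive I F t l ->
  F (sigma_ts I t) - F t = l * (sigma_ts I t - t).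
Proof.
  intros It H. rewrite is_delta_derive_eps in H.
  apply Rminus_diag_uniq. apply cond_eq. intros eps He.
  set (K := Rabs (sigma_ts I t - t)).
  assert (0 <= K) by apply Rabs_pos.
  destruct (H (eps / (K + 1))) as [d [Hd Hs]].
  { apply Rdiv_lt_0_compat; lra. }
  specialize (Hs t It). rewrite Rminus_diag, Rabs_R0 in Hs.
  specialize (Hs Hd). fold K in Hs. rewrite Rminus_0_r.
  apply Rle_lt_trans with (1 := Hs).
  apply Rmult_lt_reg_r with (K + 1); [lra|].
  replace (eps / (K + 1) * K * (K + 1)) with (eps * K) by (field; lra).
  nra.
Qed.

Lemma delta_derive_continuous (I : R -> Prop) (F : R -> R) (t l : R) :
  I t -> is_delta_derive I F t l -> continuous_within I F t.
Proof.
  intros It H. pose proof (delta_derive_jump I F t l It H) as Hj.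
  rewrite is_delta_derive_eps in H. apply continuous_within_eps. intros eps He.
  set (K := Rabs (sigma_ts I t - t)).
  assert (0 <= K) by apply Rabs_pos.
  pose proof (Rabs_pos l) as Hl.
  assert (He' : 0 < eps / (2 * (K + 1))) by (apply Rdiv_lt_0_compat; lra).
  assert (Hl' : 0 < eps / (2 * (Rabs l + 1))) by (apply Rdiv_lt_0_compat; lra).
  destruct (H _ He') as [d [Hd Hs]].
  exists (Rmin d (Rmin 1 (eps / (2 * (Rabs l + 1))))). split.
  { repeat apply Rmin_glb_lt; lra. }
  intros s Is Hst.
  assert (Hst1 : Rabs (s - t) < d) by (eapply Rlt_le_trans; [exact Hst|apply Rmin_l]).
  assert (Hst2 : Rabs (s - t) < 1).
  { eapply Rlt_le_trans; [exact Hst|]. eapply Rle_trans; [apply Rmin_r|apply Rmin_l]. }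
  assert (Hst3 : Rabs (s - t) < eps / (2 * (Rabs l + 1))).
  { eapply Rlt_le_trans; [exact Hst|]. eapply Rle_trans; [apply Rmin_r|apply Rmin_r]. }
  specialize (Hs s Is Hst1).
  assert (HK : Rabs (sigma_ts I t - s) < K + 1).
  { replace (sigma_ts I t - s) with ((sigma_ts I t - t) - (s - t)) by ring.
    unfold Rminus at 1. eapply Rle_lt_trans; [apply Rabs_triang|].
    rewrite Rabs_Ropp. fold K. lra. }
  (* The jump identity rewrites the increment as the defect in the definition plus a term linear in
     [s - t]. *)
  replace (F s - F t) with
    (- (F (sigma_ts I t) - F s - l * (sigma_ts I t - s)) + l * (s - t)) by lra.
  eapply Rle_lt_trans; [apply Rabs_triang|].
  rewrite Rabs_Ropp, Rabs_mult.
  assert (H1 : Rabs (F (sigma_ts I t) - F s - l * (sigma_ts I t - s)) < eps / 2).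
  { eapply Rle_lt_trans; [exact Hs|].
    apply Rlt_le_trans with (eps / (2 * (K + 1)) * (K + 1)).
    - apply Rmult_lt_compat_l; assumption.
    - right. field. lra. }
  assert (H2 : Rabs l * Rabs (s - t) <= eps / 2).
  { apply Rle_trans with ((Rabs l + 1) * (eps / (2 * (Rabs l + 1)))).
    - apply Rmult_le_compat; try lra. apply Rabs_pos.
    - right. field. lra. }
  lra.
Qed.

(** The only point where no derivative is given is a left-scattered [b], which is isolated in [I],
    so continuity there is automatic. *)
Lemma anti_delta_continuous (I : R -> Prop) (a b t : R) (f F : R -> R) :
  compact_ts I a b -> anti_delta I f F -> I t -> continuous_within I F t.
Proof.
  intros HI HF It. destruct (upper_kappa_dec I a b t HI It) as [K|[-> Hr]].
  - exact (delta_derive_continuous I F t (f t) It (HF t K)).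
  - apply continuous_within_eps. intros eps He. exists (b - rho_ts I b).
    split; [lra|]. intros s Is Hs.
    replace s with b; [rewrite Rminus_diag, Rabs_R0; exact He|].
    pose proof (cts_bound _ _ _ HI s Is) as Hb.
    destruct (rho_spec I a b b HI It) as [_ [_ H]].
    destruct (Rle_lt_or_eq_dec s b) as [Hlt|]; [lra| |lra].
    specialize (H s Is Hlt). rewrite Rabs_left in Hs; lra.
Qed.

Lemma is_delta_derive_unique (I : R -> Prop) (a b : R) (F : R -> R) (t l m : R) :
  compact_ts I a b -> upper_kappa I t ->
  is_delta_derive I F t l -> is_delta_derive I F t m -> l = m.
Proof.
  intros HI Kt Hl Hm. pose proof (upper_kappa_in _ _ Kt) as It.
  destruct (Req_dec (sigma_ts I t) t) as [Hd|Hd].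
  - apply cond_eq. intros eps He.
    rewrite is_delta_derive_eps in Hl, Hm.
    destruct (Hl (eps / 3)) as [d1 [Hd1 H1]]; [lra|].
    destruct (Hm (eps / 3)) as [d2 [Hd2 H2]]; [lra|].
    destruct (upper_kappa_dense_approx I a b t (Rmin d1 d2) HI Kt Hd) as [s [Is [Hs Hst]]].
    { now apply Rmin_glb_lt. }
    specialize (H1 s Is (Rlt_le_trans _ _ _ Hst (Rmin_l _ _))).
    specialize (H2 s Is (Rlt_le_trans _ _ _ Hst (Rmin_r _ _))).
    rewrite Hd in H1, H2.
    apply Rmult_lt_reg_r with (Rabs (t - s)); [apply Rabs_pos_lt; lra|].
    rewrite <- Rabs_mult.
    replace ((l - m) * (t - s)) with
      ((F t - F s - m * (t - s)) - (F t - F s - l * (t - s))) by ring.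
    assert (0 < Rabs (t - s)) by (apply Rabs_pos_lt; lra).
    unfold Rminus at 1. eapply Rle_lt_trans; [apply Rabs_triang|].
    rewrite Rabs_Ropp. nra.
  - pose proof (delta_derive_jump I F t l It Hl).
    pose proof (delta_derive_jump I F t m It Hm).
    apply Rmult_eq_reg_r with (sigma_ts I t - t); lra.
Qed.

Lemma is_delta_derive_ext (I : R -> Prop) (a b : R) (F G : R -> R) (t l : R) :
  compact_ts I a b -> I t -> (forall s, I s -> F s = G s) ->
  is_delta_derive I F t l -> is_delta_derive I G t l.
Proof.
  intros HI It HFG HF eps. destruct (HF eps) as [d Hd]. exists d.
  intros s Bs Is. rewrite <- !HFG; auto.
  apply (sigma_spec I a b t HI It).
Qed.

Lemma is_delta_derive_lin (I : R -> Prop) (F G : R -> R) (t l m u v : R) :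
  is_delta_derive I F t l -> is_delta_derive I G t m ->
  is_delta_derive I (fun s => u * F s + v * G s) t (u * l + v * m).
Proof.
  rewrite !is_delta_derive_eps. intros HF HG eps He.
  pose proof (Rabs_pos u) as Hu. pose proof (Rabs_pos v) as Hv.
  assert (He' : 0 < eps / (Rabs u + Rabs v + 1)) by (apply Rdiv_lt_0_compat; lra).
  destruct (HF _ He') as [d1 [Hd1 H1]]. destruct (HG _ He') as [d2 [Hd2 H2]].
  exists (Rmin d1 d2). split; [now apply Rmin_glb_lt|]. intros s Is Hs.
  specialize (H1 s Is (Rlt_le_trans _ _ _ Hs (Rmin_l _ _))).
  specialize (H2 s Is (Rlt_le_trans _ _ _ Hs (Rmin_r _ _))).
  replace (_ - _ - _) with
    (u * (F (sigma_ts I t) - F s - l * (sigma_ts I t - s)) +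
     v * (G (sigma_ts I t) - G s - m * (sigma_ts I t - s))) by ring.
  eapply Rle_trans; [apply Rabs_triang|]. rewrite !Rabs_mult.
  apply Rle_trans with
    ((Rabs u + Rabs v) * (eps / (Rabs u + Rabs v + 1) * Rabs (sigma_ts I t - s))).
  - nra.
  - rewrite <- Rmult_assoc. apply Rmult_le_compat_r; [apply Rabs_pos|].
    apply Rmult_le_reg_r with (Rabs u + Rabs v + 1); [lra|].
    replace ((Rabs u + Rabs v) * (eps / (Rabs u + Rabs v + 1)) * (Rabs u + Rabs v + 1))
      with ((Rabs u + Rabs v) * eps) by (field; lra). nra.
Qed.

Lemma is_delta_derive_const (I : R -> Prop) (k t : R) :
  is_delta_derive I (fun _ => k) t 0.
Proof.
  apply is_delta_derive_eps. intros eps He. exists 1. split; [lra|]. intros s _ _.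
  replace (k - k - 0 * (sigma_ts I t - s)) with 0 by ring.
  rewrite Rabs_R0. apply Rmult_le_pos; [lra|apply Rabs_pos].
Qed.

Lemma is_delta_derive_id (I : R -> Prop) (t : R) :
  is_delta_derive I (fun s => s) t 1.
Proof.
  apply is_delta_derive_eps. intros eps He. exists 1. split; [lra|]. intros s _ _.
  replace (sigma_ts I t - s - 1 * (sigma_ts I t - s)) with 0 by ring.
  rewrite Rabs_R0. apply Rmult_le_pos; [lra|apply Rabs_pos].
Qed.

Lemma is_delta_derive_mult (I : R -> Prop) (F G : R -> R) (t l m : R) :
  I t -> is_delta_derive I F t l -> is_delta_derive I G t m ->
  is_delta_derive I (fun s => F s * G s) t (l * G (sigma_ts I t) + F t * m).
Proof.
  intros It HF HG.
  pose proof (delta_derive_continuous I F t l It HF) as HC.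
  rewrite continuous_within_eps in HC.
  revert HF HG. rewrite !is_delta_derive_eps. intros HF HG eps He.
  (* [A] sums the factors that multiply [eps / A] in the three-term splitting of the error;
     continuity of [F] makes the last term small. *)
  set (A := Rabs (G (sigma_ts I t)) + (Rabs (F t) + 1) + Rabs m + 1).
  pose proof (Rabs_pos (G (sigma_ts I t))) as P1. pose proof (Rabs_pos (F t)) as P2.
  pose proof (Rabs_pos m) as P3.
  assert (HA : 0 < A) by (unfold A; lra).
  assert (He' : 0 < eps / A) by (apply Rdiv_lt_0_compat; lra).
  destruct (HF _ He') as [d1 [Hd1 H1]]. destruct (HG _ He') as [d2 [Hd2 H2]].
  destruct (HC (Rmin 1 (eps / A))) as [d3 [Hd3 H3]]; [apply Rmin_glb_lt; lra|].
  exists (Rmin d1 (Rmin d2 d3)). split; [repeat apply Rmin_glb_lt; lra|]. intros s Is Hs.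
  specialize (H1 s Is (Rlt_le_trans _ _ _ Hs (Rmin_l _ _))).
  specialize (H2 s Is (Rlt_le_trans _ _ _ Hs
    (Rle_trans _ _ _ (Rmin_r _ _) (Rmin_l _ _)))).
  specialize (H3 s Is (Rlt_le_trans _ _ _ Hs
    (Rle_trans _ _ _ (Rmin_r _ _) (Rmin_r _ _)))).
  pose proof (Rlt_le_trans _ _ _ H3 (Rmin_l _ _)) as H4.
  pose proof (Rlt_le_trans _ _ _ H3 (Rmin_r _ _)) as H5.
  assert (H6 : Rabs (F s) <= Rabs (F t) + 1).
  { replace (F s) with (F t + (F s - F t)) by ring.
    eapply Rle_trans; [apply Rabs_triang|lra]. }
  set (x := sigma_ts I t) in *. set (w := Rabs (x - s)) in *.
  assert (Hw : 0 <= w) by apply Rabs_pos.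
  replace (F x * G x - F s * G s - (l * G x + F t * m) * (x - s)) with
    ((F x - F s - l * (x - s)) * G x +
     (F s * (G x - G s - m * (x - s)) + (F s - F t) * m * (x - s))) by ring.
  eapply Rle_trans; [apply Rabs_triang|].
  eapply Rle_trans; [apply Rplus_le_compat_l, Rabs_triang|].
  rewrite !Rabs_mult. fold w.
  assert (E : eps * w = eps / A * w * A) by (field; lra). rewrite E.
  set (e := eps / A) in *.
  assert (Hew : 0 <= e * w) by nra.
  assert (T1 : Rabs (F x - F s - l * (x - s)) * Rabs (G x) <= e * w * Rabs (G x))
    by (apply Rmult_le_compat_r; lra).
  assert (T2 : Rabs (F s) * Rabs (G x - G s - m * (x - s)) <= (Rabs (F t) + 1) * (e * w)).
  { apply Rmult_le_compat; try apply Rabs_pos; lra. }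
  assert (T3 : Rabs (F s - F t) * Rabs m * w <= e * Rabs m * w).
  { apply Rmult_le_compat_r; [lra|]. apply Rmult_le_compat_r; lra. }
  unfold A. nra.
Qed.

Lemma anti_delta_lin (I : R -> Prop) (f g F G : R -> R) (u v : R) :
  anti_delta I f F -> anti_delta I g G ->
  anti_delta I (fun t => u * f t + v * g t) (fun t => u * F t + v * G t).
Proof. intros HF HG t Kt. now apply is_delta_derive_lin; [apply HF|apply HG]. Qed.

Lemma anti_delta_ext (I : R -> Prop) (f g F : R -> R) :
  (forall t, upper_kappa I t -> f t = g t) -> anti_delta I f F -> anti_delta I g F.
Proof. intros H HF t Kt. rewrite <- H; auto. Qed.

(** The set of [t] with [F t - F r <= (M + eps) (t - r)] is closed, contains
    [r], and every element [< s] is followed by a larger one. *)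
Lemma delta_increment_le (I : R -> Prop) (a b r s M : R) (f F : R -> R) :
  compact_ts I a b -> anti_delta I f F -> I r -> I s -> r <= s ->
  (forall t, I t -> r <= t < s -> f t <= M) ->
  F s - F r <= M * (s - r).
Proof.
  intros HI HF Ir Is Hrs Hf. apply le_epsilon. intros eps0 He0.
  set (eps := eps0 / (s - r + 1)).
  assert (He : 0 < eps) by (apply Rdiv_lt_0_compat; lra).
  enough (F s - F r <= (M + eps) * (s - r)) as Hmain.
  { assert (eps * (s - r) <= eps0); [|nra].
    unfold eps. apply Rmult_le_reg_r with (s - r + 1); [lra|].
    replace (eps0 / (s - r + 1) * (s - r) * (s - r + 1)) with (eps0 * (s - r))
      by (field; lra). nra. }
  set (E := fun t => I t /\ r <= t <= s /\ F t - F r <= (M + eps) * (t - r)).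
  assert (Er : E r) by (repeat split; auto; lra).
  destruct (completeness E) as [x [Hub Hlub]].
  { exists s. intros t [_ [H _]]. lra. }
  { now exists r. }
  assert (Hrx : r <= x) by now apply Hub.
  assert (Hxs : x <= s) by (apply Hlub; intros t [_ [H _]]; lra).
  assert (Happ : forall d, 0 < d -> exists t, E t /\ x - d < t <= x).
  { intros d Hd. apply NNPP. intros N. enough (x <= x - d) by lra.
    apply Hlub. intros t Et. apply Rnot_lt_le. intros Hlt. apply N.
    exists t. split; [exact Et|]. split; [exact Hlt|now apply Hub]. }
  assert (Ix : I x).
  { apply closed_adherent; [exact (cts_closed _ _ _ HI)|]. intros d Hd.
    destruct (Happ d Hd) as [t [[It _] Ht]]. exists t. split; [exact It|].
    apply Rabs_def1; lra. }
  assert (Ex : E x).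
  { repeat split; auto. apply le_epsilon. intros e1 He1.
    pose proof (anti_delta_continuous I a b x f F HI HF Ix) as HC.
    rewrite continuous_within_eps in HC.
    destruct (HC (e1 / 2)) as [d [Hd Hc]]; [lra|].
    set (B := Rabs (M + eps) + 1).
    assert (HB : 0 < B) by (unfold B; pose proof (Rabs_pos (M + eps)); lra).
    assert (HeB : 0 < e1 / 2 / B) by (apply Rdiv_lt_0_compat; lra).
    destruct (Happ (Rmin d (e1 / 2 / B))) as [t [[It [Ht1 Ht2]] Ht]].
    { apply Rmin_glb_lt; lra. }
    pose proof (Rmin_l d (e1 / 2 / B)). pose proof (Rmin_r d (e1 / 2 / B)).
    specialize (Hc t It). assert (Hc' := Hc ltac:(apply Rabs_def1; lra)).
    apply Rabs_def2 in Hc'.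
    assert ((M + eps) * (t - x) <= e1 / 2).
    { eapply Rle_trans; [apply Rle_abs|]. rewrite Rabs_mult.
      rewrite (Rabs_left1 (t - x)) by lra.
      apply Rle_trans with (B * (e1 / 2 / B)).
      - unfold B at 1. pose proof (Rabs_pos (M + eps)). nra.
      - right. field. lra. }
    lra. }
  destruct (Rle_lt_or_eq_dec x s Hxs) as [Hlt|<-].
  2: { apply Ex. }
  exfalso. destruct Ex as [_ [_ Ex]].
  pose proof (cts_bound _ _ _ HI s Is) as Hsb.
  assert (Kx : upper_kappa I x) by (apply (upper_kappa_lt I a b); auto; lra).
  pose proof (HF x Kx) as Hd.
  assert (HfM : f x <= M) by (apply Hf; auto).
  destruct (sigma_spec I a b x HI Ix) as [Iy [[Hy1 _] Hy2]].
  destruct (Rle_lt_or_eq_dec _ _ Hy1) as [Hy|Hy].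
  - pose proof (delta_derive_jump I F x (f x) Ix Hd) as Hj.
    specialize (Hy2 s Is Hlt).
    assert (E (sigma_ts I x)) as Hcon by (repeat split; auto; try lra; nra).
    apply Hub in Hcon. lra.
  - rewrite is_delta_derive_eps in Hd. destruct (Hd eps He) as [d [Hd0 Hd1]].
    symmetry in Hy.
    destruct (right_dense_approx I a b x (Rmin d (s - x)) HI Ix) as [t [It Ht]]; auto.
    { lra. }
    { apply Rmin_glb_lt; lra. }
    pose proof (Rmin_l d (s - x)). pose proof (Rmin_r d (s - x)).
    specialize (Hd1 t It ltac:(apply Rabs_def1; lra)). rewrite Hy in Hd1.
    rewrite (Rabs_left (x - t)) in Hd1 by lra.
    apply Rabs_le_between in Hd1.
    assert (E t) as Hcon by (repeat split; auto; try lra; nra).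
    apply Hub in Hcon. lra.
Qed.

Lemma delta_increment_abs_le (I : R -> Prop) (a b r s M : R) (f F : R -> R) :
  compact_ts I a b -> anti_delta I f F -> I r -> I s -> r <= s ->
  (forall t, I t -> r <= t < s -> Rabs (f t) <= M) ->
  Rabs (F s - F r) <= M * (s - r).
Proof.
  intros HI HF Ir Is Hrs Hf.
  assert (H1 := delta_increment_le I a b r s M f F HI HF Ir Is Hrs
    ltac:(intros t It Ht; specialize (Hf t It Ht); apply Rabs_le_between in Hf; lra)).
  assert (H2 := delta_increment_le I a b r s M _ _ HI
    (anti_delta_lin I f f F F (-1) 0 HF HF) Ir Is Hrs
    ltac:(intros t It Ht; specialize (Hf t It Ht); apply Rabs_le_between in Hf; lra)).
  simpl in H2. apply Rabs_le. lra.
Qed.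

(** Uniqueness of the Cauchy integral, in local form: the difference of the two antiderivatives has
    derivative 0 on the half-open [[r, s)], and the value of the integrands at [s] is not seen. *)
Lemma delta_increment_eq (I : R -> Prop) (a b r s : R) (f g F G : R -> R) :
  compact_ts I a b -> anti_delta I f F -> anti_delta I g G ->
  I r -> I s -> r <= s -> (forall t, I t -> r <= t < s -> f t = g t) ->
  F s - F r = G s - G r.
Proof.
  intros HI HF HG Ir Is Hrs H.
  assert (H' := delta_increment_abs_le I a b r s 0 _ _ HI
    (anti_delta_lin I f g F G 1 (-1) HF HG) Ir Is Hrs).
  simpl in H'. rewrite Rmult_0_l in H'.
  enough (1 * F s + -1 * G s - (1 * F r + -1 * G r) = 0) by lra.
  apply Rabs_eq_0. apply Rle_antisym; [|apply Rabs_pos]. apply H'.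
  intros t It Ht. rewrite (H t It Ht).
  replace (1 * g t + -1 * g t) with 0 by ring. rewrite Rabs_R0. lra.
Qed.

(** The antiderivative behind the value chosen by [epsilon] is unknown, but all antiderivatives have
    the same increments. *)
Lemma delta_int_eq (I : R -> Prop) (a b r s : R) (f F : R -> R) :
  compact_ts I a b -> anti_delta I f F -> I r -> I s ->
  delta_int I f r s = F s - F r.
Proof.
  intros HI HF Ir Is. unfold delta_int.
  assert (Hex : exists v, is_delta_int I f r s v).
  { exists (F s - F r), F. now split. }
  pose proof (epsilon_spec (inhabits 0) _ Hex) as [G [HG ->]].
  destruct (Rle_lt_dec r s) as [Hrs|Hrs].
  - now apply (delta_increment_eq I a b r s f f).
  - enough (G r - G s = F r - F s) by lra.
    apply (delta_increment_eq I a b s r f f); auto. lra.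
Qed.

(** * Existence of antiderivatives *)

(** Near a right-scattered [t] the distance from [s] to [sigma_ts I t] stays above half the gap, so
    an error that merely tends to 0 meets the bound; [e] is a quarter of the gap times [eps] because
    two such errors occur. *)
Lemma is_delta_derive_scattered (I : R -> Prop) (F : R -> R) (t l : R) :
  t < sigma_ts I t -> continuous_within I F t ->
  F (sigma_ts I t) - F t = l * (sigma_ts I t - t) ->
  is_delta_derive I F t l.
Proof.
  intros Ht HC Hj. apply is_delta_derive_eps. intros eps He.
  rewrite continuous_within_eps in HC. set (x := sigma_ts I t) in *.
  set (e := eps * (x - t) / 4).
  assert (He0 : 0 < e) by (unfold e; nra).
  pose proof (Rabs_pos l) as Hl.
  destruct (HC e He0) as [d [Hd H]].
  set (d2 := e / (Rabs l + 1)).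
  assert (Hd2 : 0 < d2) by (apply Rdiv_lt_0_compat; lra).
  exists (Rmin d (Rmin ((x - t) / 2) d2)). split.
  { repeat apply Rmin_glb_lt; lra. }
  intros s Is Hs.
  pose proof (Rlt_le_trans _ _ _ Hs (Rmin_l _ _)) as Hs1.
  pose proof (Rlt_le_trans _ _ _ (Rlt_le_trans _ _ _ Hs (Rmin_r _ _)) (Rmin_l _ _)) as Hs2.
  pose proof (Rlt_le_trans _ _ _ (Rlt_le_trans _ _ _ Hs (Rmin_r _ _)) (Rmin_r _ _)) as Hs3.
  specialize (H s Is Hs1).
  replace (F x - F s - l * (x - s)) with (- (F s - F t) + l * (s - t)) by lra.
  eapply Rle_trans; [apply Rabs_triang|]. rewrite Rabs_Ropp, Rabs_mult.
  assert (H3 : Rabs l * Rabs (s - t) <= e).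
  { apply Rle_trans with ((Rabs l + 1) * d2).
    - apply Rmult_le_compat; try lra. apply Rabs_pos.
    - unfold d2. right. field. lra. }
  apply Rabs_def2 in Hs2. rewrite (Rabs_pos_eq (x - s)) by lra.
  apply Rle_trans with (2 * e); [lra|]. unfold e. nra.
Qed.

(** A variant of rd-continuity, with boundedness in place of left limits at left-dense points. A
    left-dense [b] counts as right-dense, since [sigma_ts I b = b]. *)
Definition rd_bounded (I : R -> Prop) (f : R -> R) : Prop :=
  (exists M, forall t, upper_kappa I t -> Rabs (f t) <= M) /\
  (forall t, upper_kappa I t -> sigma_ts I t = t ->
     continuous_within (upper_kappa I) f t).

(** An order-theoretic majorant of the integral: over each interval [G] grows at least at the rate
    of any lower bound of [f] there. No differentiability is asked, so that splicing stays inside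
    the class. *)
Definition lower_bounded_increments (I : R -> Prop) (f G : R -> R) : Prop :=
  forall r s k, I r -> I s -> r < s ->
    (forall t, I t -> r <= t < s -> k <= f t) -> k * (s - r) <= G s - G r.

(** A test interval [[u, v)] meeting [[r, s)] shares a point of [I] with it, and the value of [f]
    there shows [k <= K]; so slope [K] is steep enough on the affine piece. On the outer pieces the
    increments of [G] are unchanged. *)
Lemma lower_bounded_increments_splice (I : R -> Prop) (f G : R -> R) (r s K : R) :
  I r -> I s -> r < s -> (forall t, I t -> r <= t < s -> f t <= K) ->
  lower_bounded_increments I f G ->
  lower_bounded_increments I f (fun x =>
    if Rle_dec x r then G x
    else if Rle_dec x s then G r + K * (x - r)
    else G r + K * (s - r) + (G x - G s)).
Proof.
  intros Ir Is Hrs HK HG u v k Iu Iv Huv Hk.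
  assert (HkK : forall x, I x -> r <= x < s -> u <= x < v -> k <= K).
  { intros x Ix H1 H2. apply Rle_trans with (f x); [now apply Hk|now apply HK]. }
  assert (HL : forall x y, I x -> I y -> x <= y -> u <= x -> y <= v ->
            k * (y - x) <= G y - G x).
  { intros x y Ix Iy Hxy Hx Hy. destruct (Rle_lt_or_eq_dec _ _ Hxy) as [H|<-].
    - apply HG; auto. intros t It Ht. apply Hk; auto. lra.
    - lra. }
  destruct (Rle_dec u r) as [Hur|Hur].
  - destruct (Rle_dec v r) as [Hvr|Hvr]; [apply HL; auto; lra|].
    pose proof (HkK r Ir ltac:(lra) ltac:(lra)).
    pose proof (HL u r Iu Ir Hur ltac:(lra) ltac:(lra)).
    destruct (Rle_dec v s) as [Hvs|Hvs]; [nra|].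
    pose proof (HL s v Is Iv ltac:(lra) ltac:(lra) ltac:(lra)). nra.
  - destruct (Rle_dec v r) as [Hvr|Hvr]; [lra|].
    destruct (Rle_dec u s) as [Hus|Hus].
    + destruct (Rle_dec v s) as [Hvs|Hvs].
      * pose proof (HkK u Iu ltac:(lra) ltac:(lra)). nra.
      * pose proof (HL s v Is Iv ltac:(lra) ltac:(lra) ltac:(lra)).
        destruct (Rle_lt_or_eq_dec _ _ Hus) as [Hlt|Heq].
        -- pose proof (HkK u Iu ltac:(lra) ltac:(lra)). nra.
        -- rewrite Heq in *. lra.
    + destruct (Rle_dec v s) as [Hvs|Hvs]; [lra|].
      pose proof (HL u v Iu Iv ltac:(lra) ltac:(lra) ltac:(lra)). lra.
Qed.

(** The antiderivative is the infimum of the functions [G] vanishing at [a]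
    whose increments are bounded below by those of [f], as for an upper Darboux
    integral; splicing such a [G] with an affine piece bounds the increments of
    the infimum from above. *)
Lemma increment_bounds_exist (I : R -> Prop) (a b : R) (f : R -> R) (M : R) :
  compact_ts I a b -> (forall t, I t -> a <= t < b -> Rabs (f t) <= M) ->
  exists F, forall r s k K, I r -> I s -> r < s ->
    (forall t, I t -> r <= t < s -> k <= f t <= K) ->
    k * (s - r) <= F s - F r <= K * (s - r).
Proof.
  intros HI HM.
  set (G0 := fun G : R -> R => G a = 0 /\ lower_bounded_increments I f G).
  assert (Hf : forall r s, I r -> I s -> r < s -> - M <= f r <= M).
  { intros r s Ir Is Hrs. apply Rabs_le_between. apply HM; auto.
    pose proof (cts_bound _ _ _ HI r Ir). pose proof (cts_bound _ _ _ HI s Is). lra. }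
  (* This member of [G0] and the lower bound [HE] keep the infimum finite on [I]. *)
  assert (HM0 : G0 (fun t => M * (t - a))).
  { split; [ring|]. intros r s k Ir Is Hrs Hk.
    specialize (Hk r Ir ltac:(lra)). pose proof (Hf r s Ir Is Hrs). nra. }
  set (E := fun t x => exists G, G0 G /\ x = G t).
  assert (HE : forall t, I t -> is_lb_Rbar (E t) (- M * (t - a)) ).
  { intros t It x [G [[HGa HG] ->]]. simpl.
    destruct (cts_bound _ _ _ HI t It) as [Hat _].
    destruct (Rle_lt_or_eq_dec _ _ Hat) as [Hlt|<-]; [|rewrite HGa; lra].
    enough (- M * (t - a) <= G t - G a) by lra.
    apply HG; auto; [exact (cts_l _ _ _ HI)|].
    intros u Iu Hu. apply (Hf u t); auto. lra. }
  assert (Hglb : forall t, I t -> is_glb_Rbar (E t) (real (Glb_Rbar (E t)))).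
  { intros t It. pose proof (Glb_Rbar_correct (E t)) as [H1 H2].
    pose proof (H2 _ (HE t It)) as H3.
    pose proof (H1 (M * (t - a)) (ex_intro _ _ (conj HM0 eq_refl))) as H4.
    destruct (Glb_Rbar (E t)); simpl in H3, H4; try tauto. now split. }
  exists (fun t => real (Glb_Rbar (E t))). intros r s k K Ir Is Hrs HkK.
  destruct (Hglb r Ir) as [Lr Gr]. destruct (Hglb s Is) as [Ls Gs].
  split.
  - enough (Rbar_le (real (Glb_Rbar (E r)) + k * (s - r)) (real (Glb_Rbar (E s)))) as H
      by (simpl in H; lra).
    apply Gs. intros x [G [[HGa HG] ->]]. simpl.
    assert (Rbar_le (real (Glb_Rbar (E r))) (G r)) as H
      by (apply Lr; now exists G).
    simpl in H. enough (k * (s - r) <= G s - G r) by lra.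
    apply HG; auto. intros t It Ht. now apply HkK.
  - enough (Rbar_le (real (Glb_Rbar (E s)) - K * (s - r)) (real (Glb_Rbar (E r)))) as H
      by (simpl in H; lra).
    apply Gr. intros x [G [[HGa HG] ->]]. simpl.
    enough (real (Glb_Rbar (E s)) <= G r + K * (s - r)) by lra.
    (* The spliced function is the competitor; this is its value at [s]. *)
    apply (Ls (G r + K * (s - r))).
    eexists. split; [split|].
    2: { apply (lower_bounded_increments_splice I f G r s K); auto.
         intros t It Ht. now apply HkK. }
    + simpl. destruct (Rle_dec a r) as [_|N]; [exact HGa|].
      destruct N. apply (cts_bound _ _ _ HI r Ir).
    + simpl. destruct (Rle_dec s r); [lra|].
      destruct (Rle_dec s s); lra.
Qed.

(** At a right-dense point continuity of [f] squeezes the increments of [F] between nearby slopes.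
    At a right-scattered point the jump is exact, and boundedness of [f] gives the continuity of
    [F]. *)
Lemma anti_delta_exists (I : R -> Prop) (a b : R) (f : R -> R) :
  compact_ts I a b -> rd_bounded I f -> exists F, anti_delta I f F.
Proof.
  intros HI [[M HM] Hc].
  assert (HM' : forall t, I t -> a <= t < b -> Rabs (f t) <= M).
  { intros t It Ht. apply HM. apply (upper_kappa_lt I a b); auto. lra. }
  destruct (increment_bounds_exist I a b f M HI HM') as [F HF].
  assert (HFc : forall t eps e, I t -> 0 < eps ->
    (forall s, I s -> s < b -> Rabs (s - t) < e -> Rabs (f s - f t) <= eps) ->
    forall s, I s -> Rabs (s - t) < e -> Rabs (F t - F s - f t * (t - s)) <= eps * Rabs (t - s)).
  { intros t eps e It He H s Is Hs.
    assert (H' : forall u, I u -> u < b -> Rabs (u - t) < e -> f t - eps <= f u <= f t + eps).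
    { intros u Iu Hu Hut. specialize (H u Iu Hu Hut). apply Rabs_le_between in H. lra. }
    pose proof (cts_bound _ _ _ HI s Is). pose proof (cts_bound _ _ _ HI t It).
    destruct (Rtotal_order s t) as [Hst|[->|Hst]].
    - pose proof (HF s t (f t - eps) (f t + eps) Is It Hst) as HB.
      rewrite (Rabs_pos_eq (t - s)) by lra.
      enough (f t * (t - s) - eps * (t - s) <= F t - F s <= f t * (t - s) + eps * (t - s))
        by (apply Rabs_le; lra).
      rewrite <- Rmult_minus_distr_r, <- Rmult_plus_distr_r. apply HB.
      intros u Iu Hu. apply H'; auto; try lra.
      rewrite Rabs_left in * by lra. lra.
    - rewrite !Rminus_diag, Rmult_0_r, Rminus_diag, Rabs_R0. lra.
    - pose proof (HF t s (f t - eps) (f t + eps) It Is Hst) as HB.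
      rewrite (Rabs_left (t - s)) by lra.
      enough (f t * (s - t) - eps * (s - t) <= F s - F t <= f t * (s - t) + eps * (s - t))
        by (apply Rabs_le; lra).
      rewrite <- Rmult_minus_distr_r, <- Rmult_plus_distr_r. apply HB.
      intros u Iu Hu. apply H'; auto; try lra.
      rewrite Rabs_pos_eq in * by lra. lra. }
  exists F. intros t Kt. pose proof (upper_kappa_in _ _ Kt) as It.
  destruct (sigma_spec I a b t HI It) as [Ix [[Hx1 Hx2] Hx3]].
  destruct (Rle_lt_or_eq_dec _ _ Hx1) as [Hlt|Heq].
  - apply is_delta_derive_scattered; [exact Hlt| |].
    + apply continuous_within_eps. intros eps He.
      assert (HMt : Rabs (f t) <= M) by now apply HM.
      pose proof (Rabs_pos (f t)).
      (* [2 * M + 1] bounds the oscillation of [f] and stays positive, as [HFc] demands; adding the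
         slope bound [M] gives [C], a Lipschitz constant of [F] at [t]. *)
      set (C := 3 * M + 1).
      assert (HC : 0 < C) by (unfold C; lra).
      exists (eps / C). split; [now apply Rdiv_lt_0_compat|]. intros s Is Hs.
      rewrite Rabs_minus_sym.
      assert (H' := HFc t (2 * M + 1) (eps / C) It ltac:(lra)).
      assert (Hs' : Rabs (F t - F s - f t * (t - s)) <= (2 * M + 1) * Rabs (t - s)).
      { apply H'; auto. intros u Iu Hu _.
        pose proof (HM u (upper_kappa_lt I a b u HI Iu Hu)).
        unfold Rminus. eapply Rle_trans; [apply Rabs_triang|].
        rewrite Rabs_Ropp. lra. }
      replace (F t - F s) with ((F t - F s - f t * (t - s)) + f t * (t - s)) by ring.
      eapply Rle_lt_trans; [apply Rabs_triang|]. rewrite Rabs_mult.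
      rewrite (Rabs_minus_sym s t) in Hs.
      assert (Rabs (f t) * Rabs (t - s) <= M * Rabs (t - s))
        by (apply Rmult_le_compat_r; [apply Rabs_pos|lra]).
      apply Rle_lt_trans with (C * Rabs (t - s)); [unfold C; lra|].
      replace eps with (C * (eps / C)) by (field; lra).
      apply Rmult_lt_compat_l; assumption.
    (* Both bounds may be taken equal to [f t], because [t] is the only point of [I] in
       [[t, sigma t)]. *)
    + apply Rle_antisym; apply (HF t (sigma_ts I t) (f t) (f t)); auto;
        intros u Iu [[Hu|<-] Hu2]; try lra; specialize (Hx3 u Iu Hu); lra.
  - symmetry in Heq. apply is_delta_derive_eps. rewrite Heq. intros eps He.
    pose proof (Hc t Kt Heq) as HC. rewrite continuous_within_eps in HC.
    destruct (HC eps He) as [d [Hd H]]. exists d. split; [exact Hd|].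
    apply HFc; auto. intros s Is Hs Hst. left. apply H; [|exact Hst].
    now apply (upper_kappa_lt I a b).
Qed.

(** * Nabla calculus by reflection *)

Lemma is_nabla_derive_eps (I : R -> Prop) (y : R -> R) (t l : R) :
  is_nabla_derive I y t l <->
  forall eps, 0 < eps -> exists d, 0 < d /\
    forall s, I s -> Rabs (s - t) < d ->
      Rabs (y (rho_ts I t) - y s - l * (rho_ts I t - s))
        <= eps * Rabs (rho_ts I t - s).
Proof.
  split.
  - intros H eps He. destruct (H (mkposreal eps He)) as [d Hd].
    exists d. split; [apply cond_pos|]. intros s Is Hs. now apply Hd.
  - intros H eps. destruct (H eps (cond_pos eps)) as [d [Hd Hs]].
    exists (mkposreal d Hd). intros s Bs Is. apply Hs; assumption.
Qed.

(** With a minus sign both outside and inside, the function is turned by half a turn about the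
    origin, which leaves slopes unchanged. *)
Lemma is_nabla_derive_reflect (I : R -> Prop) (F : R -> R) (t l : R) :
  is_nabla_derive I F t l <->
  is_delta_derive (reflect I) (fun s => - F (- s)) (- t) l.
Proof.
  rewrite is_nabla_derive_eps, is_delta_derive_eps, rho_reflect.
  set (x := sigma_ts (reflect I) (- t)).
  assert (E : forall s, Rabs (- F (- x) - - F (- - s) - l * (x - - s)) =
                        Rabs (F (- x) - F s - l * (- x - s))).
  { intros s. rewrite Ropp_involutive, <- Rabs_Ropp. f_equal. ring. }
  assert (E' : forall s, Rabs (- x - s) = Rabs (x - - s)).
  { intros s. rewrite <- Rabs_Ropp. f_equal. ring. }
  split; intros H eps He; destruct (H eps He) as [d [Hd Hs]];
    exists d; (split; [exact Hd|]); intros s Is Hst.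
  - replace s with (- - s) by ring. rewrite E, <- E'. apply Hs; [exact Is|].
    rewrite <- Rabs_Ropp. now replace (- (- s - t)) with (s - - t) by ring.
  - rewrite <- E, E'. apply Hs.
    + unfold reflect. now rewrite Ropp_involutive.
    + rewrite <- Rabs_Ropp. now replace (- (- s - - t)) with (s - t) by ring.
Qed.

Definition anti_nabla (I : R -> Prop) (f F : R -> R) : Prop :=
  forall t, lower_kappa I t -> is_nabla_derive I F t (f t).

Lemma anti_nabla_reflect (I : R -> Prop) (f F : R -> R) :
  anti_nabla I f F <->
  anti_delta (reflect I) (fun s => f (- s)) (fun s => - F (- s)).
Proof.
  split; intros H t Kt.
  - apply upper_kappa_reflect in Kt. apply H, is_nabla_derive_reflect in Kt.
    now rewrite Ropp_involutive in Kt.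
  - apply is_nabla_derive_reflect. rewrite <- (Ropp_involutive t) at 2.
    apply H. apply upper_kappa_reflect. now rewrite Ropp_involutive.
Qed.

Lemma continuous_within_reflect (D D' : R -> Prop) (f : R -> R) (t : R) :
  (forall s, D s <-> D' (- s)) ->
  continuous_within D (fun s => f (- s)) t <-> continuous_within D' f (- t).
Proof.
  intros HD. rewrite !continuous_within_eps.
  split; intros H eps He; destruct (H eps He) as [d [Hd Hs]];
    exists d; (split; [exact Hd|]); intros s Ds Hst.
  - specialize (Hs (- s)). rewrite HD, Ropp_involutive in Hs. apply Hs; [exact Ds|].
    rewrite <- Rabs_Ropp. now replace (- (- s - t)) with (s - - t) by ring.
  - apply Hs; [now apply HD|].
    rewrite <- Rabs_Ropp. now replace (- (- s - - t)) with (s - t) by ring.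
Qed.

Lemma reflect_opp (I : R -> Prop) (t : R) : reflect I (- t) <-> I t.
Proof. unfold reflect. now rewrite Ropp_involutive. Qed.

Lemma anti_nabla_continuous (I : R -> Prop) (a b t : R) (f F : R -> R) :
  compact_ts I a b -> anti_nabla I f F -> I t -> continuous_within I F t.
Proof.
  intros HI HF It. apply anti_nabla_reflect in HF.
  apply (anti_delta_continuous _ (- b) (- a) (- t)) in HF.
  - rewrite continuous_within_eps in HF |- *. intros eps He.
    destruct (HF eps He) as [d [Hd H]]. exists d. split; [exact Hd|].
    intros s Is Hs. specialize (H (- s)). rewrite !Ropp_involutive in H.
    rewrite <- Rabs_Ropp. replace (- (F s - F t)) with (- F s - - F t) by ring.
    apply H; [now apply reflect_opp|].
    rewrite <- Rabs_Ropp. now replace (- (- s - - t)) with (s - t) by ring.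
  - now apply compact_ts_reflect.
  - now apply reflect_opp.
Qed.

Lemma is_nabla_derive_unique (I : R -> Prop) (a b : R) (F : R -> R) (t l m : R) :
  compact_ts I a b -> lower_kappa I t ->
  is_nabla_derive I F t l -> is_nabla_derive I F t m -> l = m.
Proof.
  rewrite !is_nabla_derive_reflect. intros HI Kt.
  apply (is_delta_derive_unique _ (- b) (- a)).
  - now apply compact_ts_reflect.
  - apply upper_kappa_reflect. now rewrite Ropp_involutive.
Qed.

Lemma is_nabla_derive_ext (I : R -> Prop) (a b : R) (F G : R -> R) (t l : R) :
  compact_ts I a b -> I t -> (forall s, I s -> F s = G s) ->
  is_nabla_derive I F t l -> is_nabla_derive I G t l.
Proof.
  intros HI It HFG HF eps. destruct (HF eps) as [d Hd]. exists d.
  intros s Bs Is. rewrite <- !HFG; auto.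
  apply (rho_spec I a b t HI It).
Qed.

Lemma is_nabla_derive_lin (I : R -> Prop) (F G : R -> R) (t l m u v : R) :
  is_nabla_derive I F t l -> is_nabla_derive I G t m ->
  is_nabla_derive I (fun s => u * F s + v * G s) t (u * l + v * m).
Proof.
  rewrite !is_nabla_derive_reflect. intros HF HG.
  replace (fun s => - (u * F (- s) + v * G (- s)))
    with (fun s => u * - F (- s) + v * - G (- s)).
  - now apply is_delta_derive_lin.
  - apply functional_extensionality. intros s. ring.
Qed.

Lemma is_nabla_derive_mult (I : R -> Prop) (F G : R -> R) (t l m : R) :
  I t -> is_nabla_derive I F t l -> is_nabla_derive I G t m ->
  is_nabla_derive I (fun s => F s * G s) t (l * G (rho_ts I t) + F t * m).
Proof.
  rewrite !is_nabla_derive_reflect. intros It HF HG.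
  pose proof (is_delta_derive_mult _ _ _ _ _ _ (proj2 (reflect_opp I t) It) HF HG) as H.
  pose proof (is_delta_derive_lin _ _ _ _ _ _ (-1) 0 H H) as H'.
  cbv beta in H'. rewrite <- rho_reflect, Ropp_involutive in H'.
  replace (fun s => - (F (- s) * G (- s))) with
    (fun s => -1 * (- F (- s) * - G (- s)) + 0 * (- F (- s) * - G (- s))).
  - replace (l * G (rho_ts I t) + F t * m) with
      (-1 * (l * - G (rho_ts I t) + - F t * m) + 0 * (l * - G (rho_ts I t) + - F t * m))
      by ring. exact H'.
  - apply functional_extensionality. intros s. ring.
Qed.

Lemma is_nabla_derive_const (I : R -> Prop) (k t : R) :
  is_nabla_derive I (fun _ => k) t 0.
Proof. apply is_nabla_derive_reflect, is_delta_derive_const. Qed.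

Lemma is_nabla_derive_id (I : R -> Prop) (t : R) :
  is_nabla_derive I (fun s => s) t 1.
Proof.
  apply is_nabla_derive_reflect.
  replace (fun s => - - s) with (fun s : R => s); [apply is_delta_derive_id|].
  apply functional_extensionality. intros s. ring.
Qed.

Lemma anti_nabla_lin (I : R -> Prop) (f g F G : R -> R) (u v : R) :
  anti_nabla I f F -> anti_nabla I g G ->
  anti_nabla I (fun t => u * f t + v * g t) (fun t => u * F t + v * G t).
Proof. intros HF HG t Kt. now apply is_nabla_derive_lin; [apply HF|apply HG]. Qed.

Lemma anti_nabla_ext (I : R -> Prop) (f g F : R -> R) :
  (forall t, lower_kappa I t -> f t = g t) -> anti_nabla I f F -> anti_nabla I g F.
Proof. intros H HF t Kt. rewrite <- H; auto. Qed.

Lemma nabla_increment_abs_le (I : R -> Prop) (a b r s M : R) (f F : R -> R) :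
  compact_ts I a b -> anti_nabla I f F -> I r -> I s -> r <= s ->
  (forall t, I t -> r < t <= s -> Rabs (f t) <= M) ->
  Rabs (F s - F r) <= M * (s - r).
Proof.
  intros HI HF Ir Is Hrs Hf. apply anti_nabla_reflect in HF.
  replace (F s - F r) with (- F (- - r) - - F (- - s))
    by (rewrite !Ropp_involutive; ring).
  replace (s - r) with (- r - - s) by ring.
  apply (delta_increment_abs_le (reflect I) (- b) (- a) (- s) (- r) M _ _
    (compact_ts_reflect _ _ _ HI) HF).
  - now apply reflect_opp.
  - now apply reflect_opp.
  - lra.
  - intros t It Ht. apply Hf; [exact It|lra].
Qed.

Lemma nabla_increment_eq (I : R -> Prop) (a b r s : R) (f g F G : R -> R) :
  compact_ts I a b -> anti_nabla I f F -> anti_nabla I g G ->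
  I r -> I s -> r <= s -> (forall t, I t -> r < t <= s -> f t = g t) ->
  F s - F r = G s - G r.
Proof.
  intros HI HF HG Ir Is Hrs H.
  assert (H' := nabla_increment_abs_le I a b r s 0 _ _ HI
    (anti_nabla_lin I f g F G 1 (-1) HF HG) Ir Is Hrs).
  simpl in H'. rewrite Rmult_0_l in H'.
  enough (1 * F s + -1 * G s - (1 * F r + -1 * G r) = 0) by lra.
  apply Rabs_eq_0. apply Rle_antisym; [|apply Rabs_pos]. apply H'.
  intros t It Ht. rewrite (H t It Ht).
  replace (1 * g t + -1 * g t) with 0 by ring. rewrite Rabs_R0. lra.
Qed.

Lemma nabla_int_eq (I : R -> Prop) (a b r s : R) (f F : R -> R) :
  compact_ts I a b -> anti_nabla I f F -> I r -> I s ->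
  nabla_int I f r s = F s - F r.
Proof.
  intros HI HF Ir Is. unfold nabla_int.
  assert (Hex : exists v, is_nabla_int I f r s v).
  { exists (F s - F r), F. now split. }
  pose proof (epsilon_spec (inhabits 0) _ Hex) as [G [HG ->]].
  destruct (Rle_lt_dec r s) as [Hrs|Hrs].
  - now apply (nabla_increment_eq I a b r s f f).
  - enough (G r - G s = F r - F s) by lra.
    apply (nabla_increment_eq I a b s r f f); auto. lra.
Qed.

Definition ld_bounded (I : R -> Prop) (f : R -> R) : Prop :=
  (exists M, forall t, lower_kappa I t -> Rabs (f t) <= M) /\
  (forall t, lower_kappa I t -> rho_ts I t = t ->
     continuous_within (lower_kappa I) f t).

Lemma ld_bounded_reflect (I : R -> Prop) (f : R -> R) :
  ld_bounded I f <-> rd_bounded (reflect I) (fun s => f (- s)).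
Proof.
  pose proof (continuous_within_reflect (upper_kappa (reflect I)) (lower_kappa I) f)
    as HC.
  split; intros [[M HM] H]; (split; [exists M|]); intros t Kt.
  - apply HM. exact (proj1 (upper_kappa_reflect I t) Kt).
  - intros Ht. apply HC; [apply upper_kappa_reflect|]. apply H.
    + exact (proj1 (upper_kappa_reflect I t) Kt).
    + rewrite rho_reflect, Ropp_involutive. lra.
  - rewrite <- (Ropp_involutive t). apply HM. apply upper_kappa_reflect.
    now rewrite Ropp_involutive.
  - intros Ht. rewrite <- (Ropp_involutive t).
    apply HC; [apply upper_kappa_reflect|]. apply H.
    + apply upper_kappa_reflect. now rewrite Ropp_involutive.
    + rewrite rho_reflect in Ht. lra.
Qed.

Lemma anti_nabla_exists (I : R -> Prop) (a b : R) (f : R -> R) :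
  compact_ts I a b -> ld_bounded I f -> exists F, anti_nabla I f F.
Proof.
  intros HI Hf. apply ld_bounded_reflect in Hf.
  destruct (anti_delta_exists _ _ _ _ (compact_ts_reflect _ _ _ HI) Hf) as [F HF].
  exists (fun s => - F (- s)). apply anti_nabla_reflect.
  replace (fun s => - - F (- - s)) with F; [exact HF|].
  apply functional_extensionality. intros s. now rewrite !Ropp_involutive.
Qed.

(** A left-scattered [t] closes the gap that starts at [rho_ts I t], where the jump of [F] is
    [f (rho_ts I t)] times the length. At a left-dense [t] the oscillation of [f] controls the
    increments of [F] minus its tangent; continuity is an assumption there because [rd_bounded] is
    silent when [t] is right-scattered. *)
Lemma is_nabla_derive_anti_delta (I : R -> Prop) (a b t : R) (f F : R -> R) :
  compact_ts I a b -> anti_delta I f F -> I t ->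
  (rho_ts I t = t -> continuous_within (upper_kappa I) f t) ->
  is_nabla_derive I F t (f (rho_ts I t)).
Proof.
  intros HI HF It Hc.
  destruct (rho_spec I a b t HI It) as [Ir [[Hr1 Hr2] Hr3]].
  pose proof (cts_bound _ _ _ HI t It) as Hb.
  destruct (Rle_lt_or_eq_dec _ _ Hr2) as [Hlt|Heq].
  - apply is_nabla_derive_reflect.
    assert (HC := anti_delta_continuous I a b t f F HI HF It).
    assert (Kr : upper_kappa I (rho_ts I t)) by (apply (upper_kappa_lt I a b); auto; lra).
    pose proof (delta_derive_jump I F _ _ Ir (HF _ Kr)) as Hj.
    rewrite (sigma_rho I a b t HI It Hlt) in Hj.
    assert (Es : sigma_ts (reflect I) (- t) = - rho_ts I t)
      by (rewrite sigma_reflect, Ropp_involutive; reflexivity).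
    apply is_delta_derive_scattered; rewrite ?Es.
    + lra.
    + rewrite continuous_within_eps in HC |- *. intros eps He.
      destruct (HC eps He) as [d [Hd H]]. exists d. split; [exact Hd|].
      intros s Is Hs. rewrite !Ropp_involutive.
      rewrite <- Rabs_Ropp. replace (- (- F (- s) - - F t)) with (F (- s) - F t) by ring.
      apply H; [exact Is|].
      rewrite <- Rabs_Ropp. now replace (- (- s - t)) with (s - - t) by ring.
    + rewrite !Ropp_involutive. lra.
  - apply is_nabla_derive_eps. rewrite Heq. intros eps He.
    specialize (Hc Heq). rewrite continuous_within_eps in Hc.
    destruct (Hc eps He) as [d [Hd H]]. exists d. split; [exact Hd|].
    (* Subtracting the tangent line leaves an antiderivative of [f - f t], which is below [eps] near
       [t]. *)
    assert (HG : anti_delta I (fun s => 1 * f s + - f t * 1) (fun s => 1 * F s + - f t * s)).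
    { apply anti_delta_lin; [exact HF|]. intros s _. apply is_delta_derive_id. }
    assert (HGb : forall r s, I r -> I s -> r <= s -> Rabs (r - t) < d ->
      Rabs (s - t) < d ->
      Rabs (1 * F s + - f t * s - (1 * F r + - f t * r)) <= eps * (s - r)).
    { intros r s Ir' Is Hrs Hrt Hst.
      apply (delta_increment_abs_le I a b r s eps _ _ HI HG); auto.
      intros u Iu Hu. left. replace (1 * f u + - f t * 1) with (f u - f t) by ring.
      pose proof (cts_bound _ _ _ HI s Is).
      apply Rabs_def2 in Hrt, Hst.
      apply H; [apply (upper_kappa_lt I a b); auto; lra|].
      apply Rabs_def1; lra. }
    intros s Is Hst. assert (Htt : Rabs (t - t) < d) by (rewrite Rminus_diag, Rabs_R0; lra).
    destruct (Rle_lt_dec s t) as [Hle|Hlt].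
    + specialize (HGb s t Is It Hle Hst Htt). rewrite (Rabs_pos_eq (t - s)) by lra.
      now replace (F t - F s - f t * (t - s))
        with (1 * F t + - f t * t - (1 * F s + - f t * s)) by ring.
    + specialize (HGb t s It Is ltac:(lra) Htt Hst).
      rewrite (Rabs_minus_sym t s), (Rabs_pos_eq (s - t)) by lra.
      rewrite <- Rabs_Ropp. now replace (- (F t - F s - f t * (t - s)))
        with (1 * F s + - f t * s - (1 * F t + - f t * t)) by ring.
Qed.

Lemma is_delta_derive_anti_nabla (I : R -> Prop) (a b t : R) (f F : R -> R) :
  compact_ts I a b -> anti_nabla I f F -> I t ->
  (sigma_ts I t = t -> continuous_within (lower_kappa I) f t) ->
  is_delta_derive I F t (f (sigma_ts I t)).
Proof.
  intros HI HF It Hc. apply anti_nabla_reflect in HF.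
  pose proof (is_nabla_derive_anti_delta (reflect I) (- b) (- a) (- t) _ _
    (compact_ts_reflect _ _ _ HI) HF (proj2 (reflect_opp I t) It)) as H.
  rewrite is_nabla_derive_reflect, reflect_involutive in H.
  rewrite rho_reflect, reflect_involutive, !Ropp_involutive in H.
  replace (fun s => - - F (- - s)) with F in H.
  2: { apply functional_extensionality. intros s. now rewrite !Ropp_involutive. }
  apply H. intros Hs.
  apply (continuous_within_reflect (upper_kappa (reflect I)) (lower_kappa I)).
  - apply upper_kappa_reflect.
  - rewrite Ropp_involutive. apply Hc. lra.
Qed.

(** * Continuity and boundedness on compact time scales *)

Lemma continuous_within_lin (D : R -> Prop) (f g : R -> R) (t u v : R) :
  continuous_within D f t -> continuous_within D g t ->
  continuous_within D (fun s => u * f s + v * g s) t.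
Proof.
  intros Hf Hg. unfold continuous_within in *.
  apply (filterlim_comp_2 (G := locally (u * f t)) (H := locally (v * g t))).
  - apply (filterlim_comp _ _ _ f (fun x => u * x) _ (locally (f t)) _ Hf).
    apply (filterlim_scal_r u (f t)).
  - apply (filterlim_comp _ _ _ g (fun x => v * x) _ (locally (g t)) _ Hg).
    apply (filterlim_scal_r v (g t)).
  - apply (filterlim_plus (u * f t) (v * g t)).
Qed.

Lemma continuous_within_mult (D : R -> Prop) (f g : R -> R) (t : R) :
  continuous_within D f t -> continuous_within D g t ->
  continuous_within D (fun s => f s * g s) t.
Proof.
  intros Hf Hg. unfold continuous_within in *.
  apply (filterlim_comp_2 (G := locally (f t)) (H := locally (g t))); auto.
  apply (filterlim_mult (f t) (g t)).
Qed.

Lemma continuous_within_subset (D D' : R -> Prop) (f : R -> R) (t : R) :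
  (forall s, D' s -> D s) -> continuous_within D f t -> continuous_within D' f t.
Proof.
  rewrite !continuous_within_eps. intros H Hf eps He.
  destruct (Hf eps He) as [d [Hd Hs]]. exists d. split; auto.
Qed.

Lemma continuous_within_ext (D : R -> Prop) (f g : R -> R) (t : R) :
  (forall s, D s -> f s = g s) -> D t ->
  continuous_within D f t -> continuous_within D g t.
Proof.
  rewrite !continuous_within_eps. intros H Dt Hf eps He.
  destruct (Hf eps He) as [d [Hd Hs]]. exists d. split; [exact Hd|].
  intros s Ds Hst. rewrite <- !H; auto.
Qed.

Lemma continuous_within_const (D : R -> Prop) (k t : R) :
  continuous_within D (fun _ => k) t.
Proof.
  apply continuous_within_eps. intros eps He. exists 1. split; [lra|].
  intros s _ _. now rewrite Rminus_diag, Rabs_R0.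
Qed.

Lemma rd_bounded_lin (I : R -> Prop) (f g : R -> R) (u v : R) :
  rd_bounded I f -> rd_bounded I g -> rd_bounded I (fun t => u * f t + v * g t).
Proof.
  intros [[M HM] Hf] [[N HN] Hg]. split.
  - exists (Rabs u * M + Rabs v * N). intros t Kt.
    eapply Rle_trans; [apply Rabs_triang|]. rewrite !Rabs_mult.
    apply Rplus_le_compat; apply Rmult_le_compat_l; auto using Rabs_pos.
  - intros t Kt Hs. apply continuous_within_lin; auto.
Qed.

Lemma rd_bounded_mult (I : R -> Prop) (f g : R -> R) :
  rd_bounded I f -> rd_bounded I g -> rd_bounded I (fun t => f t * g t).
Proof.
  intros [[M HM] Hf] [[N HN] Hg]. split.
  - exists (M * N). intros t Kt. rewrite Rabs_mult.
    apply Rmult_le_compat; auto using Rabs_pos.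
  - intros t Kt Hs. apply continuous_within_mult; auto.
Qed.

(** A Lebesgue number for a gauge on [I] times a square. The compactness principle concerns full
    boxes, so tags outside [I] must be made harmless. *)
Lemma compact_ts_box (I : R -> Prop) (a b M : R) (P : R -> R -> R -> posreal -> Prop) :
  compact_ts I a b ->
  (forall t x v, I t -> exists d, P t x v d) ->
  exists d : posreal, forall t x v, I t -> Rabs x <= M -> Rabs v <= M ->
    exists t0 x0 v0 (d0 : posreal), P t0 x0 v0 d0 /\
      Rabs (t - t0) < d0 /\ Rabs (x - x0) < d0 /\ Rabs (v - v0) < d0 /\ d <= d0.
Proof.
  intros HI HP.
  (* Outside the closed set [I] the radius is so small that the neighbourhood of the tag misses
     [I]. *)
  assert (HQ : forall t x v, exists d : posreal,
    (I t /\ P t x v d) \/ (~ I t /\ forall s, I s -> ~ Rabs (s - t) < d)).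
  { intros t x v. destruct (classic (I t)) as [It|Nt].
    - destruct (HP t x v It) as [d Hd]. exists d. now left.
    - apply NNPP. intros N. apply Nt. apply closed_adherent; [exact (cts_closed _ _ _ HI)|].
      intros d Hd. apply NNPP. intros N'. apply N. exists (mkposreal d Hd). right.
      split; [exact Nt|]. intros s Is Hs. apply N'. now exists s. }
  set (del := fun p : Compactness.Tn 3 R =>
    epsilon (inhabits (mkposreal 1 Rlt_0_1))
      (fun d : posreal => let '(t, (x, (v, _))) := p in
        (I t /\ P t x v d) \/ (~ I t /\ forall s, I s -> ~ Rabs (s - t) < d))).
  destruct (compactness_value 3 (a, (- M, (- M, tt))) (b, (M, (M, tt))) del) as [d Hd].
  (* The principle returns its tag under a double negation, hence the classical step. *)
  exists d. intros t x v It Hx Hv. apply NNPP. intros N.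
  apply (Hd (t, (x, (v, tt)))).
  { simpl. apply Rabs_le_between in Hx. apply Rabs_le_between in Hv.
    pose proof (cts_bound _ _ _ HI t It). tauto. }
  intros [[t0 [x0 [v0 []]]] [_ [[H1 [H2 [H3 _]]] H4]]]. apply N.
  exists t0, x0, v0, (del (t0, (x0, (v0, tt)))).
  assert (Hspec := epsilon_spec (inhabits (mkposreal 1 Rlt_0_1)) _ (HQ t0 x0 v0)).
  destruct Hspec as [[_ Hspec]|[_ Hspec]].
  - repeat split; auto.
  - destruct (Hspec t It H1).
Qed.

(** Lets one radius also record a bound: shrinking it below [/ B] makes its inverse at least [B]. *)
Lemma le_inv_Rmin (d B : R) : 0 < d -> 0 < B -> B <= / Rmin d (/ B).
Proof.
  intros Hd HB. pose proof (Rinv_0_lt_compat _ HB) as HB'.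
  apply Rle_trans with (/ / B); [rewrite Rinv_inv; lra|].
  apply Rinv_le_contravar; [now apply Rmin_glb_lt|apply Rmin_r].
Qed.

(** Each radius [d] also carries the bound [/ d], so a uniform radius is at once a uniform bound;
    the other two coordinates of the box are kept at 0. Local bounds are asked at all points of [I],
    which is the compact set, while [f] is estimated only on [Q]. *)
Lemma locally_bounded_bounded (I Q : R -> Prop) (a b : R) (f : R -> R) :
  compact_ts I a b -> (forall t, Q t -> I t) ->
  (forall t, I t -> exists d M, 0 < d /\
     forall s, Q s -> Rabs (s - t) < d -> Rabs (f s) <= M) ->
  exists M, forall t, Q t -> Rabs (f t) <= M.
Proof.
  intros HI HQ H.
  destruct (compact_ts_box I a b 0 (fun t _ _ d => forall s, Q s ->
    Rabs (s - t) < d -> Rabs (f s) <= / d) HI) as [d Hd].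
  - intros t _ _ It. destruct (H t It) as [d [M [Hd HM]]].
    pose proof (Rabs_pos M).
    assert (HM' : 0 < / (Rabs M + 1)) by (apply Rinv_0_lt_compat; lra).
    exists (mkposreal (Rmin d (/ (Rabs M + 1))) (Rmin_glb_lt _ _ _ Hd HM')).
    simpl. intros s Qs Hs. apply Rle_trans with M.
    + apply HM; [exact Qs|]. eapply Rlt_le_trans; [exact Hs|apply Rmin_l].
    + apply Rle_trans with (Rabs M + 1); [pose proof (Rle_abs M); lra|].
      apply le_inv_Rmin; lra.
  - exists (/ d). intros t Qt.
    destruct (Hd t 0 0 (HQ t Qt)) as [t0 [_ [_ [d0 [H1 [H2 [_ [_ H3]]]]]]]];
      try (rewrite Rabs_R0; lra).
    apply Rle_trans with (/ d0); [now apply H1|].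
    apply Rinv_le_contravar; [apply cond_pos|exact H3].
Qed.

Lemma continuous_within_locally_bounded (D : R -> Prop) (f : R -> R) (t : R) :
  continuous_within D f t -> exists d M, 0 < d /\
     forall s, D s -> Rabs (s - t) < d -> Rabs (f s) <= M.
Proof.
  rewrite continuous_within_eps. intros H. destruct (H 1) as [d [Hd Hs]]; [lra|].
  exists d, (Rabs (f t) + 1). split; [exact Hd|]. intros s Ds Hst.
  specialize (Hs s Ds Hst). replace (f s) with (f t + (f s - f t)) by ring.
  eapply Rle_trans; [apply Rabs_triang|lra].
Qed.

Lemma continuous_bounded (I : R -> Prop) (a b : R) (f : R -> R) :
  compact_ts I a b -> (forall t, I t -> continuous_within I f t) ->
  exists M, forall t, I t -> Rabs (f t) <= M.
Proof.
  intros HI Hf. apply (locally_bounded_bounded I I a b); auto.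
  intros t It. now apply continuous_within_locally_bounded, Hf.
Qed.

Lemma continuous_upper_kappa_bounded (I : R -> Prop) (a b : R) (f : R -> R) :
  compact_ts I a b -> (forall t, upper_kappa I t -> continuous_within (upper_kappa I) f t) ->
  exists M, forall t, upper_kappa I t -> Rabs (f t) <= M.
Proof.
  intros HI Hf. apply (locally_bounded_bounded I (upper_kappa I) a b); auto.
  { apply upper_kappa_in. }
  intros t It. destruct (upper_kappa_dec I a b t HI It) as [Kt|[-> Hr]].
  - now apply continuous_within_locally_bounded, Hf.
  (* A left-scattered [b] has been removed and is isolated, so the bound 0 holds vacuously near
     it. *)
  - exists (b - rho_ts I b), 0. split; [lra|]. intros s Ks Hs. exfalso.
    pose proof (upper_kappa_in _ _ Ks) as Is.
    destruct (rho_spec I a b b HI It) as [_ [_ H]].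
    pose proof (cts_bound _ _ _ HI s Is) as Hb.
    destruct (Rle_lt_or_eq_dec s b) as [Hlt|Heq]; [lra| |subst s].
    + specialize (H s Is Hlt). rewrite Rabs_left in Hs; lra.
    + destruct Ks as [_ Ks]. apply Ks. split; [|lra].
      intros u Iu. apply (cts_bound _ _ _ HI u Iu).
Qed.

(** On the left of [t] one has [s <= sigma s <= t]; on the right, a point [x] of [I] just beyond [t]
    caps [sigma s] for every [s] below [x]. *)
Lemma sigma_continuous_within (I : R -> Prop) (a b t : R) :
  compact_ts I a b -> I t -> sigma_ts I t = t ->
  continuous_within I (sigma_ts I) t.
Proof.
  intros HI It Ht. apply continuous_within_eps. rewrite Ht. intros eps He.
  pose proof (cts_bound _ _ _ HI t It) as Hb.
  assert (Hleft : forall s, I s -> s <= t -> s <= sigma_ts I s <= t).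
  { intros s Is Hs. destruct (sigma_spec I a b s HI Is) as [_ [H1 H2]].
    split; [lra|]. destruct (Rle_lt_or_eq_dec _ _ Hs) as [Hlt| ->]; [auto|lra]. }
  destruct (Rle_lt_or_eq_dec t b) as [Hlt|Heq]; [lra| |].
  - destruct (right_dense_approx I a b t eps HI It Hlt Ht He) as [x [Ix Hx]].
    exists (Rmin eps (x - t)). split; [apply Rmin_glb_lt; lra|]. intros s Is Hs.
    pose proof (Rmin_l eps (x - t)). pose proof (Rmin_r eps (x - t)).
    apply Rabs_def2 in Hs. destruct (Rle_lt_dec s t) as [Hst|Hst].
    + specialize (Hleft s Is Hst). apply Rabs_def1; lra.
    + destruct (sigma_spec I a b s HI Is) as [_ [H1 H2]].
      specialize (H2 x Ix ltac:(lra)). apply Rabs_def1; lra.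
  - exists eps. split; [exact He|]. intros s Is Hs. apply Rabs_def2 in Hs.
    pose proof (cts_bound _ _ _ HI s Is).
    specialize (Hleft s Is ltac:(lra)). apply Rabs_def1; lra.
Qed.

Lemma continuous_within_comp_sigma (I : R -> Prop) (a b t : R) (f : R -> R) :
  compact_ts I a b -> I t -> sigma_ts I t = t -> continuous_within I f t ->
  continuous_within I (fun s => f (sigma_ts I s)) t.
Proof.
  intros HI It Ht Hf. pose proof (sigma_continuous_within I a b t HI It Ht) as Hs.
  rewrite continuous_within_eps in *. rewrite Ht in *. intros eps He.
  destruct (Hf eps He) as [d [Hd H]]. destruct (Hs d Hd) as [d' [Hd' H']].
  exists d'. split; [exact Hd'|]. intros s Is Hst. apply H; [|auto].
  apply (sigma_spec I a b s HI Is).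
Qed.

Lemma rd_bounded_continuous (I : R -> Prop) (a b : R) (f : R -> R) :
  compact_ts I a b -> (forall t, I t -> continuous_within I f t) -> rd_bounded I f.
Proof.
  intros HI Hf. split.
  - destruct (continuous_bounded I a b f HI Hf) as [M HM]. exists M.
    intros t Kt. apply HM. now apply upper_kappa_in.
  - intros t Kt _. apply (continuous_within_subset I); [apply upper_kappa_in|].
    apply Hf. now apply upper_kappa_in.
Qed.

Lemma rd_bounded_comp_sigma (I : R -> Prop) (a b : R) (f : R -> R) :
  compact_ts I a b -> (forall t, I t -> continuous_within I f t) ->
  rd_bounded I (fun t => f (sigma_ts I t)).
Proof.
  intros HI Hf. split.
  - destruct (continuous_bounded I a b f HI Hf) as [M HM]. exists M.
    intros t Kt. apply HM. apply (sigma_spec I a b t HI). now apply upper_kappa_in.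
  - intros t Kt Ht. apply (continuous_within_subset I); [apply upper_kappa_in|].
    apply (continuous_within_comp_sigma I a b); auto; [|apply Hf];
      now apply upper_kappa_in.
Qed.

Lemma rd_bounded_continuous_on (I : R -> Prop) (a b : R) (f : R -> R) :
  compact_ts I a b -> continuous_on (upper_kappa I) f -> rd_bounded I f.
Proof.
  intros HI Hf. split.
  - now apply (continuous_upper_kappa_bounded I a b).
  - intros t Kt _. now apply Hf.
Qed.

(** * Lagrangians on compact sets and along [C^1] functions *)

Lemma jointly_continuous_eps (T : R -> Prop) (g : R -> R -> R -> R) :
  jointly_continuous T g ->
  forall t x v eps, T t -> 0 < eps -> exists d, 0 < d /\
    forall t' x' v', T t' -> Rabs (t' - t) < d -> Rabs (x' - x) < d ->
      Rabs (v' - v) < d -> Rabs (g t' x' v' - g t x v) < eps.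
Proof.
  intros Hg t x v eps Tt He.
  destruct (Hg (t, (x, v)) Tt (fun y => Rabs (y - g t x v) < eps)) as [d Hd].
  - exists (mkposreal eps He). intros y Hy. exact Hy.
  - exists d. split; [apply cond_pos|]. intros t' x' v' Tt' H1 H2 H3.
    apply (Hd (t', (x', v'))); [|exact Tt'].
    split; [exact H1|]. split; [exact H2|exact H3].
Qed.

Lemma jointly_continuous_bounded (T I : R -> Prop) (a b M : R) (g : R -> R -> R -> R) :
  compact_ts I a b -> (forall t, I t -> T t) -> jointly_continuous T g ->
  exists B, forall t x v, I t -> Rabs x <= M -> Rabs v <= M -> Rabs (g t x v) <= B.
Proof.
  intros HI HIT Hg.
  destruct (compact_ts_box I a b M (fun t x v d => forall t' x' v', I t' ->
    Rabs (t' - t) < d -> Rabs (x' - x) < d -> Rabs (v' - v) < d ->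
    Rabs (g t' x' v') <= / d) HI) as [d Hd].
  - intros t x v It.
    destruct (jointly_continuous_eps T g Hg t x v 1 (HIT t It)) as [d [Hd H]]; [lra|].
    set (B := Rabs (g t x v) + 1).
    assert (HB : 0 < / B).
    { apply Rinv_0_lt_compat. unfold B. pose proof (Rabs_pos (g t x v)). lra. }
    exists (mkposreal (Rmin d (/ B)) (Rmin_glb_lt _ _ _ Hd HB)). simpl.
    intros t' x' v' It' H1 H2 H3. pose proof (Rmin_l d (/ B)).
    specialize (H t' x' v' (HIT t' It') ltac:(lra) ltac:(lra) ltac:(lra)).
    apply Rle_trans with B.
    + unfold B. replace (g t' x' v') with (g t x v + (g t' x' v' - g t x v)) by ring.
      eapply Rle_trans; [apply Rabs_triang|lra].
    + apply le_inv_Rmin; [exact Hd|]. unfold B.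
      pose proof (Rabs_pos (g t x v)). lra.
  - exists (/ d). intros t x v It Hx Hv.
    destruct (Hd t x v It Hx Hv) as [t0 [x0 [v0 [d0 [H [H1 [H2 [H3 H4]]]]]]]].
    apply Rle_trans with (/ d0); [now apply H|].
    apply Rinv_le_contravar; [apply cond_pos|exact H4].
Qed.

Lemma jointly_continuous_uniform (T I : R -> Prop) (a b M eps : R) (g : R -> R -> R -> R) :
  compact_ts I a b -> (forall t, I t -> T t) -> jointly_continuous T g -> 0 < eps ->
  exists d, 0 < d /\ forall t x v x' v', I t -> Rabs x <= M -> Rabs v <= M ->
    Rabs (x' - x) < d -> Rabs (v' - v) < d -> Rabs (g t x' v' - g t x v) < eps.
Proof.
  intros HI HIT Hg He.
  (* Radii are doubled so that both [(x, v)] and its perturbation lie in the neighbourhood of one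
     tag. *)
  destruct (compact_ts_box I a b M (fun t x v d => forall t' x' v', I t' ->
    Rabs (t' - t) < 2 * d -> Rabs (x' - x) < 2 * d -> Rabs (v' - v) < 2 * d ->
    Rabs (g t' x' v' - g t x v) < eps / 2) HI) as [d Hd].
  - intros t x v It.
    destruct (jointly_continuous_eps T g Hg t x v (eps / 2) (HIT t It)) as [d [Hd H]];
      [lra|].
    assert (Hd2 : 0 < d / 2) by lra. exists (mkposreal (d / 2) Hd2). simpl.
    intros t' x' v' It' H1 H2 H3. apply H; auto; lra.
  - exists d. split; [apply cond_pos|]. intros t x v x' v' It Hx Hv Hx' Hv'.
    destruct (Hd t x v It Hx Hv) as [t0 [x0 [v0 [d0 [H [H1 [H2 [H3 H4]]]]]]]].
    pose proof (cond_pos d0) as Hd0.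
    apply Rabs_def2 in H1, H2, H3, Hx', Hv'.
    assert (A := H t x v It ltac:(apply Rabs_def1; lra) ltac:(apply Rabs_def1; lra)
      ltac:(apply Rabs_def1; lra)).
    assert (B := H t x' v' It ltac:(apply Rabs_def1; lra) ltac:(apply Rabs_def1; lra)
      ltac:(apply Rabs_def1; lra)).
    apply Rabs_def2 in A, B. apply Rabs_def1; lra.
Qed.

(** The delta half of [C1_diamond], split off because reflection carries the nabla half onto it. *)
Definition C1_delta (I : R -> Prop) (y : R -> R) : Prop :=
  (forall t, upper_kappa I t -> exists l, is_delta_derive I y t l) /\
  continuous_on (upper_kappa I) (delta_derive I y).

Lemma delta_derive_eq (I : R -> Prop) (a b t l : R) (y : R -> R) :
  compact_ts I a b -> upper_kappa I t -> is_delta_derive I y t l ->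
  delta_derive I y t = l.
Proof.
  intros HI Kt Hl. apply (is_delta_derive_unique I a b y t); auto.
  unfold delta_derive. apply epsilon_spec. now exists l.
Qed.

Lemma C1_delta_anti (I : R -> Prop) (y : R -> R) :
  C1_delta I y -> anti_delta I (delta_derive I y) y.
Proof. intros [H _] t Kt. unfold delta_derive. now apply epsilon_spec, H. Qed.

Lemma C1_delta_intro (I : R -> Prop) (a b : R) (f F : R -> R) :
  compact_ts I a b -> anti_delta I f F -> continuous_on (upper_kappa I) f ->
  C1_delta I F.
Proof.
  intros HI HF Hf. split.
  - intros t Kt. exists (f t). now apply HF.
  - intros t Kt. apply (continuous_within_ext _ f); auto.
    + intros s Ks. symmetry. apply (delta_derive_eq I a b); auto.
    + now apply Hf.
Qed.

Lemma C1_delta_continuous (I : R -> Prop) (a b t : R) (y : R -> R) :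
  compact_ts I a b -> C1_delta I y -> I t -> continuous_within I y t.
Proof.
  intros HI Hy It. apply (anti_delta_continuous I a b t (delta_derive I y)); auto.
  now apply C1_delta_anti.
Qed.

Lemma C1_delta_lin (I : R -> Prop) (a b u v : R) (y z : R -> R) :
  compact_ts I a b -> C1_delta I y -> C1_delta I z ->
  C1_delta I (fun s => u * y s + v * z s).
Proof.
  intros HI Hy Hz.
  apply (C1_delta_intro I a b (fun s => u * delta_derive I y s + v * delta_derive I z s));
    auto.
  - apply anti_delta_lin; now apply C1_delta_anti.
  - intros t Kt. apply continuous_within_lin; [now apply Hy|now apply Hz].
Qed.

Lemma delta_derive_lin (I : R -> Prop) (a b u v t : R) (y z : R -> R) :
  compact_ts I a b -> C1_delta I y -> C1_delta I z -> upper_kappa I t ->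
  delta_derive I (fun s => u * y s + v * z s) t =
  u * delta_derive I y t + v * delta_derive I z t.
Proof.
  intros HI Hy Hz Kt. apply (delta_derive_eq I a b); auto.
  apply is_delta_derive_lin; now apply C1_delta_anti.
Qed.

(** At a right-dense point [sigma_ts] is continuous, hence so is [y] composed with it. At a
    left-dense right-scattered point only boundedness survives. *)
Lemma along_delta_rd (T I : R -> Prop) (a b : R) (g : R -> R -> R -> R) (y : R -> R) :
  compact_ts I a b -> (forall t, I t -> T t) -> jointly_continuous T g ->
  C1_delta I y -> rd_bounded I (along_delta I g y).
Proof.
  intros HI HIT Hg Hy.
  assert (Hyc : forall t, I t -> continuous_within I y t)
    by (intros; now apply (C1_delta_continuous I a b)).
  pose proof (rd_bounded_comp_sigma I a b y HI Hyc) as [[M1 HM1] H1].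
  pose proof (rd_bounded_continuous_on I a b _ HI (proj2 Hy)) as [[M2 HM2] H2].
  split.
  - destruct (jointly_continuous_bounded T I a b (Rmax M1 M2) g HI HIT Hg) as [B HB].
    exists B. intros t Kt. apply HB; [now apply upper_kappa_in| |].
    + eapply Rle_trans; [now apply HM1|apply Rmax_l].
    + eapply Rle_trans; [now apply HM2|apply Rmax_r].
  - intros t Kt Ht. specialize (H1 t Kt Ht). specialize (H2 t Kt Ht).
    rewrite continuous_within_eps in *. intros eps He.
    destruct (jointly_continuous_eps T g Hg t (y (sigma_ts I t)) (delta_derive I y t) eps)
      as [d [Hd H]]; [apply HIT; now apply upper_kappa_in|exact He|].
    destruct (H1 d Hd) as [d1 [Hd1 H1']]. destruct (H2 d Hd) as [d2 [Hd2 H2']].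
    exists (Rmin d (Rmin d1 d2)). split; [repeat apply Rmin_glb_lt; lra|].
    intros s Ks Hs.
    pose proof (Rmin_l d (Rmin d1 d2)). pose proof (Rmin_r d (Rmin d1 d2)).
    pose proof (Rmin_l d1 d2). pose proof (Rmin_r d1 d2).
    apply H.
    + apply HIT. now apply upper_kappa_in.
    + lra.
    + apply H1'; auto; lra.
    + apply H2'; auto; lra.
Qed.

(** * The first variation *)

Lemma Derive_increment (f : R -> R) (x h c eps : R) :
  (forall u, ex_derive f u) ->
  (forall u, Rabs (u - x) <= Rabs h -> Rabs (Derive f u - c) <= eps) ->
  Rabs (f (x + h) - f x - c * h) <= eps * Rabs h.
Proof.
  intros Hf Hc.
  destruct (MVT_gen f x (x + h) (Derive f)) as [u [Hu Heq]].
  - intros u _. apply Derive_correct, Hf.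
  - intros u _. apply continuity_pt_filterlim.
    apply (@ex_derive_continuous R_AbsRing R_NormedModule), Hf.
  - rewrite Heq. replace (Derive f u * (x + h - x) - c * h) with ((Derive f u - c) * h)
      by ring.
    rewrite Rabs_mult. apply Rmult_le_compat_r; [apply Rabs_pos|]. apply Hc.
    unfold Rmin, Rmax in Hu. destruct (Rle_dec x (x + h)).
    + rewrite !Rabs_pos_eq; lra.
    + rewrite !Rabs_left1; lra.
Qed.

(** The arguments are moved one at a time, the value first with the slope already at [v + k]; two
    mean value estimates then rest on uniform continuity of the partial derivatives over a compact
    box. *)
Lemma lagrangian_expansion (T I : R -> Prop) (a b M eps : R) (L : R -> R -> R -> R) :
  compact_ts I a b -> (forall t, I t -> T t) -> smooth_lagrangian T L -> 0 < eps ->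
  exists d, 0 < d /\ forall t x v h k r, I t -> Rabs x <= M -> Rabs v <= M ->
    Rabs h <= r -> Rabs k <= r -> r < d ->
    Rabs (L t (x + h) (v + k) - L t x v - (partial2 L t x v * h + partial3 L t x v * k))
      <= eps * r.
Proof.
  intros HI HIT [D2 [D3 [_ [C2 C3]]]] He.
  destruct (jointly_continuous_uniform T I a b M (eps / 2) _ HI HIT C2) as [d2 [Hd2 H2]];
    [lra|].
  destruct (jointly_continuous_uniform T I a b M (eps / 2) _ HI HIT C3) as [d3 [Hd3 H3]];
    [lra|].
  exists (Rmin d2 d3). split; [now apply Rmin_glb_lt|].
  intros t x v h k r It Hx Hv Hh Hk Hr.
  pose proof (Rmin_l d2 d3). pose proof (Rmin_r d2 d3).
  assert (E2 : Rabs (L t (x + h) (v + k) - L t x (v + k) - partial2 L t x v * h)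
                 <= eps / 2 * Rabs h).
  { apply (Derive_increment (fun x' => L t x' (v + k))).
    - intros u. now apply D2, HIT.
    - intros u Hu. left. apply (H2 t x v u (v + k)); auto; [lra|].
      replace (v + k - v) with k by ring. lra. }
  assert (E3 : Rabs (L t x (v + k) - L t x v - partial3 L t x v * k)
                 <= eps / 2 * Rabs k).
  { apply (Derive_increment (fun v' => L t x v')).
    - intros u. now apply D3, HIT.
    - intros u Hu. left. apply (H3 t x v x u); auto; [|lra].
      rewrite Rminus_diag, Rabs_R0. lra. }
  replace (_ - _ - _) with
    ((L t (x + h) (v + k) - L t x (v + k) - partial2 L t x v * h) +
     (L t x (v + k) - L t x v - partial3 L t x v * k)) by ring.
  eapply Rle_trans; [apply Rabs_triang|].
  assert (eps / 2 * Rabs h <= eps / 2 * r) by (apply Rmult_le_compat_l; lra).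
  assert (eps / 2 * Rabs k <= eps / 2 * r) by (apply Rmult_le_compat_l; lra).
  lra.
Qed.

Definition delta_variation (I : R -> Prop) (a b : R) (L : R -> R -> R -> R)
  (y z : R -> R) : R :=
  delta_int I (fun t => along_delta I (partial2 L) y t * z (sigma_ts I t)
                      + along_delta I (partial3 L) y t * delta_derive I z t) a b.

Definition delta_small (I : R -> Prop) (z : R -> R) (r : R) : Prop :=
  (forall t, I t -> Rabs (z t) <= r) /\
  (forall t, upper_kappa I t -> Rabs (delta_derive I z t) <= r).

Lemma delta_variation_rd (T I : R -> Prop) (a b : R) (L : R -> R -> R -> R) (y z : R -> R) :
  compact_ts I a b -> (forall t, I t -> T t) -> smooth_lagrangian T L ->
  C1_delta I y -> C1_delta I z ->
  rd_bounded I (fun t => along_delta I (partial2 L) y t * z (sigma_ts I t)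
                       + along_delta I (partial3 L) y t * delta_derive I z t).
Proof.
  intros HI HIT [_ [_ [_ [C2 C3]]]] Hy Hz.
  assert (H2 : rd_bounded I (fun t => along_delta I (partial2 L) y t * z (sigma_ts I t))).
  { apply rd_bounded_mult; [now apply (along_delta_rd T I a b)|].
    apply (rd_bounded_comp_sigma I a b); auto.
    intros t It. now apply (C1_delta_continuous I a b). }
  assert (H3 : rd_bounded I (fun t => along_delta I (partial3 L) y t * delta_derive I z t)).
  { apply rd_bounded_mult; [now apply (along_delta_rd T I a b)|].
    apply (rd_bounded_continuous_on I a b); auto. apply Hz. }
  pose proof (rd_bounded_lin I _ _ 1 1 H2 H3) as H.
  replace (fun t => _) with (fun t => 1 * (along_delta I (partial2 L) y t * z (sigma_ts I t))
     + 1 * (along_delta I (partial3 L) y t * delta_derive I z t)); [exact H|].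
  apply functional_extensionality. intros t. ring.
Qed.

(** The pointwise expansion is uniform in [t], so it can be integrated; dividing [eps] by [b - a]
    compensates the length of the interval. *)
Lemma delta_functional_frechet (T I : R -> Prop) (a b eps : R) (L : R -> R -> R -> R)
  (y : R -> R) :
  compact_ts I a b -> (forall t, I t -> T t) -> smooth_lagrangian T L ->
  C1_delta I y -> 0 < eps ->
  exists d, 0 < d /\ forall z r, C1_delta I z -> delta_small I z r -> r < d ->
    Rabs (delta_functional I a b L (fun s => y s + z s) - delta_functional I a b L y
          - delta_variation I a b L y z) <= eps * r.
Proof.
  intros HI HIT HL Hy He.
  pose proof (cts_l _ _ _ HI) as Ia. pose proof (cts_r _ _ _ HI) as Ib.
  pose proof (cts_lt _ _ _ HI) as Hab.
  assert (Hyc : forall t, I t -> continuous_within I y t)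
    by (intros; now apply (C1_delta_continuous I a b)).
  destruct (continuous_bounded I a b y HI Hyc) as [M1 HM1].
  destruct (continuous_upper_kappa_bounded I a b _ HI (proj2 Hy)) as [M2 HM2].
  set (e := eps / (b - a)).
  assert (He0 : 0 < e) by (apply Rdiv_lt_0_compat; lra).
  destruct (lagrangian_expansion T I a b (Rmax M1 M2) e L HI HIT HL He0) as [d [Hd H]].
  exists d. split; [exact Hd|]. intros z r Hz [Hz1 Hz2] Hr.
  assert (Hyz : C1_delta I (fun s => y s + z s)).
  { pose proof (C1_delta_lin I a b 1 1 y z HI Hy Hz) as H'.
    replace (fun s => y s + z s) with (fun s => 1 * y s + 1 * z s); [exact H'|].
    apply functional_extensionality. intros s. ring. }
  assert (Dyz : forall t, upper_kappa I t ->
    delta_derive I (fun s => y s + z s) t = delta_derive I y t + delta_derive I z t).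
  { intros t Kt. pose proof (delta_derive_lin I a b 1 1 t y z HI Hy Hz Kt) as H'.
    rewrite !Rmult_1_l in H'. rewrite <- H'. f_equal.
    apply functional_extensionality. intros s. ring. }
  assert (HLc : jointly_continuous T L) by apply HL.
  destruct (anti_delta_exists I a b _ HI (along_delta_rd T I a b L y HI HIT HLc Hy))
    as [F0 HF0].
  destruct (anti_delta_exists I a b _ HI (along_delta_rd T I a b L _ HI HIT HLc Hyz))
    as [F1 HF1].
  destruct (anti_delta_exists I a b _ HI (delta_variation_rd T I a b L y z HI HIT HL Hy Hz))
    as [G HG].
  unfold delta_functional, delta_variation.
  rewrite (delta_int_eq I a b a b _ _ HI HF0), (delta_int_eq I a b a b _ _ HI HF1),
    (delta_int_eq I a b a b _ _ HI HG) by assumption.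
  pose proof (anti_delta_lin I _ _ _ _ 1 (-1)
    (anti_delta_lin I _ _ _ _ 1 (-1) HF1 HF0) HG) as HH.
  pose proof (delta_increment_abs_le I a b a b (e * r) _ _ HI HH
    (cts_l _ _ _ HI) (cts_r _ _ _ HI) ltac:(lra)) as Hinc.
  replace (eps * r) with (e * r * (b - a)) by (unfold e; field; lra).
  replace (_ - _ - _) with
    (1 * (1 * F1 b + -1 * F0 b) + -1 * G b - (1 * (1 * F1 a + -1 * F0 a) + -1 * G a))
    by ring.
  apply Hinc. intros t It Ht.
  assert (Kt : upper_kappa I t) by (apply (upper_kappa_lt I a b); auto; lra).
  destruct (sigma_spec I a b t HI It) as [Is _].
  unfold along_delta. rewrite (Dyz t Kt).
  replace (_ + _) with
    (L t (y (sigma_ts I t) + z (sigma_ts I t)) (delta_derive I y t + delta_derive I z t)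
     - L t (y (sigma_ts I t)) (delta_derive I y t)
     - (partial2 L t (y (sigma_ts I t)) (delta_derive I y t) * z (sigma_ts I t)
        + partial3 L t (y (sigma_ts I t)) (delta_derive I y t) * delta_derive I z t)) by ring.
  apply H; auto.
  - eapply Rle_trans; [now apply HM1|apply Rmax_l].
  - eapply Rle_trans; [now apply HM2|apply Rmax_r].
Qed.

(** In a product of two functionals the first-order terms get multiplied; this bound makes that
    product quadratic in [r]. *)
Lemma delta_variation_bound (T I : R -> Prop) (a b : R) (L : R -> R -> R -> R)
  (y : R -> R) :
  compact_ts I a b -> (forall t, I t -> T t) -> smooth_lagrangian T L -> C1_delta I y ->
  exists C, 0 <= C /\ forall z r, C1_delta I z -> delta_small I z r ->
    Rabs (delta_variation I a b L y z) <= C * r.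
Proof.
  intros HI HIT HL Hy.
  pose proof (cts_l _ _ _ HI) as Ia. pose proof (cts_r _ _ _ HI) as Ib.
  pose proof (cts_lt _ _ _ HI) as Hab.
  destruct (along_delta_rd T I a b (partial2 L) y HI HIT ltac:(apply HL) Hy)
    as [[M2 HM2] _].
  destruct (along_delta_rd T I a b (partial3 L) y HI HIT ltac:(apply HL) Hy)
    as [[M3 HM3] _].
  assert (Ka : upper_kappa I a) by (apply (upper_kappa_lt I a b); auto; lra).
  pose proof (Rle_trans _ _ _ (Rabs_pos _) (HM2 a Ka)).
  pose proof (Rle_trans _ _ _ (Rabs_pos _) (HM3 a Ka)).
  exists ((M2 + M3) * (b - a)). split; [apply Rmult_le_pos; lra|].
  intros z r Hz [Hz1 Hz2].
  destruct (anti_delta_exists I a b _ HI (delta_variation_rd T I a b L y z HI HIT HL Hy Hz))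
    as [G HG].
  unfold delta_variation. rewrite (delta_int_eq I a b a b _ _ HI HG) by assumption.
  replace ((M2 + M3) * (b - a) * r) with ((M2 * r + M3 * r) * (b - a)) by ring.
  apply (delta_increment_abs_le I a b a b _ _ _ HI HG); try assumption; [lra|].
  intros t It Ht.
  assert (Kt : upper_kappa I t) by (apply (upper_kappa_lt I a b); auto; lra).
  eapply Rle_trans; [apply Rabs_triang|]. rewrite !Rabs_mult.
  apply Rplus_le_compat; apply Rmult_le_compat; auto using Rabs_pos.
  apply Hz1. apply (sigma_spec I a b t HI It).
Qed.

Lemma delta_variation_lin (T I : R -> Prop) (a b u v : R) (L : R -> R -> R -> R)
  (y z w : R -> R) :
  compact_ts I a b -> (forall t, I t -> T t) -> smooth_lagrangian T L ->
  C1_delta I y -> C1_delta I z -> C1_delta I w ->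
  delta_variation I a b L y (fun s => u * z s + v * w s) =
  u * delta_variation I a b L y z + v * delta_variation I a b L y w.
Proof.
  intros HI HIT HL Hy Hz Hw.
  pose proof (cts_l _ _ _ HI) as Ia. pose proof (cts_r _ _ _ HI) as Ib.
  destruct (anti_delta_exists I a b _ HI (delta_variation_rd T I a b L y z HI HIT HL Hy Hz))
    as [G HG].
  destruct (anti_delta_exists I a b _ HI (delta_variation_rd T I a b L y w HI HIT HL Hy Hw))
    as [H HH].
  unfold delta_variation.
  rewrite (delta_int_eq I a b a b _ _ HI HG), (delta_int_eq I a b a b _ _ HI HH)
    by assumption.
  rewrite (delta_int_eq I a b a b _ (fun s => u * G s + v * H s) HI); try assumption; [ring|].
  pose proof (anti_delta_lin I _ _ _ _ u v HG HH) as HGH.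
  apply (fun E => anti_delta_ext I _ _ _ E HGH). intros t Kt.
  rewrite (delta_derive_lin I a b) by auto. ring.
Qed.

(** Integration by parts: if [P] is an antiderivative of [d_2 L[y]], then
    [S + P z] is one of the integrand of the first variation. *)
Lemma delta_variation_by_parts (I : R -> Prop) (a b : R) (L : R -> R -> R -> R)
  (y z P S : R -> R) :
  compact_ts I a b -> C1_delta I z -> z a = 0 -> z b = 0 ->
  anti_delta I (along_delta I (partial2 L) y) P ->
  anti_delta I (fun t => (along_delta I (partial3 L) y t - P t) * delta_derive I z t) S ->
  delta_variation I a b L y z = S b - S a.
Proof.
  intros HI Hz Hza Hzb HP HS.
  pose proof (cts_l _ _ _ HI) as Ia. pose proof (cts_r _ _ _ HI) as Ib.
  unfold delta_variation.
  rewrite (delta_int_eq I a b a b _ (fun s => 1 * S s + 1 * (P s * z s)) HI);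
    try assumption.
  - rewrite Hza, Hzb. ring.
  - intros t Kt. pose proof (upper_kappa_in _ _ Kt) as It.
    replace (_ + _) with
      (1 * ((along_delta I (partial3 L) y t - P t) * delta_derive I z t) +
       1 * (along_delta I (partial2 L) y t * z (sigma_ts I t) + P t * delta_derive I z t))
      by ring.
    apply is_delta_derive_lin; [now apply HS|].
    apply is_delta_derive_mult; [exact It|now apply HP|].
    now apply C1_delta_anti.
Qed.

(** * The first variation on the nabla side *)

Definition reflect_fun (y : R -> R) (s : R) : R := - y (- s).

(** Paired with [reflect_fun]: time and value change sign, while the two signs cancel in the
    slope. *)
Definition reflect_lagrangian (L : R -> R -> R -> R) (t x v : R) : R := L (- t) (- x) v.

Lemma nabla_derive_reflect (I : R -> Prop) (y : R -> R) (t : R) :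
  nabla_derive I y t = delta_derive (reflect I) (reflect_fun y) (- t).
Proof.
  unfold nabla_derive, delta_derive. f_equal.
  apply functional_extensionality. intros l. apply propositional_extensionality.
  apply is_nabla_derive_reflect.
Qed.

Lemma nabla_int_reflect (I : R -> Prop) (f : R -> R) (r s : R) :
  nabla_int I f r s = delta_int (reflect I) (fun t => f (- t)) (- s) (- r).
Proof.
  unfold nabla_int, delta_int. f_equal.
  apply functional_extensionality. intros v. apply propositional_extensionality.
  split; intros [F [HF ->]]; exists (reflect_fun F); unfold reflect_fun.
  - split; [now apply anti_nabla_reflect|]. rewrite !Ropp_involutive. ring.
  - split; [|ring]. apply anti_nabla_reflect.
    replace (fun s => - - F (- - s)) with F; [exact HF|].
    apply functional_extensionality. intros u. now rewrite !Ropp_involutive.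
Qed.

Lemma along_nabla_reflect (I : R -> Prop) (g : R -> R -> R -> R) (y : R -> R) (t : R) :
  along_nabla I g y t =
  along_delta (reflect I) (reflect_lagrangian g) (reflect_fun y) (- t).
Proof.
  unfold along_nabla, along_delta, reflect_lagrangian.
  rewrite nabla_derive_reflect, rho_reflect.
  set (v := delta_derive _ _ _). unfold reflect_fun. now rewrite !Ropp_involutive.
Qed.

Lemma nabla_functional_reflect (I : R -> Prop) (a b : R) (L : R -> R -> R -> R)
  (y : R -> R) :
  nabla_functional I a b L y =
  delta_functional (reflect I) (- b) (- a) (reflect_lagrangian L) (reflect_fun y).
Proof.
  unfold nabla_functional, delta_functional. rewrite nabla_int_reflect. f_equal.
  apply functional_extensionality. intros t.
  now rewrite along_nabla_reflect, Ropp_involutive.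
Qed.

Lemma jointly_continuous_reflect (T : R -> Prop) (g : R -> R -> R -> R) :
  jointly_continuous T g -> jointly_continuous (reflect T) (reflect_lagrangian g).
Proof.
  intros Hg [t [x v]] Tt P [e He].
  destruct (jointly_continuous_eps T g Hg (- t) (- x) v e Tt (cond_pos e)) as [d [Hd H]].
  exists (mkposreal d Hd). intros [t' [x' v']] [H1 [H2 H3]] Tt'. apply He.
  assert (E : forall p q, Rabs (- p - - q) = Rabs (p - q)).
  { intros p q. rewrite <- Rabs_Ropp. f_equal. ring. }
  apply H; [exact Tt'| | |exact H3]; rewrite E; assumption.
Qed.

Lemma partial2_reflect (T : R -> Prop) (L : R -> R -> R -> R) (t x v : R) :
  smooth_lagrangian T L -> reflect T t ->
  partial2 (reflect_lagrangian L) t x v = - partial2 L (- t) (- x) v.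
Proof.
  intros HL Tt. unfold partial2, reflect_lagrangian.
  rewrite (Derive_comp (fun x' => L (- t) x' v) Ropp).
  - replace (Derive Ropp x) with (- 1); [ring|].
    symmetry. apply is_derive_unique. auto_derive; [trivial|ring].
  - now apply HL.
  - auto_derive. trivial.
Qed.

Lemma smooth_lagrangian_reflect (T : R -> Prop) (L : R -> R -> R -> R) :
  smooth_lagrangian T L -> smooth_lagrangian (reflect T) (reflect_lagrangian L).
Proof.
  intros HL. pose proof HL as [D2 [D3 [C1 [C2 C3]]]]. repeat split.
  - intros t x v Tt. unfold reflect_lagrangian.
    apply (ex_derive_comp (fun x' => L (- t) x' v) Ropp); [now apply D2|].
    auto_derive. trivial.
  - intros t x v Tt. unfold reflect_lagrangian. now apply D3.
  - now apply jointly_continuous_reflect.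
  - intros p Tp.
    pose proof (jointly_continuous_reflect T _ C2 p Tp) as H.
    rewrite (partial2_reflect T) by assumption.
    apply (filterlim_within_ext _ (fun p : R * (R * R) =>
      opp (reflect_lagrangian (partial2 L) (fst p) (fst (snd p)) (snd (snd p))))).
    + intros q Tq. now rewrite (partial2_reflect T).
    + apply (filterlim_comp _ _ _ _ _ _ _ _ H).
      apply (filterlim_opp (reflect_lagrangian (partial2 L) (fst p) (fst (snd p)) (snd (snd p)))).
  - exact (jointly_continuous_reflect T _ C3).
Qed.

Definition C1_nabla (I : R -> Prop) (y : R -> R) : Prop :=
  (forall t, lower_kappa I t -> exists l, is_nabla_derive I y t l) /\
  continuous_on (lower_kappa I) (nabla_derive I y).

Lemma C1_diamond_iff (I : R -> Prop) (y : R -> R) :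
  C1_diamond I y <-> C1_delta I y /\ C1_nabla I y.
Proof. unfold C1_diamond, C1_delta, C1_nabla. tauto. Qed.

Lemma C1_nabla_reflect (I : R -> Prop) (y : R -> R) :
  C1_nabla I y <-> C1_delta (reflect I) (reflect_fun y).
Proof.
  assert (E : nabla_derive I y = fun t => delta_derive (reflect I) (reflect_fun y) (- t)).
  { apply functional_extensionality. intros t. apply nabla_derive_reflect. }
  pose proof (continuous_within_reflect (lower_kappa I) (upper_kappa (reflect I))
    (delta_derive (reflect I) (reflect_fun y))) as HC.
  assert (HK : forall s, lower_kappa I s <-> upper_kappa (reflect I) (- s)).
  { intros s. now rewrite upper_kappa_reflect, Ropp_involutive. }
  unfold C1_nabla, C1_delta. rewrite E. split; intros [H1 H2]; split; intros t Kt.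
  - destruct (H1 (- t)) as [l Hl]; [now apply (proj1 (upper_kappa_reflect I t))|].
    exists l. apply is_nabla_derive_reflect in Hl. now rewrite Ropp_involutive in Hl.
  - rewrite <- (Ropp_involutive t). apply HC; [exact HK|].
    apply H2. now apply (proj1 (upper_kappa_reflect I t)).
  - destruct (H1 (- t)) as [l Hl]; [now apply HK|].
    exists l. now apply is_nabla_derive_reflect.
  - apply HC; [exact HK|]. apply H2. now apply HK.
Qed.

Lemma C1_nabla_anti (I : R -> Prop) (y : R -> R) :
  C1_nabla I y -> anti_nabla I (nabla_derive I y) y.
Proof. intros [H _] t Kt. unfold nabla_derive. now apply epsilon_spec, H. Qed.

Lemma nabla_derive_eq (I : R -> Prop) (a b t l : R) (y : R -> R) :
  compact_ts I a b -> lower_kappa I t -> is_nabla_derive I y t l ->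
  nabla_derive I y t = l.
Proof.
  intros HI Kt Hl. apply (is_nabla_derive_unique I a b y t); auto.
  unfold nabla_derive. apply epsilon_spec. now exists l.
Qed.

Lemma C1_nabla_intro (I : R -> Prop) (a b : R) (f F : R -> R) :
  compact_ts I a b -> anti_nabla I f F -> continuous_on (lower_kappa I) f ->
  C1_nabla I F.
Proof.
  intros HI HF Hf. split.
  - intros t Kt. exists (f t). now apply HF.
  - intros t Kt. apply (continuous_within_ext _ f); auto.
    + intros s Ks. symmetry. apply (nabla_derive_eq I a b); auto.
    + now apply Hf.
Qed.

Lemma reflect_fun_lin (u v : R) (y z : R -> R) :
  reflect_fun (fun s => u * y s + v * z s) =
  fun s => u * reflect_fun y s + v * reflect_fun z s.
Proof. apply functional_extensionality. intros s. unfold reflect_fun. ring. Qed.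

Lemma C1_diamond_lin (I : R -> Prop) (a b u v : R) (y z : R -> R) :
  compact_ts I a b -> C1_diamond I y -> C1_diamond I z ->
  C1_diamond I (fun s => u * y s + v * z s).
Proof.
  rewrite !C1_diamond_iff, !C1_nabla_reflect, reflect_fun_lin. intros HI [H1 H2] [H3 H4].
  split; [now apply (C1_delta_lin I a b)|].
  apply (C1_delta_lin _ (- b) (- a)); auto. now apply compact_ts_reflect.
Qed.

Lemma C1_diamond_plus (I : R -> Prop) (a b : R) (y z : R -> R) :
  compact_ts I a b -> C1_diamond I y -> C1_diamond I z ->
  C1_diamond I (fun s => y s + z s).
Proof.
  intros HI Hy Hz. pose proof (C1_diamond_lin I a b 1 1 y z HI Hy Hz) as H.
  replace (fun s => y s + z s) with (fun s => 1 * y s + 1 * z s); [exact H|].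
  apply functional_extensionality. intros s. ring.
Qed.

Definition nabla_variation (I : R -> Prop) (a b : R) (L : R -> R -> R -> R)
  (y z : R -> R) : R :=
  nabla_int I (fun t => along_nabla I (partial2 L) y t * z (rho_ts I t)
                      + along_nabla I (partial3 L) y t * nabla_derive I z t) a b.

Lemma delta_int_ext (I : R -> Prop) (f g : R -> R) (r s : R) :
  (forall t, upper_kappa I t -> f t = g t) -> delta_int I f r s = delta_int I g r s.
Proof.
  intros H. unfold delta_int. f_equal.
  apply functional_extensionality. intros v. apply propositional_extensionality.
  split; intros [F [HF ->]]; exists F; (split; [|reflexivity]).
  - now apply (anti_delta_ext I f).
  - apply (anti_delta_ext I g); auto. intros t Kt. symmetry. auto.
Qed.

(** The sign that [partial2] acquires cancels the one carried by [reflect_fun z]; [partial3] and the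
    derivatives acquire none. *)
Lemma nabla_variation_reflect (T I : R -> Prop) (a b : R) (L : R -> R -> R -> R)
  (y z : R -> R) :
  (forall t, I t -> T t) -> smooth_lagrangian T L ->
  nabla_variation I a b L y z =
  delta_variation (reflect I) (- b) (- a) (reflect_lagrangian L)
    (reflect_fun y) (reflect_fun z).
Proof.
  intros HIT HL. unfold nabla_variation, delta_variation. rewrite nabla_int_reflect.
  apply delta_int_ext. intros t Kt. pose proof (upper_kappa_in _ _ Kt) as It.
  rewrite !along_nabla_reflect, nabla_derive_reflect, rho_reflect, !Ropp_involutive.
  unfold along_delta. rewrite (partial2_reflect T); [|exact HL|now apply HIT].
  change (partial3 (reflect_lagrangian L)) with (reflect_lagrangian (partial3 L)).
  set (v := delta_derive _ (reflect_fun y) t). set (w := delta_derive _ (reflect_fun z) t).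
  unfold reflect_lagrangian, reflect_fun. ring.
Qed.

Definition nabla_small (I : R -> Prop) (z : R -> R) (r : R) : Prop :=
  (forall t, I t -> Rabs (z t) <= r) /\
  (forall t, lower_kappa I t -> Rabs (nabla_derive I z t) <= r).

Lemma nabla_small_reflect (I : R -> Prop) (z : R -> R) (r : R) :
  nabla_small I z r -> delta_small (reflect I) (reflect_fun z) r.
Proof.
  intros [H1 H2]. split.
  - intros t It. unfold reflect_fun. rewrite Rabs_Ropp. now apply H1.
  - intros t Kt. rewrite <- (Ropp_involutive t), <- nabla_derive_reflect.
    apply H2. now apply (proj1 (upper_kappa_reflect I t)).
Qed.

Lemma nabla_functional_frechet (T I : R -> Prop) (a b eps : R) (L : R -> R -> R -> R)
  (y : R -> R) :
  compact_ts I a b -> (forall t, I t -> T t) -> smooth_lagrangian T L ->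
  C1_nabla I y -> 0 < eps ->
  exists d, 0 < d /\ forall z r, C1_nabla I z -> nabla_small I z r -> r < d ->
    Rabs (nabla_functional I a b L (fun s => y s + z s) - nabla_functional I a b L y
          - nabla_variation I a b L y z) <= eps * r.
Proof.
  intros HI HIT HL Hy He.
  destruct (delta_functional_frechet (reflect T) (reflect I) (- b) (- a) eps
    (reflect_lagrangian L) (reflect_fun y)) as [d [Hd H]].
  - now apply compact_ts_reflect.
  - intros t. apply HIT.
  - now apply smooth_lagrangian_reflect.
  - now apply C1_nabla_reflect.
  - exact He.
  - exists d. split; [exact Hd|]. intros z r Hz Hzr Hr.
    rewrite !nabla_functional_reflect, (nabla_variation_reflect T) by assumption.
    replace (reflect_fun (fun s => y s + z s))
      with (fun s => reflect_fun y s + reflect_fun z s).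
    + apply H; [now apply C1_nabla_reflect|now apply nabla_small_reflect|exact Hr].
    + apply functional_extensionality. intros s. unfold reflect_fun. ring.
Qed.

Lemma nabla_variation_bound (T I : R -> Prop) (a b : R) (L : R -> R -> R -> R)
  (y : R -> R) :
  compact_ts I a b -> (forall t, I t -> T t) -> smooth_lagrangian T L -> C1_nabla I y ->
  exists C, 0 <= C /\ forall z r, C1_nabla I z -> nabla_small I z r ->
    Rabs (nabla_variation I a b L y z) <= C * r.
Proof.
  intros HI HIT HL Hy.
  destruct (delta_variation_bound (reflect T) (reflect I) (- b) (- a)
    (reflect_lagrangian L) (reflect_fun y)) as [C [HC H]].
  - now apply compact_ts_reflect.
  - intros t. apply HIT.
  - now apply smooth_lagrangian_reflect.
  - now apply C1_nabla_reflect.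
  - exists C. split; [exact HC|]. intros z r Hz Hzr.
    rewrite (nabla_variation_reflect T) by assumption.
    apply H; [now apply C1_nabla_reflect|now apply nabla_small_reflect].
Qed.

Lemma nabla_variation_lin (T I : R -> Prop) (a b u v : R) (L : R -> R -> R -> R)
  (y z w : R -> R) :
  compact_ts I a b -> (forall t, I t -> T t) -> smooth_lagrangian T L ->
  C1_nabla I y -> C1_nabla I z -> C1_nabla I w ->
  nabla_variation I a b L y (fun s => u * z s + v * w s) =
  u * nabla_variation I a b L y z + v * nabla_variation I a b L y w.
Proof.
  rewrite !C1_nabla_reflect. intros HI HIT HL Hy Hz Hw.
  rewrite !(nabla_variation_reflect T) by assumption. rewrite reflect_fun_lin.
  apply (delta_variation_lin (reflect T)); auto.
  - now apply compact_ts_reflect.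
  - intros t. apply HIT.
  - now apply smooth_lagrangian_reflect.
Qed.

Lemma nabla_variation_by_parts (I : R -> Prop) (a b : R) (L : R -> R -> R -> R)
  (y z Q S : R -> R) :
  compact_ts I a b -> C1_nabla I z -> z a = 0 -> z b = 0 ->
  anti_nabla I (along_nabla I (partial2 L) y) Q ->
  anti_nabla I (fun t => (along_nabla I (partial3 L) y t - Q t) * nabla_derive I z t) S ->
  nabla_variation I a b L y z = S b - S a.
Proof.
  intros HI Hz Hza Hzb HQ HS.
  pose proof (cts_l _ _ _ HI) as Ia. pose proof (cts_r _ _ _ HI) as Ib.
  unfold nabla_variation.
  rewrite (nabla_int_eq I a b a b _ (fun s => 1 * S s + 1 * (Q s * z s)) HI);
    try assumption.
  - rewrite Hza, Hzb. ring.
  - intros t Kt. pose proof (lower_kappa_in _ _ Kt) as It.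
    replace (_ + _) with
      (1 * ((along_nabla I (partial3 L) y t - Q t) * nabla_derive I z t) +
       1 * (along_nabla I (partial2 L) y t * z (rho_ts I t) + Q t * nabla_derive I z t))
      by ring.
    apply is_nabla_derive_lin; [now apply HS|].
    apply is_nabla_derive_mult; [exact It|now apply HQ|].
    now apply C1_nabla_anti.
Qed.

Lemma along_nabla_ld (T I : R -> Prop) (a b : R) (g : R -> R -> R -> R) (y : R -> R) :
  compact_ts I a b -> (forall t, I t -> T t) -> jointly_continuous T g ->
  C1_nabla I y -> ld_bounded I (along_nabla I g y).
Proof.
  intros HI HIT Hg Hy. apply ld_bounded_reflect.
  pose proof (along_delta_rd (reflect T) (reflect I) (- b) (- a) (reflect_lagrangian g)
    (reflect_fun y) (compact_ts_reflect _ _ _ HI) (fun t => HIT (- t))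
    (jointly_continuous_reflect T g Hg) (proj1 (C1_nabla_reflect I y) Hy)) as H.
  replace (fun s => along_nabla I g y (- s)) with
    (along_delta (reflect I) (reflect_lagrangian g) (reflect_fun y)); [exact H|].
  apply functional_extensionality. intros s.
  now rewrite along_nabla_reflect, Ropp_involutive.
Qed.

(** * Lagrange multipliers *)

Definition product_variation (I : R -> Prop) (a b : R) (LD LN : R -> R -> R -> R)
  (y z : R -> R) : R :=
  nabla_functional I a b LN y * delta_variation I a b LD y z
  + delta_functional I a b LD y * nabla_variation I a b LN y z.

Definition diamond_small (I : R -> Prop) (z : R -> R) (r : R) : Prop :=
  (forall t, I t -> Rabs (z t) <= r) /\
  (forall t, upper_kappa I t -> Rabs (delta_derive I z t) <= r) /\
  (forall t, lower_kappa I t -> Rabs (nabla_derive I z t) <= r).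

Lemma product_variation_lin (T I : R -> Prop) (a b u v : R) (LD LN : R -> R -> R -> R)
  (y z w : R -> R) :
  compact_ts I a b -> (forall t, I t -> T t) ->
  smooth_lagrangian T LD -> smooth_lagrangian T LN ->
  C1_diamond I y -> C1_diamond I z -> C1_diamond I w ->
  product_variation I a b LD LN y (fun s => u * z s + v * w s) =
  u * product_variation I a b LD LN y z + v * product_variation I a b LD LN y w.
Proof.
  rewrite !C1_diamond_iff. intros HI HIT HLD HLN [Hy1 Hy2] [Hz1 Hz2] [Hw1 Hw2].
  unfold product_variation.
  rewrite (delta_variation_lin T), (nabla_variation_lin T) by assumption. ring.
Qed.

Lemma product_functional_frechet (T I : R -> Prop) (a b eps : R)
  (LD LN : R -> R -> R -> R) (y : R -> R) :
  compact_ts I a b -> (forall t, I t -> T t) ->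
  smooth_lagrangian T LD -> smooth_lagrangian T LN ->
  C1_diamond I y -> 0 < eps ->
  exists d, 0 < d /\ forall z r, C1_diamond I z -> diamond_small I z r -> r < d ->
    Rabs (product_functional I a b LD LN (fun s => y s + z s)
          - product_functional I a b LD LN y
          - product_variation I a b LD LN y z) <= eps * r.
Proof.
  intros HI HIT HLD HLN Hy He. apply C1_diamond_iff in Hy. destruct Hy as [Hy1 Hy2].
  set (A := delta_functional I a b LD y). set (B := nabla_functional I a b LN y).
  destruct (delta_variation_bound T I a b LD y HI HIT HLD Hy1) as [C1 [HC1 H1]].
  destruct (nabla_variation_bound T I a b LN y HI HIT HLN Hy2) as [C2 [HC2 H2]].
  pose proof (Rabs_pos A) as PA. pose proof (Rabs_pos B) as PB.
  (* [N] adds up the coefficients of the three terms containing a remainder, the [1] standing for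
     the product of both remainders; with [e * N <= eps / 2] they cost half of [eps]. *)
  set (N := Rabs A + Rabs B + C1 + C2 + 1).
  assert (HN : 0 < N) by (unfold N; lra).
  set (e := Rmin 1 (eps / 2 / N)).
  assert (He0 : 0 < e) by (apply Rmin_glb_lt; [lra|apply Rdiv_lt_0_compat; lra]).
  assert (He1 : e <= 1) by apply Rmin_l.
  assert (HeN : e * N <= eps / 2).
  { apply Rle_trans with (eps / 2 / N * N).
    - apply Rmult_le_compat_r; [lra|apply Rmin_r].
    - right. field. lra. }
  destruct (delta_functional_frechet T I a b e LD y HI HIT HLD Hy1 He0) as [d1 [Hd1 F1]].
  destruct (nabla_functional_frechet T I a b e LN y HI HIT HLN Hy2 He0) as [d2 [Hd2 F2]].
  assert (HC : 0 <= C1 * C2) by nra.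
  (* The other half pays for the product of the two variations, at most [C1 * C2 * r * r]. *)
  set (d3 := eps / 2 / (C1 * C2 + 1)).
  assert (Hd3 : 0 < d3) by (apply Rdiv_lt_0_compat; lra).
  exists (Rmin (Rmin 1 d3) (Rmin d1 d2)). split; [repeat apply Rmin_glb_lt; lra|].
  intros z r Hz [S1 [S2 S3]] Hr. apply C1_diamond_iff in Hz. destruct Hz as [Hz1 Hz2].
  pose proof (Rmin_l (Rmin 1 d3) (Rmin d1 d2)). pose proof (Rmin_r (Rmin 1 d3) (Rmin d1 d2)).
  pose proof (Rmin_l 1 d3). pose proof (Rmin_r 1 d3).
  pose proof (Rmin_l d1 d2). pose proof (Rmin_r d1 d2).
  assert (Sd : delta_small I z r) by now split.
  assert (Sn : nabla_small I z r) by now split.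
  specialize (F1 z r Hz1 Sd ltac:(lra)). specialize (F2 z r Hz2 Sn ltac:(lra)).
  specialize (H1 z r Hz1 Sd). specialize (H2 z r Hz2 Sn).
  fold A in F1. fold B in F2.
  unfold product_functional, product_variation. fold A B.
  set (A' := delta_functional I a b LD (fun s => y s + z s)) in *.
  set (B' := nabla_functional I a b LN (fun s => y s + z s)) in *.
  set (p := delta_variation I a b LD y z) in *.
  set (q := nabla_variation I a b LN y z) in *.
  set (x1 := A' - A - p) in *. set (x2 := B' - B - q) in *.
  assert (Hr0 : 0 <= r).
  { eapply Rle_trans; [apply Rabs_pos|apply S1]. exact (cts_l _ _ _ HI). }
  replace (A' * B' - A * B - (B * p + A * q)) with
    (p * q + (x1 * (B + q) + (x2 * (A + p) + x1 * x2))) by (unfold x1, x2; ring).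
  assert (HB : Rabs (B + q) <= Rabs B + C2).
  { eapply Rle_trans; [apply Rabs_triang|]. nra. }
  assert (HA : Rabs (A + p) <= Rabs A + C1).
  { eapply Rle_trans; [apply Rabs_triang|]. nra. }
  assert (T1 : Rabs (p * q) <= eps / 2 * r).
  { rewrite Rabs_mult. apply Rle_trans with (C1 * r * (C2 * r)).
    - apply Rmult_le_compat; auto using Rabs_pos.
    - replace (C1 * r * (C2 * r)) with (C1 * C2 * r * r) by ring.
      apply Rmult_le_compat_r; [exact Hr0|].
      apply Rle_trans with ((C1 * C2 + 1) * d3).
      + apply Rmult_le_compat; lra.
      + unfold d3. right. field. lra. }
  assert (T2 : Rabs (x1 * (B + q)) <= e * r * (Rabs B + C2)).
  { rewrite Rabs_mult. apply Rmult_le_compat; auto using Rabs_pos. }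
  assert (T3 : Rabs (x2 * (A + p)) <= e * r * (Rabs A + C1)).
  { rewrite Rabs_mult. apply Rmult_le_compat; auto using Rabs_pos. }
  assert (T4 : Rabs (x1 * x2) <= e * r * 1).
  { rewrite Rabs_mult. apply Rmult_le_compat; auto using Rabs_pos.
    apply Rle_trans with (1 := F2). nra. }
  assert (T5 : e * r * (Rabs B + C2) + e * r * (Rabs A + C1) + e * r * 1 <= eps / 2 * r).
  { replace (_ + _) with (e * N * r) by (unfold N; ring).
    now apply Rmult_le_compat_r. }
  eapply Rle_trans; [apply Rabs_triang|].
  eapply Rle_trans; [apply Rplus_le_compat_l, Rabs_triang|].
  eapply Rle_trans; [apply Rplus_le_compat_l, Rplus_le_compat_l, Rabs_triang|]. lra.
Qed.

(** * A multiplier rule in two real parameters *)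

Definition differentiable_at_0 (f : R -> R -> R) (l1 l2 : R) : Prop :=
  forall eps, 0 < eps -> exists d, 0 < d /\ forall u v, Rabs u < d -> Rabs v < d ->
    Rabs (f u v - f 0 0 - (l1 * u + l2 * v)) <= eps * (Rabs u + Rabs v).

(** On the level set of [g], the intermediate value theorem gives points with
    [v = - (g1 / g2) u + o(u)]: differentiability at the origin and continuity
    in [v] suffice, no implicit function is needed. *)
Lemma lagrange_two_parameters (f g : R -> R -> R) (f1 f2 g1 g2 d0 : R) :
  differentiable_at_0 f f1 f2 -> differentiable_at_0 g g1 g2 ->
  (forall u, continuity (g u)) -> g2 <> 0 -> 0 < d0 ->
  (forall u v, Rabs u < d0 -> Rabs v < d0 -> g u v = g 0 0 -> f 0 0 <= f u v) ->
  f1 = f2 * g1 / g2.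
Proof.
  intros Hf Hg Hc Hg2 Hd0 Hmin. apply NNPP. intros Hne.
  (* [m] is the slope of the level set of [g] at the origin and [D] the derivative of [f] along it;
     the claim amounts to [D = 0]. *)
  set (m := - g1 / g2). set (D := f1 + f2 * m).
  assert (HD : D <> 0).
  { unfold D, m. intros HD. apply Hne. apply Rminus_diag_uniq. rewrite <- HD. field.
    exact Hg2. }
  pose proof (Rabs_pos_lt D HD) as PD. pose proof (Rabs_pos f2) as Pf.
  pose proof (Rabs_pos m) as Pm. pose proof (Rabs_pos_lt g2 Hg2) as Pg.
  (* Half-width, relative to [Rabs u], of the window around [m * u]: small enough that the deviation
     of [v] from [m * u] costs [f] at most a quarter of the gain [Rabs D * h]. *)
  set (w := Rmin 1 (Rabs D / 4 / (Rabs f2 + 1))).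
  assert (Hw : 0 < w) by (apply Rmin_glb_lt; [lra|repeat apply Rdiv_lt_0_compat; lra]).
  assert (Hw1 : w <= 1) by apply Rmin_l.
  assert (Hw2 : Rabs f2 * w <= Rabs D / 4).
  { apply Rle_trans with ((Rabs f2 + 1) * (Rabs D / 4 / (Rabs f2 + 1))).
    - apply Rmult_le_compat; try lra. apply Rmin_r.
    - right. field. lra. }
  (* In the window [Rabs u + Rabs v <= h * K]: the first [1] is for [u], and [Rabs m + 1] is for
     [v]. *)
  set (K := 1 + (Rabs m + 1)).
  assert (HK : 0 < K) by (unfold K; lra).
  destruct (Hf (Rabs D / 4 / K)) as [df [Hdf Ef]]; [repeat apply Rdiv_lt_0_compat; lra|].
  destruct (Hg (w * Rabs g2 / 2 / K)) as [dg [Hdg Eg]].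
  { repeat apply Rdiv_lt_0_compat; try lra. apply Rmult_lt_0_compat; lra. }
  set (d := Rmin d0 (Rmin df dg)).
  assert (Hd : 0 < d) by (repeat apply Rmin_glb_lt; lra).
  pose proof (Rmin_l d0 (Rmin df dg)). pose proof (Rmin_r d0 (Rmin df dg)).
  pose proof (Rmin_l df dg). pose proof (Rmin_r df dg).
  fold d in H, H0.
  set (h := d / 2 / K).
  assert (Hh : 0 < h) by (repeat apply Rdiv_lt_0_compat; lra).
  assert (HhK : h * K = d / 2) by (unfold h; field; lra).
  assert (Hhd : h < d) by (unfold K in HhK; nra).
  (* The sign of [u] is the one for which [f] decreases to first order along the level set. *)
  assert (Hu : exists u, Rabs u = h /\ D * u = - (Rabs D * h)).
  { destruct (Rcase_abs D) as [Hneg|Hpos].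
    - exists h. rewrite (Rabs_left D) by lra. rewrite Rabs_pos_eq; lra.
    - exists (- h). rewrite (Rabs_pos_eq D) by lra. rewrite Rabs_Ropp, Rabs_pos_eq; lra. }
  destruct Hu as [u [Hu HDu]].
  assert (Hv : forall v, Rabs (v - m * u) <= w * h -> Rabs u + Rabs v <= h * K /\ Rabs v < d).
  { intros v Hv. replace v with (m * u + (v - m * u)) by ring.
    assert (Rabs (m * u + (v - m * u)) <= (Rabs m + 1) * h).
    { eapply Rle_trans; [apply Rabs_triang|]. rewrite Rabs_mult, Hu. nra. }
    unfold K in *. split; nra. }
  assert (Gv : forall v, Rabs (v - m * u) <= w * h ->
    Rabs (g u v - g 0 0 - g2 * (v - m * u)) <= w * h * Rabs g2 / 2).
  { intros v Hvu. destruct (Hv v Hvu) as [Hv1 Hv2].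
    replace (g2 * (v - m * u)) with (g1 * u + g2 * v) by (unfold m; field; exact Hg2).
    eapply Rle_trans; [apply Eg; lra|].
    apply Rle_trans with (w * Rabs g2 / 2 / K * (h * K)).
    - apply Rmult_le_compat_l; [|exact Hv1].
      left. repeat apply Rdiv_lt_0_compat; try lra. apply Rmult_lt_0_compat; lra.
    - right. field. lra. }
  assert (Hwh : 0 < w * h) by (apply Rmult_lt_0_compat; lra).
  assert (Ep : Rabs (m * u + w * h - m * u) <= w * h).
  { replace (m * u + w * h - m * u) with (w * h) by ring. rewrite Rabs_pos_eq; lra. }
  assert (Em : Rabs (m * u - w * h - m * u) <= w * h).
  { replace (m * u - w * h - m * u) with (- (w * h)) by ring.
    rewrite Rabs_Ropp, Rabs_pos_eq; lra. }
  pose proof (Gv _ Ep) as Gp. pose proof (Gv _ Em) as Gm.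
  replace (m * u + w * h - m * u) with (w * h) in Gp by ring.
  replace (m * u - w * h - m * u) with (- (w * h)) in Gm by ring.
  apply Rabs_le_between in Gp, Gm.
  assert (Hmul : 0 < w * h * Rabs g2) by (apply Rmult_lt_0_compat; lra).
  (* At the two ends of the window [g2 * (v - m * u)] has opposite signs and twice the size of the
     error in [Gv], so [g u] crosses the level [g 0 0] in between. *)
  destruct (IVT_gen (g u) (m * u - w * h) (m * u + w * h) (g 0 0) (Hc u)) as [v [Hv1 Hv2]].
  { destruct (Rcase_abs g2) as [Hn|Hp].
    - rewrite (Rabs_left g2) in * by lra.
      rewrite Rmin_right, Rmax_left; nra.
    - rewrite (Rabs_pos_eq g2) in * by lra.
      rewrite Rmin_left, Rmax_right; nra. }
  rewrite Rmin_left, Rmax_right in Hv1 by lra.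
  assert (Hvu : Rabs (v - m * u) <= w * h) by (apply Rabs_le; lra).
  destruct (Hv v Hvu) as [Hv3 Hv4].
  pose proof (Hmin u v ltac:(lra) ltac:(lra) Hv2) as Hle.
  pose proof (Ef u v ltac:(lra) ltac:(lra)) as E.
  assert (E' : Rabs (f u v - f 0 0 - (f1 * u + f2 * v)) <= Rabs D / 4 * h).
  { eapply Rle_trans; [exact E|]. apply Rle_trans with (Rabs D / 4 / K * (h * K)).
    - apply Rmult_le_compat_l; [|exact Hv3]. left. repeat apply Rdiv_lt_0_compat; lra.
    - right. field. lra. }
  replace (f1 * u + f2 * v) with (D * u + f2 * (v - m * u)) in E' by (unfold D; ring).
  assert (E2 : Rabs (f2 * (v - m * u)) <= Rabs D / 4 * h).
  { rewrite Rabs_mult. apply Rle_trans with (Rabs f2 * (w * h)).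
    - apply Rmult_le_compat_l; lra.
    - rewrite <- Rmult_assoc. apply Rmult_le_compat_r; lra. }
  apply Rabs_le_between in E', E2.
  assert (0 < Rabs D * h) by (apply Rmult_lt_0_compat; lra). lra.
Qed.

(** * Two-parameter families of variations *)

Lemma diamond_small_exists (I : R -> Prop) (a b : R) (z : R -> R) :
  compact_ts I a b -> C1_diamond I z -> exists N, 0 < N /\ diamond_small I z N.
Proof.
  intros HI Hz. apply C1_diamond_iff in Hz. destruct Hz as [H1 H2].
  apply C1_nabla_reflect in H2.
  destruct (continuous_bounded I a b z HI) as [M1 HM1].
  { intros t It. now apply (C1_delta_continuous I a b). }
  destruct (continuous_upper_kappa_bounded I a b _ HI (proj2 H1)) as [M2 HM2].
  destruct (continuous_upper_kappa_bounded _ _ _ _ (compact_ts_reflect _ _ _ HI) (proj2 H2))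
    as [M3 HM3].
  pose proof (Rle_abs M1). pose proof (Rle_abs M2). pose proof (Rle_abs M3).
  pose proof (Rabs_pos M1). pose proof (Rabs_pos M2). pose proof (Rabs_pos M3).
  exists (Rabs M1 + Rabs M2 + Rabs M3 + 1). split; [lra|]. repeat split; intros t Ht.
  - specialize (HM1 t Ht). lra.
  - specialize (HM2 t Ht). lra.
  - rewrite nabla_derive_reflect. specialize (HM3 (- t)).
    rewrite upper_kappa_reflect, Ropp_involutive in HM3. specialize (HM3 Ht). lra.
Qed.

Lemma diamond_small_lin (I : R -> Prop) (a b u v M N r : R) (z w : R -> R) :
  compact_ts I a b -> C1_diamond I z -> C1_diamond I w ->
  diamond_small I z M -> diamond_small I w N -> Rabs u * M + Rabs v * N <= r ->
  diamond_small I (fun s => u * z s + v * w s) r.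
Proof.
  intros HI Hz Hw [Z1 [Z2 Z3]] [W1 [W2 W3]] Hr.
  assert (HB : forall p q, Rabs p <= M -> Rabs q <= N -> Rabs (u * p + v * q) <= r).
  { intros p q Hp Hq. eapply Rle_trans; [|exact Hr].
    eapply Rle_trans; [apply Rabs_triang|]. rewrite !Rabs_mult.
    apply Rplus_le_compat; apply Rmult_le_compat_l; auto using Rabs_pos. }
  apply C1_diamond_iff in Hz, Hw. destruct Hz as [Hz1 Hz2], Hw as [Hw1 Hw2].
  repeat split; intros t Ht.
  - apply HB; auto.
  - rewrite (delta_derive_lin I a b) by assumption. apply HB; auto.
  - rewrite (nabla_derive_eq I a b t (u * nabla_derive I z t + v * nabla_derive I w t));
      auto.
    apply is_nabla_derive_lin; now apply C1_nabla_anti.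
Qed.

(** Each of the four suprema in the norm contributes at most [r]. The case analysis also meets
    [m_infty], the supremum over an empty [both_kappa I]. *)
Lemma norm_1_inf_small (I : R -> Prop) (a b r : R) (z : R -> R) :
  compact_ts I a b -> 0 <= r -> diamond_small I z r -> Rbar_le (norm_1_inf I z) (4 * r).
Proof.
  intros HI Hr [H1 [H2 H3]].
  assert (HB : forall f, (forall t, both_kappa I t -> Rabs (f t) <= r) ->
    Rbar_le (norm_inf I f) r).
  { intros f Hf. apply Lub_Rbar_correct. intros x [t [Ht ->]]. now apply Hf. }
  unfold norm_1_inf.
  assert (N1 : Rbar_le (norm_inf I (fun t => z (sigma_ts I t))) r).
  { apply HB. intros t [Kt _]. apply H1. apply (sigma_spec I a b t HI). apply Kt. }
  assert (N2 : Rbar_le (norm_inf I (fun t => z (rho_ts I t))) r).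
  { apply HB. intros t [Kt _]. apply H1. apply (rho_spec I a b t HI). apply Kt. }
  assert (N3 : Rbar_le (norm_inf I (delta_derive I z)) r).
  { apply HB. intros t [Kt _]. now apply H2. }
  assert (N4 : Rbar_le (norm_inf I (nabla_derive I z)) r).
  { apply HB. intros t [_ Kt]. now apply H3. }
  destruct (norm_inf I _), (norm_inf I _), (norm_inf I _), (norm_inf I _);
    simpl in *; try tauto; lra.
Qed.

Lemma product_functional_differentiable (T I : R -> Prop) (a b : R)
  (LD LN : R -> R -> R -> R) (y z w : R -> R) :
  compact_ts I a b -> (forall t, I t -> T t) ->
  smooth_lagrangian T LD -> smooth_lagrangian T LN ->
  C1_diamond I y -> C1_diamond I z -> C1_diamond I w ->
  differentiable_at_0
    (fun u v => product_functional I a b LD LN (fun s => y s + (u * z s + v * w s)))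
    (product_variation I a b LD LN y z) (product_variation I a b LD LN y w).
Proof.
  intros HI HIT HLD HLN Hy Hz Hw eps He.
  destruct (diamond_small_exists I a b z HI Hz) as [M [HM SM]].
  destruct (diamond_small_exists I a b w HI Hw) as [N [HN SN]].
  destruct (product_functional_frechet T I a b (eps / (M + N)) LD LN y HI HIT HLD HLN Hy)
    as [d [Hd H]]; [apply Rdiv_lt_0_compat; lra|].
  exists (d / (2 * (M + N))). split; [apply Rdiv_lt_0_compat; lra|]. intros u v Hu Hv.
  set (r := (Rabs u + Rabs v) * (M + N)).
  pose proof (Rabs_pos u). pose proof (Rabs_pos v).
  specialize (H (fun s => u * z s + v * w s) r).
  replace (fun s => y s + (0 * z s + 0 * w s)) with y
    by (apply functional_extensionality; intros s; ring).
  rewrite (product_variation_lin T I a b u v) in H by assumption.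
  replace (eps * (Rabs u + Rabs v)) with (eps / (M + N) * r) by (unfold r; field; lra).
  rewrite (Rmult_comm _ u), (Rmult_comm _ v). apply H.
  - now apply (C1_diamond_lin I a b).
  - apply (diamond_small_lin I a b u v M N); auto. unfold r. nra.
  - unfold r. apply Rlt_le_trans with ((d / (2 * (M + N)) + d / (2 * (M + N))) * (M + N)).
    + apply Rmult_lt_compat_r; lra.
    + right. field. lra.
Qed.

(** Continuity is wanted at every [v], so the base point is moved to [y + u z + v w] and
    differentiability at the origin is applied there, with [w] as both directions. *)
Lemma product_functional_continuity (T I : R -> Prop) (a b u : R)
  (LD LN : R -> R -> R -> R) (y z w : R -> R) :
  compact_ts I a b -> (forall t, I t -> T t) ->
  smooth_lagrangian T LD -> smooth_lagrangian T LN ->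
  C1_diamond I y -> C1_diamond I z -> C1_diamond I w ->
  continuity (fun v => product_functional I a b LD LN (fun s => y s + (u * z s + v * w s))).
Proof.
  intros HI HIT HLD HLN Hy Hz Hw v.
  assert (Hy' : C1_diamond I (fun s => y s + (u * z s + v * w s))).
  { apply (C1_diamond_plus I a b); auto. now apply (C1_diamond_lin I a b). }
  pose proof (product_functional_differentiable T I a b LD LN _ w w HI HIT HLD HLN Hy' Hw Hw)
    as HD.
  set (l := product_variation _ _ _ _ _ _ _) in HD.
  destruct (HD 1 Rlt_0_1) as [d [Hd H]].
  intros eps He. pose proof (Rabs_pos l).
  exists (Rmin d (eps / (Rabs l + 1))). split.
  { apply Rmin_glb_lt; [lra|apply Rdiv_lt_0_compat; lra]. }
  intros x [_ Hx]. simpl in *. unfold Rdist in *.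
  pose proof (Rlt_le_trans _ _ _ Hx (Rmin_l _ _)) as Hx1.
  pose proof (Rlt_le_trans _ _ _ Hx (Rmin_r _ _)) as Hx2.
  specialize (H 0 (x - v) ltac:(rewrite Rabs_R0; lra) Hx1).
  rewrite Rabs_R0, Rplus_0_l, Rmult_0_r, Rplus_0_l, Rmult_1_l in H.
  replace (fun s => y s + (u * z s + v * w s) + (0 * w s + (x - v) * w s))
    with (fun s => y s + (u * z s + x * w s)) in H
    by (apply functional_extensionality; intros s; ring).
  replace (fun s => y s + (u * z s + v * w s) + (0 * w s + 0 * w s))
    with (fun s => y s + (u * z s + v * w s)) in H
    by (apply functional_extensionality; intros s; ring).
  set (p := product_functional I a b LD LN (fun s => y s + (u * z s + x * w s))) in *.
  set (q := product_functional I a b LD LN (fun s => y s + (u * z s + v * w s))) in *.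
  replace (p - q) with ((p - q - l * (x - v)) + l * (x - v)) by ring.
  eapply Rle_lt_trans; [apply Rabs_triang|]. rewrite Rabs_mult.
  apply Rle_lt_trans with ((Rabs l + 1) * Rabs (x - v)); [lra|].
  replace eps with ((Rabs l + 1) * (eps / (Rabs l + 1))) by (field; lra).
  apply Rmult_lt_compat_l; lra.
Qed.

(** The sign [sg] treats minimizers and maximizers together. The family [y + u z + v w] keeps the
    end values, so only the constraint has to be restored, by the choice of [v]. *)
Lemma weak_local_minimizer_proportional (T I : R -> Prop) (a b alpha beta k sg : R)
  (LD LN KD KN : R -> R -> R -> R) (y z w : R -> R) (delta : posreal) :
  compact_ts I a b -> (forall t, I t -> T t) ->
  smooth_lagrangian T LD -> smooth_lagrangian T LN ->
  smooth_lagrangian T KD -> smooth_lagrangian T KN ->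
  admissible I a b alpha beta k KD KN y ->
  (sg = 1 \/ sg = -1) ->
  (forall x, admissible I a b alpha beta k KD KN x ->
    Rbar_lt (norm_1_inf I (fun t => x t - y t)) delta ->
    sg * product_functional I a b LD LN y <= sg * product_functional I a b LD LN x) ->
  C1_diamond I z -> z a = 0 -> z b = 0 ->
  C1_diamond I w -> w a = 0 -> w b = 0 ->
  product_variation I a b KD KN y w <> 0 ->
  product_variation I a b LD LN y z =
    product_variation I a b LD LN y w * product_variation I a b KD KN y z
      / product_variation I a b KD KN y w.
Proof.
  intros HI HIT HLD HLN HKD HKN [Hy [Hya [Hyb HyK]]] Hsg Hmin Hz Hza Hzb Hw Hwa Hwb HK.
  destruct (diamond_small_exists I a b z HI Hz) as [M [HM SM]].
  destruct (diamond_small_exists I a b w HI Hw) as [N [HN SN]].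
  pose proof (cond_pos delta) as Hdelta.
  (* Parameters below [d0] give a variation that is [delta / 8]-small, so its norm, a sum of four
     terms, is at most [delta / 2]. *)
  set (d0 := delta / (8 * (M + N))).
  assert (Hd0 : 0 < d0) by (apply Rdiv_lt_0_compat; lra).
  assert (E0 : (fun s => y s + (0 * z s + 0 * w s)) = y)
    by (apply functional_extensionality; intros s; ring).
  set (f := fun u v => sg * product_functional I a b LD LN (fun s => y s + (u * z s + v * w s))).
  set (g := fun u v => product_functional I a b KD KN (fun s => y s + (u * z s + v * w s))).
  enough (sg * product_variation I a b LD LN y z =
    sg * product_variation I a b LD LN y w * product_variation I a b KD KN y z
      / product_variation I a b KD KN y w) as Hsgn.
  { apply (Rmult_eq_reg_l sg); [rewrite Hsgn; field; exact HK|]. destruct Hsg; lra. }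
  apply (lagrange_two_parameters f g _ _ _ _ d0); auto.
  - intros eps He.
    destruct (product_functional_differentiable T I a b LD LN y z w HI HIT HLD HLN Hy Hz Hw
      eps He) as [d [Hd H]].
    exists d. split; [exact Hd|]. intros u v Hu Hv. specialize (H u v Hu Hv).
    unfold f.
    set (P := product_functional I a b LD LN (fun s => y s + (u * z s + v * w s))) in *.
    set (P0 := product_functional I a b LD LN (fun s => y s + (0 * z s + 0 * w s))) in *.
    set (l1 := product_variation I a b LD LN y z) in *.
    set (l2 := product_variation I a b LD LN y w) in *.
    replace (sg * P - sg * P0 - (sg * l1 * u + sg * l2 * v))
      with (sg * (P - P0 - (l1 * u + l2 * v))) by ring.
    rewrite Rabs_mult. replace (Rabs sg) with 1; [lra|].
    destruct Hsg as [->| ->]; [now rewrite Rabs_R1|].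
    rewrite Rabs_left; lra.
  - exact (product_functional_differentiable T I a b KD KN y z w HI HIT HKD HKN Hy Hz Hw).
  - intros u. exact (product_functional_continuity T I a b u KD KN y z w HI HIT HKD HKN Hy Hz Hw).
  - intros u v Hu Hv Hg. unfold f, g in *. rewrite E0 in *.
    apply Hmin.
    + split; [|split; [|split]].
      * apply (C1_diamond_plus I a b); auto. now apply (C1_diamond_lin I a b).
      * rewrite Hza, Hwa, Hya. ring.
      * rewrite Hzb, Hwb, Hyb. ring.
      * rewrite Hg. exact HyK.
    + replace (fun t => y t + (u * z t + v * w t) - y t)
        with (fun t => u * z t + v * w t)
        by (apply functional_extensionality; intros s; ring).
      set (r := d0 * (M + N)).
      assert (Hr : 4 * r = delta / 2) by (unfold r, d0; field; lra).
      apply Rbar_le_lt_trans with (4 * r).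
      * apply (norm_1_inf_small I a b); auto; [lra|].
        apply (diamond_small_lin I a b u v M N); auto. unfold r. nra.
      * simpl. lra.
Qed.

Lemma multipliers_exist (T I : R -> Prop) (a b alpha beta k : R)
  (LD LN KD KN : R -> R -> R -> R) (y : R -> R) :
  compact_ts I a b -> (forall t, I t -> T t) ->
  smooth_lagrangian T LD -> smooth_lagrangian T LN ->
  smooth_lagrangian T KD -> smooth_lagrangian T KN ->
  extremizer I a b alpha beta k LD LN KD KN y ->
  exists lambda0 lambda, ~ (lambda0 = 0 /\ lambda = 0) /\
    forall z, C1_diamond I z -> z a = 0 -> z b = 0 ->
      lambda0 * product_variation I a b LD LN y z
      - lambda * product_variation I a b KD KN y z = 0.
Proof.
  intros HI HIT HLD HLN HKD HKN Hext.
  destruct (classic (exists w, (C1_diamond I w /\ w a = 0 /\ w b = 0) /\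
    product_variation I a b KD KN y w <> 0)) as [[w [[Hw [Hwa Hwb]] HK]]|N].
  - exists 1, (product_variation I a b LD LN y w / product_variation I a b KD KN y w).
    split; [lra|]. intros z Hz Hza Hzb.
    enough (product_variation I a b LD LN y z =
      product_variation I a b LD LN y w * product_variation I a b KD KN y z
        / product_variation I a b KD KN y w) as -> by (field; exact HK).
    destruct Hext as [[Hy [delta H]]|[Hy [delta H]]].
    + apply (weak_local_minimizer_proportional T I a b alpha beta k 1 LD LN KD KN y z w delta);
        auto.
      intros x Hx Hn. rewrite !Rmult_1_l. auto.
    + apply (weak_local_minimizer_proportional T I a b alpha beta k (-1) LD LN KD KN y z w delta);
        auto.
      intros x Hx Hn. specialize (H x Hx Hn). lra.
  - exists 0, 1. split; [lra|]. intros z Hz Hza Hzb.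
    destruct (Req_dec (product_variation I a b KD KN y z) 0) as [->|Hne]; [ring|].
    destruct N. now exists z.
Qed.

(** * Admissible cutoff functions *)

Lemma zero_of_pow_half_bound (x : R) : (forall n, Rabs x <= (/ 2) ^ n) -> x = 0.
Proof.
  intros H. apply cond_eq. intros eps He. rewrite Rminus_0_r.
  destruct (pow_lt_1_zero (/ 2)) with (y := eps) as [n Hn].
  - rewrite Rabs_pos_eq; lra.
  - exact He.
  - specialize (Hn n (Nat.le_refl n)). specialize (H n).
    rewrite Rabs_pos_eq in Hn; [lra|]. apply pow_le. lra.
Qed.

(** Truncated binary expansion of the value at [x]: each cut at [mid u v] decides one digit, 0 up to
    and including the cut and 1 beyond it. *)
Fixpoint bisection_digits (mid : R -> R -> R) (n : nat) (u v x : R) : R :=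
  match n with
  | O => 0
  | S n =>
      let m := mid u v in
      if Rle_dec x m then bisection_digits mid n u m x / 2
      else 1 / 2 + bisection_digits mid n m v x / 2
  end.

(** The truncations increase and are bounded, hence converge, and their recursion passes to the
    limit as a self-similarity. *)
Lemma bisection_function (mid : R -> R -> R) :
  exists phi : R -> R -> R -> R,
    (forall u v x, 0 <= phi u v x <= 1) /\
    (forall u v x, phi u v x =
       if Rle_dec x (mid u v) then phi u (mid u v) x / 2
       else 1 / 2 + phi (mid u v) v x / 2).
Proof.
  assert (HB : forall n u v x, 0 <= bisection_digits mid n u v x <= 1).
  { induction n as [|n IH]; intros u v x; simpl; [lra|].
    destruct (Rle_dec x (mid u v)).
    - specialize (IH u (mid u v) x). lra.
    - specialize (IH (mid u v) v x). lra. }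
  assert (HI : forall n u v x, bisection_digits mid n u v x <= bisection_digits mid (S n) u v x).
  { induction n as [|n IH]; intros u v x; [apply HB|].
    change (bisection_digits mid (S (S n)) u v x) with
      (if Rle_dec x (mid u v) then bisection_digits mid (S n) u (mid u v) x / 2
       else 1 / 2 + bisection_digits mid (S n) (mid u v) v x / 2).
    change (bisection_digits mid (S n) u v x) with
      (if Rle_dec x (mid u v) then bisection_digits mid n u (mid u v) x / 2
       else 1 / 2 + bisection_digits mid n (mid u v) v x / 2).
    destruct (Rle_dec x (mid u v)).
    - specialize (IH u (mid u v) x). lra.
    - specialize (IH (mid u v) v x). lra. }
  set (phi := fun u v x => real (Lim_seq (fun n => bisection_digits mid n u v x))).
  assert (HL : forall u v x, is_lim_seq (fun n => bisection_digits mid n u v x) (phi u v x)).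
  { intros u v x. apply Lim_seq_correct'. apply (ex_finite_lim_seq_incr _ 1).
    - intros n. apply HI.
    - intros n. apply HB. }
  exists phi. split.
  - intros u v x. split.
    + apply (is_lim_seq_le (fun _ => 0) (fun n => bisection_digits mid n u v x) 0 (phi u v x));
        [intros n; apply HB|apply is_lim_seq_const|apply HL].
    + apply (is_lim_seq_le (fun n => bisection_digits mid n u v x) (fun _ => 1) (phi u v x) 1);
        [intros n; apply HB|apply HL|apply is_lim_seq_const].
  - intros u v x. pose proof (HL u v x) as H.
    apply is_lim_seq_incr_1 in H. simpl in H.
    apply is_lim_seq_unique in H.
    enough (Lim_seq (fun n => if Rle_dec x (mid u v)
        then bisection_digits mid n u (mid u v) x / 2
        else 1 / 2 + bisection_digits mid n (mid u v) v x / 2) =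
      Finite (if Rle_dec x (mid u v) then phi u (mid u v) x / 2
       else 1 / 2 + phi (mid u v) v x / 2)) as E.
    { rewrite E in H. now injection H. }
    apply is_lim_seq_unique. destruct (Rle_dec x (mid u v)).
    + apply is_lim_seq_mult'; [apply HL|apply is_lim_seq_const].
    + apply is_lim_seq_plus'; [apply is_lim_seq_const|].
      apply is_lim_seq_mult'; [apply HL|apply is_lim_seq_const].
Qed.

(** A Cantor function: [phi] is the limit of step functions whose jumps, of
    size [2^-n], sit at distinct points of [J], so it is continuous and constant
    on every gap of [J]. *)
Lemma cantor_function (J : R -> Prop) (c d : R) :
  (forall u v, (exists t, J t /\ u < t < v) -> exists m, J m /\ u < m < v /\
     (exists t, J t /\ u < t < m) /\ (exists t, J t /\ m < t < v)) ->
  (exists t, J t /\ c < t < d) ->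
  exists phi : R -> R,
    (forall x, 0 <= phi x <= 1) /\
    (forall x, x <= c -> phi x = 0) /\ (forall x, d <= x -> phi x = 1) /\
    continuity phi /\
    (forall r s, r < s -> (forall t, J t -> ~ r < t < s) -> phi r = phi s).
Proof.
  intros Hmid Hcd.
  set (mid := fun u v => epsilon (inhabits 0) (fun m => J m /\ u < m < v /\
     (exists t, J t /\ u < t < m) /\ (exists t, J t /\ m < t < v))).
  set (ok := fun u v => exists t, J t /\ u < t < v).
  assert (Hm : forall u v, ok u v -> J (mid u v) /\ u < mid u v < v /\
     ok u (mid u v) /\ ok (mid u v) v).
  { intros u v H. exact (epsilon_spec (inhabits 0) _ (Hmid u v H)). }
  clearbody mid.
  destruct (bisection_function mid) as [phi [HB HE]].
  (* The functional equation halves any error bound, so induction on the number of cuts gives the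
     error [(/ 2) ^ n]; the next three assertions use the same device. *)
  assert (H0 : forall u v x, ok u v -> x <= u -> phi u v x = 0).
  { intros u v x Huv Hx. apply zero_of_pow_half_bound. intros n. revert u v Huv Hx.
    induction n as [|n IH]; intros u v Huv Hx.
    - specialize (HB u v x). simpl. apply Rabs_le. lra.
    - destruct (Hm u v Huv) as [_ [H1 [H2 H3]]]. rewrite HE.
      destruct (Rle_dec x (mid u v)); [|lra].
      specialize (IH _ _ H2 Hx). simpl. apply Rabs_le_between in IH. apply Rabs_le. lra. }
  assert (H1 : forall u v x, ok u v -> v <= x -> phi u v x = 1).
  { intros u v x Huv Hx. enough (phi u v x - 1 = 0) by lra.
    apply zero_of_pow_half_bound. intros n. revert u v Huv Hx.
    induction n as [|n IH]; intros u v Huv Hx.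
    - specialize (HB u v x). simpl. apply Rabs_le. lra.
    - destruct (Hm u v Huv) as [_ [H1 [H2 H3]]]. rewrite HE.
      destruct (Rle_dec x (mid u v)); [lra|].
      specialize (IH _ _ H3 Hx). simpl. apply Rabs_le_between in IH. apply Rabs_le. lra. }
  assert (HC : forall n u v x, ok u v -> exists e, 0 < e /\
    forall s, Rabs (s - x) < e -> Rabs (phi u v s - phi u v x) <= (/ 2) ^ n).
  { induction n as [|n IH]; intros u v x Huv.
    - exists 1. split; [lra|]. intros s _. simpl.
      pose proof (HB u v s). pose proof (HB u v x). apply Rabs_le. lra.
    - destruct (Hm u v Huv) as [_ [Hmuv [H2 H3]]]. set (m := mid u v) in *.
      destruct (IH u m x H2) as [e1 [He1 E1]]. destruct (IH m v x H3) as [e2 [He2 E2]].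
      pose proof (Rmin_l e1 e2). pose proof (Rmin_r e1 e2).
      assert (Hmin : 0 < Rmin e1 e2) by now apply Rmin_glb_lt.
      destruct (Rtotal_order x m) as [Hx|[Hx|Hx]].
      + exists (Rmin (Rmin e1 e2) (m - x)). split; [apply Rmin_glb_lt; lra|].
        pose proof (Rmin_l (Rmin e1 e2) (m - x)). pose proof (Rmin_r (Rmin e1 e2) (m - x)).
        intros s Hs. specialize (E1 s ltac:(lra)).
        apply Rabs_def2 in Hs. rewrite (HE u v s), (HE u v x). fold m.
        destruct (Rle_dec s m); [|lra]. destruct (Rle_dec x m); [|lra].
        simpl. apply Rabs_le_between in E1. apply Rabs_le. lra.
      (* At the cut both branches give 1/2: the left half ends in 1 and the right half starts at
         0. *)
      + subst x. exists (Rmin e1 e2). split; [exact Hmin|]. intros s Hs.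
        specialize (E1 s ltac:(lra)). specialize (E2 s ltac:(lra)).
        rewrite (HE u v s), (HE u v m). fold m.
        destruct (Rle_dec m m) as [_|]; [|lra].
        pose proof (H0 m v m H3 ltac:(lra)) as F0.
        pose proof (H1 u m m H2 ltac:(lra)) as F1.
        destruct (Rle_dec s m); simpl.
        * apply Rabs_le_between in E1. apply Rabs_le. lra.
        * apply Rabs_le_between in E2. apply Rabs_le. lra.
      + exists (Rmin (Rmin e1 e2) (x - m)). split; [apply Rmin_glb_lt; lra|].
        pose proof (Rmin_l (Rmin e1 e2) (x - m)). pose proof (Rmin_r (Rmin e1 e2) (x - m)).
        intros s Hs. specialize (E2 s ltac:(lra)).
        apply Rabs_def2 in Hs. rewrite (HE u v s), (HE u v x). fold m.
        destruct (Rle_dec s m); [lra|]. destruct (Rle_dec x m); [lra|].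
        simpl. apply Rabs_le_between in E2. apply Rabs_le. lra. }
  assert (HG : forall r s, r < s -> (forall t, J t -> ~ r < t < s) ->
    forall n u v, ok u v -> Rabs (phi u v s - phi u v r) <= (/ 2) ^ n).
  { intros r s Hrs Hgap. induction n as [|n IH]; intros u v Huv.
    - simpl. pose proof (HB u v s). pose proof (HB u v r). apply Rabs_le. lra.
    - destruct (Hm u v Huv) as [Jm [Hmuv [H2 H3]]]. set (m := mid u v) in *.
      specialize (Hgap m Jm).
      pose proof (IH u m H2) as E1. pose proof (IH m v H3) as E2.
      apply Rabs_le_between in E1, E2.
      rewrite (HE u v s), (HE u v r). fold m. simpl.
      destruct (Rle_dec s m); destruct (Rle_dec r m); try lra; apply Rabs_le; try lra.
      (* The cut belongs to [J], so it can separate [r] from [s] only by being equal to [r]; there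
         the two branches agree. *)
      assert (r = m) by lra. subst r.
      pose proof (H0 m v m H3 ltac:(lra)) as F0.
      pose proof (H1 u m m H2 ltac:(lra)) as F1. lra. }
  exists (phi c d). repeat split.
  - apply HB.
  - apply HB.
  - intros x Hx. now apply H0.
  - intros x Hx. now apply H1.
  - intros x eps He.
    destruct (pow_lt_1_zero (/ 2)) with (y := eps) as [n Hn];
      [rewrite Rabs_pos_eq; lra|exact He|].
    specialize (Hn n (Nat.le_refl n)).
    rewrite Rabs_pos_eq in Hn by (apply pow_le; lra).
    destruct (HC n c d x Hcd) as [e [He' H]]. exists e. split; [exact He'|].
    intros s [_ Hs]. simpl in *. unfold Rdist in *.
    eapply Rle_lt_trans; [now apply H|exact Hn].
  - intros r s Hrs Hgap. symmetry. apply Rminus_diag_uniq.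
    apply zero_of_pow_half_bound. intros n. now apply HG.
Qed.

(** The delta derivatives of the functions in [C1_diamond]: across a gap to
    the left of a right-dense point the derivative cannot jump. *)
Definition gap_compatible (I : R -> Prop) (h : R -> R) : Prop :=
  (forall t, I t -> continuous_within I h t) /\
  (forall t, right_dense_left_scattered I t -> I t -> h (rho_ts I t) = h t).

(** Left-scatteredness of [t] makes the step continuous on [I]. Right-scatteredness keeps [t] itself
    from being right-dense left-scattered, and any other such point has its [rho_ts] on the same
    side of the step. *)
Lemma gap_compatible_step (I : R -> Prop) (a b t : R) :
  compact_ts I a b -> I t -> rho_ts I t < t < sigma_ts I t ->
  gap_compatible I (fun x => if Rlt_dec x t then 1 else 0).
Proof.
  intros HI It [Hr Hs].
  destruct (sigma_spec I a b t HI It) as [_ [_ Hs']].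
  destruct (rho_spec I a b t HI It) as [_ [_ Hr']].
  split.
  - intros x Ix. apply continuous_within_eps. intros eps He.
    assert (Hc : forall e, 0 < e -> (forall s, I s -> Rabs (s - x) < e -> (s < t <-> x < t)) ->
      exists d, 0 < d /\ forall s, I s -> Rabs (s - x) < d ->
        Rabs ((if Rlt_dec s t then 1 else 0) - (if Rlt_dec x t then 1 else 0)) < eps).
    { intros e He' H. exists e. split; [exact He'|]. intros s Is Hsx.
      specialize (H s Is Hsx).
      destruct (Rlt_dec s t), (Rlt_dec x t); try tauto;
        now rewrite Rminus_diag, Rabs_R0. }
    destruct (Rtotal_order x t) as [Hx|[->|Hx]].
    * apply (Hc (t - x)); [lra|]. intros s Is Hsx. apply Rabs_def2 in Hsx. lra.
    * apply (Hc (t - rho_ts I t)); [lra|]. intros s Is Hsx. apply Rabs_def2 in Hsx.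
      split; [|lra]. intros Hst. specialize (Hr' s Is Hst). lra.
    * apply (Hc (x - t)); [lra|]. intros s Is Hsx. apply Rabs_def2 in Hsx. lra.
  - intros x [Hx1 Hx2] Ix. destruct (rho_spec I a b x HI Ix) as [_ [_ Hx3]].
    destruct (Rlt_dec x t) as [Hxt|Hxt]; destruct (Rlt_dec (rho_ts I x) t) as [Hxr|Hxr];
      try lra.
    destruct (Rle_lt_or_eq_dec t x) as [Hlt|Heq]; [lra| |].
    * specialize (Hx3 t It Hlt). lra.
    * subst x. lra.
Qed.

(** Either the window contains an isolated point, and a step there will do, or each of its points is
    dense on one side, which yields the splitting property required by [cantor_function]. *)
Lemma gap_compatible_cutoff (I : R -> Prop) (a b c d : R) :
  compact_ts I a b -> (exists t, I t /\ c < t < d) -> a <= c -> d <= b ->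
  exists h, gap_compatible I h /\ (forall x, 0 <= h x <= 1) /\
    (forall x, x <= c -> h x = 1) /\ (forall x, d <= x -> h x = 0).
Proof.
  intros HI Hcd Hac Hdb.
  destruct (classic (exists t, I t /\ c < t < d /\ t < sigma_ts I t /\ rho_ts I t < t))
    as [[t [It [Ht [Hs Hr]]]]|N].
  - exists (fun x => if Rlt_dec x t then 1 else 0).
    split; [now apply (gap_compatible_step I a b)|repeat split].
    + destruct (Rlt_dec x t); lra.
    + destruct (Rlt_dec x t); lra.
    + intros x Hx. destruct (Rlt_dec x t); lra.
    + intros x Hx. destruct (Rlt_dec x t); lra.
  - set (J := fun t => I t /\ c < t < d).
    assert (HJ : forall t, J t -> sigma_ts I t = t \/ rho_ts I t = t).
    { intros t [It Ht]. destruct (sigma_spec I a b t HI It) as [_ [Hs _]].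
      destruct (rho_spec I a b t HI It) as [_ [Hr _]].
      destruct (Req_dec (sigma_ts I t) t); [now left|].
      destruct (Req_dec (rho_ts I t) t); [now right|].
      destruct N. exists t. repeat split; auto; lra. }
    destruct (cantor_function J c d) as [phi [HB [H0 [H1 [HC HG]]]]].
    + intros u v [t [Jt Ht]]. pose proof Jt as [It Htcd].
      destruct (HJ t Jt) as [Hd|Hd].
      (* Two points of [I] are taken to the right of [t]: the nearer one, [m], is the cut, with [t]
         and [s] as witnesses on its two sides. *)
      * destruct (right_dense_approx I a b t (Rmin v d - t) HI It) as [s [Is Hs]]; auto.
        { lra. }
        { enough (t < Rmin v d) by lra. apply Rmin_glb_lt; lra. }
        pose proof (Rmin_l v d). pose proof (Rmin_r v d).
        destruct (right_dense_approx I a b t (s - t) HI It) as [m [Im Hm]]; auto; try lra.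
        exists m. repeat split; auto; try lra.
        -- exists t. split; [exact Jt|lra].
        -- exists s. repeat split; auto; lra.
      * destruct (left_dense_approx I a b t (t - Rmax u c) HI It) as [s [Is Hs]]; auto.
        { lra. }
        { enough (Rmax u c < t) by lra. apply Rmax_lub_lt; lra. }
        pose proof (Rmax_l u c). pose proof (Rmax_r u c).
        destruct (left_dense_approx I a b t (t - s) HI It) as [m [Im Hm]]; auto; try lra.
        exists m. repeat split; auto; try lra.
        -- exists s. repeat split; auto; lra.
        -- exists t. split; [exact Jt|lra].
    + destruct Hcd as [t [It Ht]]. exists t. now repeat split.
    + exists (fun x => 1 - phi x). split; [split|repeat split].
      * intros t It. apply continuous_within_eps. intros eps He.
        destruct (HC t eps He) as [e [He' H]]. exists e. split; [exact He'|].
        intros s _ Hs. replace (1 - phi s - (1 - phi t)) with (- (phi s - phi t)) by ring.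
        rewrite Rabs_Ropp. destruct (Req_dec t s) as [->|Hne].
        -- now rewrite Rminus_diag, Rabs_R0.
        -- apply H. split; [now split|exact Hs].
      * intros t [_ Ht] It. f_equal. apply HG; [exact Ht|].
        intros s [Is _] [Hs1 Hs2]. destruct (rho_spec I a b t HI It) as [_ [_ H]].
        specialize (H s Is Hs2). lra.
      * specialize (HB x). lra.
      * specialize (HB x). lra.
      * intros x Hx. rewrite H0 by exact Hx. ring.
      * intros x Hx. rewrite H1 by exact Hx. ring.
Qed.

(** * The lemma of du Bois-Reymond *)

Lemma ld_bounded_lin (I : R -> Prop) (f g : R -> R) (u v : R) :
  ld_bounded I f -> ld_bounded I g -> ld_bounded I (fun t => u * f t + v * g t).
Proof. rewrite !ld_bounded_reflect. apply rd_bounded_lin. Qed.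

Lemma ld_bounded_mult (I : R -> Prop) (f g : R -> R) :
  ld_bounded I f -> ld_bounded I g -> ld_bounded I (fun t => f t * g t).
Proof. rewrite !ld_bounded_reflect. apply rd_bounded_mult. Qed.

Lemma continuous_reflect (I : R -> Prop) (f : R -> R) :
  (forall t, I t -> continuous_within I f t) ->
  forall t, reflect I t -> continuous_within (reflect I) (fun s => f (- s)) t.
Proof.
  intros Hf t It. apply (continuous_within_reflect (reflect I) I); [|now apply Hf].
  intros s. reflexivity.
Qed.

Lemma ld_bounded_continuous (I : R -> Prop) (a b : R) (f : R -> R) :
  compact_ts I a b -> (forall t, I t -> continuous_within I f t) -> ld_bounded I f.
Proof.
  intros HI Hf. apply ld_bounded_reflect.
  apply (rd_bounded_continuous _ (- b) (- a)); [now apply compact_ts_reflect|].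
  now apply continuous_reflect.
Qed.

Lemma ld_bounded_comp_rho (I : R -> Prop) (a b : R) (f : R -> R) :
  compact_ts I a b -> (forall t, I t -> continuous_within I f t) ->
  ld_bounded I (fun t => f (rho_ts I t)).
Proof.
  intros HI Hf. apply ld_bounded_reflect.
  pose proof (rd_bounded_comp_sigma (reflect I) (- b) (- a) _ (compact_ts_reflect _ _ _ HI)
    (continuous_reflect I f Hf)) as H.
  replace (fun s => f (rho_ts I (- s))) with (fun s => f (- sigma_ts (reflect I) s));
    [exact H|].
  apply functional_extensionality. intros s. now rewrite rho_reflect, Ropp_involutive.
Qed.

Lemma continuous_within_comp_rho (I : R -> Prop) (a b t : R) (f : R -> R) :
  compact_ts I a b -> I t -> rho_ts I t = t -> continuous_within I f t ->
  continuous_within I (fun s => f (rho_ts I s)) t.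
Proof.
  intros HI It Ht Hf.
  assert (HR : forall s, I s <-> reflect I (- s)) by (intros s; symmetry; apply reflect_opp).
  pose proof (continuous_within_comp_sigma (reflect I) (- b) (- a) (- t)
    (fun s => f (- s)) (compact_ts_reflect _ _ _ HI) (proj1 (HR t) It)) as H.
  apply (continuous_within_reflect I (reflect I)) in H; auto.
  - cbv beta in H. replace (fun s => f (rho_ts I s))
      with (fun s => f (- sigma_ts (reflect I) (- s))); [exact H|].
    apply functional_extensionality. intros s. now rewrite rho_reflect.
  - rewrite rho_reflect in Ht. lra.
  - apply (continuous_within_reflect (reflect I) I); [reflexivity|].
    now rewrite Ropp_involutive.
Qed.

(** The nabla derivative is [h] composed with [rho_ts]. At a right-dense left-scattered [t] its
    limit from the right is [h t] and its value is [h (rho_ts I t)]; the second clause of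
    [gap_compatible] equates them. *)
Lemma gap_compatible_primitive (I : R -> Prop) (a b : R) (h H : R -> R) :
  compact_ts I a b -> gap_compatible I h -> anti_delta I h H ->
  C1_diamond I H /\
  (forall t, upper_kappa I t -> delta_derive I H t = h t) /\
  (forall t, lower_kappa I t -> nabla_derive I H t = h (rho_ts I t)).
Proof.
  intros HI [Hc Hg] HH.
  assert (HN : anti_nabla I (fun t => h (rho_ts I t)) H).
  { intros t Kt. pose proof (lower_kappa_in _ _ Kt) as It.
    apply (is_nabla_derive_anti_delta I a b); auto. intros _.
    apply (continuous_within_subset I); [apply upper_kappa_in|now apply Hc]. }
  split; [apply C1_diamond_iff; split|split].
  - apply (C1_delta_intro I a b h); auto. intros t Kt.
    apply (continuous_within_subset I); [apply upper_kappa_in|].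
    apply Hc. now apply upper_kappa_in.
  - apply (C1_nabla_intro I a b (fun t => h (rho_ts I t))); auto. intros t Kt.
    pose proof (lower_kappa_in _ _ Kt) as It.
    apply (continuous_within_subset I (lower_kappa I) (fun s => h (rho_ts I s)) t);
      [apply lower_kappa_in|].
    destruct (rho_spec I a b t HI It) as [_ [[_ Hr] Hr']].
    destruct (Rle_lt_or_eq_dec _ _ Hr) as [Hlt|Heq].
    2: { apply (continuous_within_comp_rho I a b); auto. }
    destruct (sigma_spec I a b t HI It) as [_ [[Hs _] Hs']].
    (* to the left of [t] there are no points nearby, and to the right [rho] is
       squeezed between [t] and the identity *)
    apply continuous_within_eps. intros eps He.
    destruct (Rle_lt_or_eq_dec _ _ Hs) as [Hlt'|Heq'].
    + exists (Rmin (t - rho_ts I t) (sigma_ts I t - t)).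
      split; [apply Rmin_glb_lt; lra|]. intros s Is Hst.
      pose proof (Rmin_l (t - rho_ts I t) (sigma_ts I t - t)).
      pose proof (Rmin_r (t - rho_ts I t) (sigma_ts I t - t)).
      apply Rabs_def2 in Hst. destruct (Rtotal_order s t) as [Hlst|[->|Hlst]].
      * specialize (Hr' s Is Hlst). lra.
      * now rewrite Rminus_diag, Rabs_R0.
      * specialize (Hs' s Is Hlst). lra.
    + symmetry in Heq'. rewrite (Hg t (conj Heq' Hlt) It).
      pose proof (Hc t It) as Hct. rewrite continuous_within_eps in Hct.
      destruct (Hct eps He) as [d [Hd Hd']].
      exists (Rmin (t - rho_ts I t) d).
      split; [apply Rmin_glb_lt; lra|]. intros s Is Hst.
      pose proof (Rmin_l (t - rho_ts I t) d). pose proof (Rmin_r (t - rho_ts I t) d).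
      apply Rabs_def2 in Hst. destruct (Rtotal_order s t) as [Hlst|[->|Hlst]].
      * specialize (Hr' s Is Hlst). lra.
      * rewrite (Hg t (conj Heq' Hlt) It). now rewrite Rminus_diag, Rabs_R0.
      * destruct (rho_spec I a b s HI Is) as [Irs [[_ Hs1] Hs2]].
        specialize (Hs2 t It Hlst). apply Hd'; [exact Irs|]. apply Rabs_def1; lra.
  - intros t Kt. apply (delta_derive_eq I a b); auto.
  - intros t Kt. apply (nabla_derive_eq I a b); auto.
Qed.

Lemma gap_compatible_minus_const (I : R -> Prop) (h : R -> R) (m : R) :
  gap_compatible I h -> gap_compatible I (fun t => 1 * h t + - m * 1).
Proof.
  intros [H1 H2]. split.
  - intros t It. apply continuous_within_lin; [now apply H1|apply continuous_within_const].
  - intros t Ht It. now rewrite (H2 t Ht It).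
Qed.

(** Explicit antiderivatives stand for the two integrals, so that linear combinations of integrands
    are handled on the antiderivatives directly. *)
Definition annihilates_variations (I : R -> Prop) (a b : R) (p q : R -> R) : Prop :=
  forall z S1 S2, C1_diamond I z -> z a = 0 -> z b = 0 ->
    anti_delta I (fun t => p t * delta_derive I z t) S1 ->
    anti_nabla I (fun t => q t * nabla_derive I z t) S2 ->
    S1 b - S1 a + (S2 b - S2 a) = 0.

(** Subtracting from [h] its mean [m] gives a slope with a primitive vanishing at both ends; the
    subtracted constant produces the right-hand side. *)
Lemma annihilates_gap_compatible (I : R -> Prop) (a b : R) (p q P Q h H S1 S2 : R -> R) :
  compact_ts I a b -> annihilates_variations I a b p q ->
  anti_delta I p P -> anti_nabla I q Q ->
  gap_compatible I h -> anti_delta I h H ->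
  anti_delta I (fun t => p t * h t) S1 ->
  anti_nabla I (fun t => q t * h (rho_ts I t)) S2 ->
  S1 b - S1 a + (S2 b - S2 a) =
    (P b - P a + (Q b - Q a)) / (b - a) * (H b - H a).
Proof.
  intros HI Hann HP HQ Hh HH HS1 HS2. pose proof (cts_lt _ _ _ HI) as Hab.
  set (m := (H b - H a) / (b - a)).
  assert (Hz : anti_delta I (fun t => 1 * h t + - m * 1)
    (fun s => 1 * (1 * H s + - m * s) + (m * a - H a) * 1)).
  { intros t Kt. replace (1 * h t + - m * 1) with (1 * (1 * h t + - m * 1) + (m * a - H a) * 0)
      by ring.
    apply is_delta_derive_lin; [|apply is_delta_derive_const].
    apply is_delta_derive_lin; [now apply HH|apply is_delta_derive_id]. }
  destruct (gap_compatible_primitive I a b _ _ HI (gap_compatible_minus_const I h m Hh) Hz)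
    as [Cz [Dz Nz]].
  pose proof (Hann _ (fun s => 1 * S1 s + - m * P s) (fun s => 1 * S2 s + - m * Q s) Cz)
    as E.
  enough (1 * S1 b + - m * P b - (1 * S1 a + - m * P a) +
    (1 * S2 b + - m * Q b - (1 * S2 a + - m * Q a)) = 0) as E'.
  { replace (_ / _ * _) with (m * (P b - P a + (Q b - Q a))) by (unfold m; field; lra).
    lra. }
  apply E.
  - ring.
  - unfold m. field. lra.
  - apply (anti_delta_ext I (fun t => 1 * (p t * h t) + - m * p t)).
    + intros t Kt. rewrite Dz by exact Kt. ring.
    + now apply anti_delta_lin.
  - apply (anti_nabla_ext I (fun t => 1 * (q t * h (rho_ts I t)) + - m * q t)).
    + intros t Kt. rewrite Nz by exact Kt. ring.
    + now apply anti_nabla_lin.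
Qed.

(** A cutoff that drops inside [[u, v]] turns the integrals into [P] and [Q] up to the window. Each
    of [p], [q] and [c] errs twice, once by the cutoff inside the window and once by replacing [u]
    with [t], hence the factor 2. Nabla integrals run over [(a, u]], so [h (rho_ts I x) = 1] is
    asked up to [x = u] included, but [h x = 1] only below [u]; this admits the degenerate window
    [u = v]. *)
Lemma annihilates_cutoff_estimate (I : R -> Prop) (a b c M N u t v : R)
  (p q P Q h : R -> R) :
  compact_ts I a b -> annihilates_variations I a b p q ->
  rd_bounded I p -> ld_bounded I q -> anti_delta I p P -> anti_nabla I q Q ->
  c = (P b - P a + (Q b - Q a)) / (b - a) ->
  (forall x, upper_kappa I x -> Rabs (p x) <= M) ->
  (forall x, lower_kappa I x -> Rabs (q x) <= N) ->
  gap_compatible I h -> (forall x, 0 <= h x <= 1) ->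
  I u -> I t -> I v -> u <= t <= v ->
  (forall x, I x -> x < u -> h x = 1) ->
  (forall x, I x -> x <= u -> h (rho_ts I x) = 1) ->
  (forall x, v <= x -> h x = 0) ->
  Rabs (P t + Q t - (P a + Q a) - c * (t - a)) <= 2 * (M + N + Rabs c) * (v - u).
Proof.
  intros HI Hann Rp Lq HP HQ Hc HM HN Hh Hh01 Iu It Iv Hutv Hl Hl' Hr.
  pose proof (cts_l _ _ _ HI) as Ia. pose proof (cts_r _ _ _ HI) as Ib.
  pose proof (cts_bound _ _ _ HI u Iu) as Bu. pose proof (cts_bound _ _ _ HI v Iv) as Bv.
  assert (Rh : rd_bounded I h) by (apply (rd_bounded_continuous I a b); auto; apply Hh).
  assert (Lh : ld_bounded I (fun x => h (rho_ts I x)))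
    by (apply (ld_bounded_comp_rho I a b); auto; apply Hh).
  destruct (anti_delta_exists I a b h HI Rh) as [H HH].
  destruct (anti_delta_exists I a b _ HI (rd_bounded_mult I _ _ Rp Rh)) as [S1 HS1].
  destruct (anti_nabla_exists I a b _ HI (ld_bounded_mult I _ _ Lq Lh)) as [S2 HS2].
  pose proof (annihilates_gap_compatible I a b p q P Q h H S1 S2 HI Hann HP HQ Hh HH HS1 HS2)
    as E. rewrite <- Hc in E.
  assert (Hid : anti_delta I (fun _ => 1) (fun s => s)) by (intros x _; apply is_delta_derive_id).
  assert (KU : forall x, I x -> x < v -> upper_kappa I x)
    by (intros x Ix Hx; apply (upper_kappa_lt I a b); auto; lra).
  assert (KL : forall x, I x -> u < x -> lower_kappa I x)
    by (intros x Ix Hx; apply (lower_kappa_lt I a b); auto; lra).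
  assert (Habs : forall x, Rabs (h x) <= 1).
  { intros x. specialize (Hh01 x). apply Rabs_le. lra. }
  assert (A1 : H u - H a = u - a).
  { apply (delta_increment_eq I a b a u h (fun _ => 1) H (fun s => s)); auto; [lra|].
    intros x Ix Hx. apply Hl; auto; lra. }
  assert (A2 : Rabs (H v - H u) <= 1 * (v - u)).
  { apply (delta_increment_abs_le I a b u v 1 h H); auto. lra. }
  assert (A3 : Rabs (H b - H v) <= 0 * (b - v)).
  { apply (delta_increment_abs_le I a b v b 0 h H); auto; [lra|].
    intros x Ix Hx. rewrite Hr by lra. rewrite Rabs_R0. lra. }
  assert (B1 : S1 u - S1 a = P u - P a).
  { apply (delta_increment_eq I a b a u (fun x => p x * h x) p S1 P); auto; [lra|].
    intros x Ix Hx. rewrite Hl by (auto; lra). ring. }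
  assert (B2 : Rabs (S1 v - S1 u) <= M * (v - u)).
  { apply (delta_increment_abs_le I a b u v M _ S1 HI HS1); auto; [lra|].
    intros x Ix Hx. rewrite Rabs_mult. rewrite <- (Rmult_1_r M).
    apply Rmult_le_compat; auto using Rabs_pos. apply HM, KU; auto; lra. }
  assert (B3 : Rabs (S1 b - S1 v) <= 0 * (b - v)).
  { apply (delta_increment_abs_le I a b v b 0 _ S1 HI HS1); auto; [lra|].
    intros x Ix Hx. rewrite Hr by lra. rewrite Rmult_0_r, Rabs_R0. lra. }
  assert (B4 : Rabs (P t - P u) <= M * (t - u)).
  { apply (delta_increment_abs_le I a b u t M _ P HI HP); auto; [lra|].
    intros x Ix Hx. apply HM, KU; auto; lra. }
  assert (D1 : S2 u - S2 a = Q u - Q a).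
  { apply (nabla_increment_eq I a b a u (fun x => q x * h (rho_ts I x)) q S2 Q); auto; [lra|].
    intros x Ix Hx. rewrite Hl' by (auto; lra). ring. }
  assert (D2 : Rabs (S2 v - S2 u) <= N * (v - u)).
  { apply (nabla_increment_abs_le I a b u v N _ S2 HI HS2); auto; [lra|].
    intros x Ix Hx. rewrite Rabs_mult. rewrite <- (Rmult_1_r N).
    apply Rmult_le_compat; auto using Rabs_pos. apply HN, KL; auto; lra. }
  assert (D3 : Rabs (S2 b - S2 v) <= 0 * (b - v)).
  { apply (nabla_increment_abs_le I a b v b 0 _ S2 HI HS2); auto; [lra|].
    intros x Ix Hx. destruct (rho_spec I a b x HI Ix) as [_ [_ Hx']].
    rewrite Hr by (apply Hx'; auto; lra). rewrite Rmult_0_r, Rabs_R0. lra. }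
  assert (D4 : Rabs (Q t - Q u) <= N * (t - u)).
  { apply (nabla_increment_abs_le I a b u t N _ Q HI HQ); auto; [lra|].
    intros x Ix Hx. apply HN, KL; auto; lra. }
  assert (E1 : Rabs (c * (H v - H u)) <= Rabs c * (v - u)).
  { rewrite Rabs_mult. apply Rmult_le_compat_l; [apply Rabs_pos|lra]. }
  assert (E2 : Rabs (c * (t - u)) <= Rabs c * (v - u)).
  { rewrite Rabs_mult, (Rabs_pos_eq (t - u)) by lra.
    apply Rmult_le_compat_l; [apply Rabs_pos|lra]. }
  rewrite Rmult_0_l in A3, B3, D3.
  assert (A3' : H b = H v) by (apply Rabs_le_between in A3; lra).
  replace (c * (H b - H a)) with (c * (u - a) + c * (H v - H u)) in E
    by (rewrite A3', <- A1; ring).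
  replace (c * (t - a)) with (c * (u - a) + c * (t - u)) by ring.
  assert (M * (t - u) <= M * (v - u) /\ N * (t - u) <= N * (v - u)) as [F1 F2].
  { destruct (Rle_lt_or_eq_dec u v) as [Huv|Huv]; [lra| |].
    - assert (0 <= M) by (eapply Rle_trans; [apply Rabs_pos|apply (HM u), KU; auto]).
      assert (0 <= N) by (eapply Rle_trans; [apply Rabs_pos|apply (HN v), KL; auto]).
      split; apply Rmult_le_compat_l; lra.
    - replace t with v by lra. lra. }
  apply Rabs_le_between in B2, B3, B4, D2, D3, D4, E1, E2. apply Rabs_le. lra.
Qed.

(** Every interior point has a usable window: an isolated point the degenerate one, where the
    estimate is exact, any other point an arbitrarily short one on a side where it is dense. The end
    [b] is settled by the choice of [c]. *)
Lemma du_bois_reymond (I : R -> Prop) (a b : R) (p q P Q : R -> R) :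
  compact_ts I a b -> annihilates_variations I a b p q ->
  rd_bounded I p -> ld_bounded I q -> anti_delta I p P -> anti_nabla I q Q ->
  exists c, forall t, I t -> P t + Q t = P a + Q a + c * (t - a).
Proof.
  intros HI Hann Rp Lq HP HQ. pose proof (cts_lt _ _ _ HI) as Hab.
  set (c := (P b - P a + (Q b - Q a)) / (b - a)). exists c. intros t It.
  pose proof Rp as [[M HM] _]. pose proof Lq as [[N HN] _].
  enough (P t + Q t - (P a + Q a) - c * (t - a) = 0) by lra.
  assert (Hest := fun u v h => annihilates_cutoff_estimate I a b c M N u t v p q P Q h
    HI Hann Rp Lq HP HQ eq_refl HM HN).
  assert (Hlim : forall x K, (forall d, 0 < d -> Rabs x <= K * d) -> x = 0).
  { intros x K H. apply cond_eq. intros eps He. rewrite Rminus_0_r.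
    pose proof (Rabs_pos K). pose proof (Rle_abs K).
    assert (Hd : 0 < eps / (Rabs K + 1) / 2) by (repeat apply Rdiv_lt_0_compat; lra).
    specialize (H _ Hd). apply Rle_lt_trans with (1 := H).
    apply Rle_lt_trans with ((Rabs K + 1) * (eps / (Rabs K + 1) / 2)).
    - apply Rmult_le_compat_r; lra.
    - replace ((Rabs K + 1) * (eps / (Rabs K + 1) / 2)) with (eps / 2) by (field; lra).
      lra. }
  pose proof (Rabs_pos c) as Pc.
  assert (HM0 : 0 <= M).
  { eapply Rle_trans; [apply Rabs_pos|apply (HM a)].
    apply (upper_kappa_lt I a b); auto. exact (cts_l _ _ _ HI). }
  assert (HN0 : 0 <= N).
  { eapply Rle_trans; [apply Rabs_pos|apply (HN b)].
    apply (lower_kappa_lt I a b); auto. exact (cts_r _ _ _ HI). }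
  destruct (cts_bound _ _ _ HI t It) as [Hat Htb].
  destruct (Rle_lt_or_eq_dec _ _ Hat) as [Hat'|<-]; [|ring].
  destruct (Rle_lt_or_eq_dec _ _ Htb) as [Htb'|Heq].
  2: { subst t. unfold c. field. lra. }
  destruct (sigma_spec I a b t HI It) as [_ [[Hs _] _]].
  destruct (rho_spec I a b t HI It) as [_ [[_ Hr] _]].
  destruct (Rle_lt_or_eq_dec _ _ Hs) as [Hs'|Hs'].
  - destruct (Rle_lt_or_eq_dec _ _ Hr) as [Hr'|Hr'].
    + apply (Hlim _ 0). intros d Hd.
      replace (0 * d) with (2 * (M + N + Rabs c) * (t - t)) by ring.
      apply (Hest t t (fun x => if Rlt_dec x t then 1 else 0)); auto.
      * apply (gap_compatible_step I a b); auto.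
      * intros x. destruct (Rlt_dec x t); lra.
      * lra.
      * intros x Ix Hx. destruct (Rlt_dec x t); lra.
      * intros x Ix Hx. destruct (rho_spec I a b x HI Ix) as [_ [[_ Hx'] _]].
        destruct (Rlt_dec (rho_ts I x) t) as [|Hn]; [reflexivity|].
        assert (x = t) by lra. subst x. lra.
      * intros x Hx. destruct (Rlt_dec x t); lra.
    + apply (Hlim _ (2 * (M + N + Rabs c))). intros d Hd.
      destruct (left_dense_approx I a b t d HI It Hat' Hr' Hd) as [u [Iu Hu]].
      (* The cutoff needs a point of [I] strictly inside its window in order to descend. *)
      destruct (left_dense_approx I a b t (t - u) HI It Hat' Hr') as [w [Iw Hw]]; [lra|].
      pose proof (cts_bound _ _ _ HI u Iu).
      destruct (gap_compatible_cutoff I a b u t HI) as [h [Hh [Hh01 [H1 H0]]]]; try lra.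
      { exists w. split; [exact Iw|lra]. }
      apply Rle_trans with (2 * (M + N + Rabs c) * (t - u)).
      * apply (Hest u t h); auto; try lra.
        -- intros x Ix Hx. apply H1. lra.
        -- intros x Ix Hx. apply H1.
           destruct (rho_spec I a b x HI Ix) as [_ [Hx' _]]. lra.
      * apply Rmult_le_compat_l; lra.
  - apply (Hlim _ (2 * (M + N + Rabs c))). intros d Hd. symmetry in Hs'.
    destruct (right_dense_approx I a b t d HI It Htb' Hs' Hd) as [v [Iv Hv]].
    destruct (right_dense_approx I a b t (v - t) HI It Htb' Hs') as [w [Iw Hw]]; [lra|].
    pose proof (cts_bound _ _ _ HI v Iv).
    destruct (gap_compatible_cutoff I a b t v HI) as [h [Hh [Hh01 [H1 H0]]]]; try lra.
    { exists w. split; [exact Iw|lra]. }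
    apply Rle_trans with (2 * (M + N + Rabs c) * (v - t)).
    * apply (Hest t v h); auto; try lra.
      -- intros x Ix Hx. apply H1. lra.
      -- intros x Ix Hx. apply H1.
         destruct (rho_spec I a b x HI Ix) as [_ [Hx' _]]. lra.
    * apply Rmult_le_compat_l; lra.
Qed.

(** * The Euler-Lagrange equations *)

(** [delta_int] is chosen separately for each upper limit; one antiderivative normalised to vanish
    at [a] represents it for all [t] at once. *)
Lemma delta_EL_primitive (T I : R -> Prop) (a b : R) (L : R -> R -> R -> R) (y : R -> R) :
  compact_ts I a b -> (forall t, I t -> T t) -> smooth_lagrangian T L -> C1_delta I y ->
  exists P, anti_delta I (along_delta I (partial2 L) y) P /\
    forall t, I t -> delta_EL I a L y t = along_delta I (partial3 L) y t - P t.
Proof.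
  intros HI HIT HL Hy.
  destruct (anti_delta_exists I a b _ HI
    (along_delta_rd T I a b (partial2 L) y HI HIT ltac:(apply HL) Hy)) as [F HF].
  exists (fun t => 1 * F t + - F a * 1). split.
  - intros t Kt. replace (along_delta I (partial2 L) y t) with
      (1 * along_delta I (partial2 L) y t + - F a * 0) by ring.
    apply is_delta_derive_lin; [now apply HF|apply is_delta_derive_const].
  - intros t It. unfold delta_EL.
    rewrite (delta_int_eq I a b a t _ F HI HF (cts_l _ _ _ HI) It). ring.
Qed.

Lemma nabla_EL_primitive (T I : R -> Prop) (a b : R) (L : R -> R -> R -> R) (y : R -> R) :
  compact_ts I a b -> (forall t, I t -> T t) -> smooth_lagrangian T L -> C1_nabla I y ->
  exists Q, anti_nabla I (along_nabla I (partial2 L) y) Q /\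
    forall t, I t -> nabla_EL I a L y t = along_nabla I (partial3 L) y t - Q t.
Proof.
  intros HI HIT HL Hy.
  destruct (anti_nabla_exists I a b _ HI
    (along_nabla_ld T I a b (partial2 L) y HI HIT ltac:(apply HL) Hy)) as [F HF].
  exists (fun t => 1 * F t + - F a * 1). split.
  - intros t Kt. replace (along_nabla I (partial2 L) y t) with
      (1 * along_nabla I (partial2 L) y t + - F a * 0) by ring.
    apply is_nabla_derive_lin; [now apply HF|apply is_nabla_derive_const].
  - intros t It. unfold nabla_EL.
    rewrite (nabla_int_eq I a b a t _ F HI HF (cts_l _ _ _ HI) It). ring.
Qed.

Lemma rd_bounded_ext (I : R -> Prop) (f g : R -> R) :
  (forall t, upper_kappa I t -> f t = g t) -> rd_bounded I f -> rd_bounded I g.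
Proof.
  intros H [[M HM] Hf]. split.
  - exists M. intros t Kt. rewrite <- H by exact Kt. now apply HM.
  - intros t Kt Ht. apply (continuous_within_ext _ f); auto.
Qed.

Lemma ld_bounded_ext (I : R -> Prop) (f g : R -> R) :
  (forall t, lower_kappa I t -> f t = g t) -> ld_bounded I f -> ld_bounded I g.
Proof.
  intros H [[M HM] Hf]. split.
  - exists M. intros t Kt. rewrite <- H by exact Kt. now apply HM.
  - intros t Kt Ht. apply (continuous_within_ext _ f); auto.
Qed.

Lemma delta_EL_rd (T I : R -> Prop) (a b : R) (L : R -> R -> R -> R) (y : R -> R) :
  compact_ts I a b -> (forall t, I t -> T t) -> smooth_lagrangian T L -> C1_delta I y ->
  rd_bounded I (delta_EL I a L y).
Proof.
  intros HI HIT HL Hy.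
  destruct (delta_EL_primitive T I a b L y HI HIT HL Hy) as [P [HP HE]].
  apply (rd_bounded_ext I (fun t => 1 * along_delta I (partial3 L) y t + -1 * P t)).
  - intros t Kt. rewrite HE by now apply upper_kappa_in. ring.
  - apply rd_bounded_lin.
    + apply (along_delta_rd T I a b); auto. apply HL.
    + apply (rd_bounded_continuous I a b); auto. intros t It.
      now apply (anti_delta_continuous I a b t _ P HI HP).
Qed.

Lemma nabla_EL_ld (T I : R -> Prop) (a b : R) (L : R -> R -> R -> R) (y : R -> R) :
  compact_ts I a b -> (forall t, I t -> T t) -> smooth_lagrangian T L -> C1_nabla I y ->
  ld_bounded I (nabla_EL I a L y).
Proof.
  intros HI HIT HL Hy.
  destruct (nabla_EL_primitive T I a b L y HI HIT HL Hy) as [Q [HQ HE]].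
  apply (ld_bounded_ext I (fun t => 1 * along_nabla I (partial3 L) y t + -1 * Q t)).
  - intros t Kt. rewrite HE by now apply lower_kappa_in. ring.
  - apply ld_bounded_lin.
    + apply (along_nabla_ld T I a b); auto. apply HL.
    + apply (ld_bounded_continuous I a b); auto. intros t It.
      now apply (anti_nabla_continuous I a b t _ Q HI HQ).
Qed.

Lemma delta_variation_EL (T I : R -> Prop) (a b : R) (L : R -> R -> R -> R)
  (y z S : R -> R) :
  compact_ts I a b -> (forall t, I t -> T t) -> smooth_lagrangian T L ->
  C1_delta I y -> C1_delta I z -> z a = 0 -> z b = 0 ->
  anti_delta I (fun t => delta_EL I a L y t * delta_derive I z t) S ->
  delta_variation I a b L y z = S b - S a.
Proof.
  intros HI HIT HL Hy Hz Hza Hzb HS.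
  destruct (delta_EL_primitive T I a b L y HI HIT HL Hy) as [P [HP HE]].
  apply (delta_variation_by_parts I a b L y z P S); auto.
  apply (anti_delta_ext I (fun t => delta_EL I a L y t * delta_derive I z t)); auto.
  intros t Kt. rewrite HE; [reflexivity|]. now apply upper_kappa_in.
Qed.

Lemma nabla_variation_EL (T I : R -> Prop) (a b : R) (L : R -> R -> R -> R)
  (y z S : R -> R) :
  compact_ts I a b -> (forall t, I t -> T t) -> smooth_lagrangian T L ->
  C1_nabla I y -> C1_nabla I z -> z a = 0 -> z b = 0 ->
  anti_nabla I (fun t => nabla_EL I a L y t * nabla_derive I z t) S ->
  nabla_variation I a b L y z = S b - S a.
Proof.
  intros HI HIT HL Hy Hz Hza Hzb HS.
  destruct (nabla_EL_primitive T I a b L y HI HIT HL Hy) as [Q [HQ HE]].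
  apply (nabla_variation_by_parts I a b L y z Q S); auto.
  apply (anti_nabla_ext I (fun t => nabla_EL I a L y t * nabla_derive I z t)); auto.
  intros t Kt. rewrite HE; [reflexivity|]. now apply lower_kappa_in.
Qed.

(** If [sigma_ts I t = t], continuity is part of [rd_bounded]. At a left-dense right-scattered [t]
    it is the momentum hypothesis, the integral term being continuous everywhere. *)
Lemma delta_EL_continuous_within (T I : R -> Prop) (a b t : R) (L : R -> R -> R -> R)
  (y : R -> R) :
  compact_ts I a b -> (forall t, I t -> T t) -> smooth_lagrangian T L -> C1_delta I y ->
  upper_kappa I t -> rho_ts I t = t -> delta_momentum_regular I L y t ->
  continuous_within (upper_kappa I) (delta_EL I a L y) t.
Proof.
  intros HI HIT HL Hy Kt Hr Hreg. pose proof (upper_kappa_in _ _ Kt) as It.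
  destruct (sigma_spec I a b t HI It) as [_ [[Hs _] _]].
  destruct (Rle_lt_or_eq_dec _ _ Hs) as [Hs'|Hs'].
  2: { apply (delta_EL_rd T I a b); auto. }
  destruct (delta_EL_primitive T I a b L y HI HIT HL Hy) as [P [HP HE]].
  apply (continuous_within_ext _
    (fun s => 1 * along_delta I (partial3 L) y s + -1 * P s)); auto.
  - intros s Ks. rewrite HE by now apply upper_kappa_in. ring.
  - apply continuous_within_lin; [now apply Hreg|].
    apply (continuous_within_subset I); [apply upper_kappa_in|].
    now apply (anti_delta_continuous I a b t _ P HI HP).
Qed.

Lemma nabla_EL_continuous_within (T I : R -> Prop) (a b t : R) (L : R -> R -> R -> R)
  (y : R -> R) :
  compact_ts I a b -> (forall t, I t -> T t) -> smooth_lagrangian T L -> C1_nabla I y ->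
  lower_kappa I t -> sigma_ts I t = t -> nabla_momentum_regular I L y t ->
  continuous_within (lower_kappa I) (nabla_EL I a L y) t.
Proof.
  intros HI HIT HL Hy Kt Hs Hreg. pose proof (lower_kappa_in _ _ Kt) as It.
  destruct (rho_spec I a b t HI It) as [_ [[_ Hr] _]].
  destruct (Rle_lt_or_eq_dec _ _ Hr) as [Hr'|Hr'].
  2: { apply (nabla_EL_ld T I a b); auto. }
  destruct (nabla_EL_primitive T I a b L y HI HIT HL Hy) as [Q [HQ HE]].
  apply (continuous_within_ext _
    (fun s => 1 * along_nabla I (partial3 L) y s + -1 * Q s)); auto.
  - intros s Ks. rewrite HE by now apply lower_kappa_in. ring.
  - apply continuous_within_lin; [now apply Hreg|].
    apply (continuous_within_subset I); [apply lower_kappa_in|].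
    now apply (anti_nabla_continuous I a b t _ Q HI HQ).
Qed.

(** The weights follow the product rule: each Euler-Lagrange expression is multiplied by the value
    of the other factor of its product. The given [S1] and [S2] have the same increments as the
    weighted sums of antiderivatives for the single Lagrangians. *)
Lemma annihilates_EL (T I : R -> Prop) (a b lambda0 lambda : R)
  (LD LN KD KN : R -> R -> R -> R) (y : R -> R) :
  compact_ts I a b -> (forall t, I t -> T t) ->
  smooth_lagrangian T LD -> smooth_lagrangian T LN ->
  smooth_lagrangian T KD -> smooth_lagrangian T KN -> C1_diamond I y ->
  (forall z, C1_diamond I z -> z a = 0 -> z b = 0 ->
      lambda0 * product_variation I a b LD LN y z
      - lambda * product_variation I a b KD KN y z = 0) ->
  annihilates_variations I a b
    (fun t => lambda0 * nabla_functional I a b LN y * delta_EL I a LD y t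
              + - (lambda * nabla_functional I a b KN y) * delta_EL I a KD y t)
    (fun t => lambda0 * delta_functional I a b LD y * nabla_EL I a LN y t
              + - (lambda * delta_functional I a b KD y) * nabla_EL I a KN y t).
Proof.
  intros HI HIT HLD HLN HKD HKN Hy Hvar z S1 S2 Hz Hza Hzb HS1 HS2.
  specialize (Hvar z Hz Hza Hzb).
  pose proof (cts_l _ _ _ HI) as Ia. pose proof (cts_r _ _ _ HI) as Ib.
  pose proof (cts_lt _ _ _ HI) as Hab.
  apply C1_diamond_iff in Hy, Hz. destruct Hy as [Hy1 Hy2], Hz as [Hz1 Hz2].
  assert (Rz : rd_bounded I (delta_derive I z))
    by (apply (rd_bounded_continuous_on I a b); auto; apply Hz1).
  assert (Lz : ld_bounded I (nabla_derive I z)).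
  { apply C1_nabla_reflect in Hz2. apply ld_bounded_reflect.
    replace (fun s => nabla_derive I z (- s))
      with (delta_derive (reflect I) (reflect_fun z)).
    - apply (rd_bounded_continuous_on _ (- b) (- a)); [now apply compact_ts_reflect|].
      apply Hz2.
    - apply functional_extensionality. intros s.
      now rewrite nabla_derive_reflect, Ropp_involutive. }
  destruct (anti_delta_exists I a b _ HI
    (rd_bounded_mult I _ _ (delta_EL_rd T I a b LD y HI HIT HLD Hy1) Rz)) as [U1 HU1].
  destruct (anti_delta_exists I a b _ HI
    (rd_bounded_mult I _ _ (delta_EL_rd T I a b KD y HI HIT HKD Hy1) Rz)) as [V1 HV1].
  destruct (anti_nabla_exists I a b _ HI
    (ld_bounded_mult I _ _ (nabla_EL_ld T I a b LN y HI HIT HLN Hy2) Lz)) as [U2 HU2].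
  destruct (anti_nabla_exists I a b _ HI
    (ld_bounded_mult I _ _ (nabla_EL_ld T I a b KN y HI HIT HKN Hy2) Lz)) as [V2 HV2].
  unfold product_variation in Hvar.
  rewrite (delta_variation_EL T I a b LD y z U1), (delta_variation_EL T I a b KD y z V1),
    (nabla_variation_EL T I a b LN y z U2), (nabla_variation_EL T I a b KN y z V2)
    in Hvar by assumption.
  pose proof (delta_increment_eq I a b a b _ _ S1 _ HI HS1
    (anti_delta_lin I _ _ _ _ (lambda0 * nabla_functional I a b LN y)
      (- (lambda * nabla_functional I a b KN y)) HU1 HV1) Ia Ib ltac:(lra)) as E1.
  pose proof (nabla_increment_eq I a b a b _ _ S2 _ HI HS2
    (anti_nabla_lin I _ _ _ _ (lambda0 * delta_functional I a b LD y)
      (- (lambda * delta_functional I a b KD y)) HU2 HV2) Ia Ib ltac:(lra)) as E2.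
  cbv beta in E1, E2. rewrite E1, E2 by (intros; ring). rewrite <- Hvar. ring.
Qed.

(** * The two integral equations *)

Lemma compact_ts_interval (T : R -> Prop) (a b : R) :
  closed T -> T a -> T b -> a < b -> compact_ts (ts_interval T a b) a b.
Proof.
  intros HT Ha Hb Hab. split; unfold ts_interval; try (split; [assumption|lra]);
    try tauto.
  intros x Hx. split.
  - apply HT. intros [d Hd]. apply Hx. exists d. intros y By [Ty _]. exact (Hd y By Ty).
  - apply NNPP. intros N. apply Hx.
    destruct (Rlt_le_dec x a) as [Hxa|Hxa].
    + assert (Hd : 0 < a - x) by lra. exists (mkposreal _ Hd). intros y By [_ Hy].
      change (Rabs (y - x) < a - x) in By. apply Rabs_def2 in By. lra.
    + assert (Hd : 0 < x - b) by lra. exists (mkposreal _ Hd). intros y By [_ Hy].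
      change (Rabs (y - x) < x - b) in By. apply Rabs_def2 in By. lra.
Qed.

Theorem theorem10 (T : R -> Prop) (a b alpha beta k : R)
  (LD LN KD KN : R -> R -> R -> R) (yh : R -> R)
  (hT : time_scale T) (ha : T a) (hb : T b) (hab : a < b)
  (hmid : exists c, T c /\ c <> a /\ c <> b /\ a <= c <= b)
  (hLD : smooth_lagrangian T LD) (hLN : smooth_lagrangian T LN)
  (hKD : smooth_lagrangian T KD) (hKN : smooth_lagrangian T KN)
  (hext : extremizer (ts_interval T a b) a b alpha beta k LD LN KD KN yh) :
  let I := ts_interval T a b in
  exists lambda0 lambda : R,
    ~ (lambda0 = 0 /\ lambda = 0) /\
    (exists c : R, forall t : R, lower_kappa I t ->
       delta_momentum_regular I LD yh t ->
       delta_momentum_regular I KD yh t ->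
       lambda0 *
         (nabla_functional I a b LN yh * delta_EL I a LD yh (rho_ts I t)
          + delta_functional I a b LD yh * nabla_EL I a LN yh t)
       - lambda *
         (nabla_functional I a b KN yh * delta_EL I a KD yh (rho_ts I t)
          + delta_functional I a b KD yh * nabla_EL I a KN yh t) = c) /\
    (exists c : R, forall t : R, upper_kappa I t ->
       nabla_momentum_regular I LN yh t ->
       nabla_momentum_regular I KN yh t ->
       lambda0 *
         (nabla_functional I a b LN yh * delta_EL I a LD yh t
          + delta_functional I a b LD yh * nabla_EL I a LN yh (sigma_ts I t))
       - lambda *
         (nabla_functional I a b KN yh * delta_EL I a KD yh t
          + delta_functional I a b KD yh * nabla_EL I a KN yh (sigma_ts I t)) = c).
Proof.
  intros I.
  assert (HI : compact_ts I a b) by (apply compact_ts_interval; auto; apply hT).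
  assert (HIT : forall t, I t -> T t) by (intros t [Tt _]; exact Tt).
  destruct (multipliers_exist T I a b alpha beta k LD LN KD KN yh HI HIT hLD hLN hKD hKN hext)
    as [lambda0 [lambda [Hne Hvar]]].
  assert (Hy : C1_diamond I yh) by (destruct hext as [[[H _] _]|[[H _] _]]; exact H).
  exists lambda0, lambda. split; [exact Hne|].
  pose proof (annihilates_EL T I a b lambda0 lambda LD LN KD KN yh HI HIT hLD hLN hKD hKN
    Hy Hvar) as Hann.
  apply C1_diamond_iff in Hy. destruct Hy as [Hy1 Hy2].
  set (p := fun t => lambda0 * nabla_functional I a b LN yh * delta_EL I a LD yh t
    + - (lambda * nabla_functional I a b KN yh) * delta_EL I a KD yh t) in Hann.
  set (q := fun t => lambda0 * delta_functional I a b LD yh * nabla_EL I a LN yh t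
    + - (lambda * delta_functional I a b KD yh) * nabla_EL I a KN yh t) in Hann.
  assert (Rp : rd_bounded I p) by (apply rd_bounded_lin; now apply (delta_EL_rd T I a b)).
  assert (Lq : ld_bounded I q) by (apply ld_bounded_lin; now apply (nabla_EL_ld T I a b)).
  destruct (anti_delta_exists I a b p HI Rp) as [P HP].
  destruct (anti_nabla_exists I a b q HI Lq) as [Q HQ].
  destruct (du_bois_reymond I a b p q P Q HI Hann Rp Lq HP HQ) as [c Hc].
  (* Both sides are written as linear combinations so that the linearity rules give their two
     derivatives, to be compared by uniqueness. *)
  assert (HA : forall t, I t -> c * t + (P a + Q a - c * a) * 1 = 1 * P t + 1 * Q t).
  { intros t It. specialize (Hc t It). lra. }
  split; exists c; intros t Kt HregL HregK.
  - pose proof (lower_kappa_in _ _ Kt) as It.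
    assert (DA : is_nabla_derive I (fun s => 1 * P s + 1 * Q s) t
      (1 * p (rho_ts I t) + 1 * q t)).
    { apply is_nabla_derive_lin; [|now apply HQ].
      apply (is_nabla_derive_anti_delta I a b); auto. intros Hr.
      (* The momentum hypotheses enter here, at a left-dense [t]; at a left-scattered one the
         derivative is read off the gap. *)
      pose proof (upper_kappa_left_dense I t It Hr) as Ku.
      apply continuous_within_lin; now apply (delta_EL_continuous_within T I a b). }
    assert (DC : is_nabla_derive I (fun s => 1 * P s + 1 * Q s) t
      (c * 1 + (P a + Q a - c * a) * 0)).
    { apply (is_nabla_derive_ext I a b (fun s => c * s + (P a + Q a - c * a) * 1)); auto.
      apply is_nabla_derive_lin; [apply is_nabla_derive_id|apply is_nabla_derive_const]. }
    pose proof (is_nabla_derive_unique I a b _ t _ _ HI Kt DA DC) as E.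
    unfold p, q in E. lra.
  - pose proof (upper_kappa_in _ _ Kt) as It.
    assert (DA : is_delta_derive I (fun s => 1 * P s + 1 * Q s) t
      (1 * p t + 1 * q (sigma_ts I t))).
    { apply is_delta_derive_lin; [now apply HP|].
      apply (is_delta_derive_anti_nabla I a b); auto. intros Hs.
      pose proof (lower_kappa_right_dense I t It Hs) as Kl.
      apply continuous_within_lin; now apply (nabla_EL_continuous_within T I a b). }
    assert (DC : is_delta_derive I (fun s => 1 * P s + 1 * Q s) t
      (c * 1 + (P a + Q a - c * a) * 0)).
    { apply (is_delta_derive_ext I a b (fun s => c * s + (P a + Q a - c * a) * 1)); auto.
      apply is_delta_derive_lin; [apply is_delta_derive_id|apply is_delta_derive_const]. }
    pose proof (is_delta_derive_unique I a b _ t _ _ HI Kt DA DC) as E.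
    unfold p, q in E. lra.
Qed.
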